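(* Over $\mathsf{RCA}_0$ the following are equivalent: (1) $\mathsf{ACA}_0$; (2) let $(V,E)$ be a connected reflexive graph, triangulated and with no asteroidal triples; if $a,b,c,d\in V$ are such that $(a,b),(c,d)\in W$, $(a,b)$ and $(c,d)$ are not connected by a path in $(W,Q)$, and $(a,b)$ and $(d,c)$ are not connected by a path in $(W,Q)$, then there exists a buried subgraph $B\subseteq V$ such that either $a,b\in B$ or $c,d\in B$, and no proper subset $A\subsetneq B$ containing $a,b$ (respectively $c,d$) is a buried subgraph; (3) let $(V,E)$ be a connected closed interval graph; if $(W,Q)$ has more than two connected components, then there exists a buried subgraph $B\subseteq V$; (4) let $(V,E)$ be a connected closed interval graph; if $(V,E)$ is not uniquely orderable, then there exists a buried subgraph $B\subseteq V$.
   Context: Reverse mathematics in second order arithmetic; $\mathsf{RCA}_0$, $\mathsf{ACA}_0$ are the standard subsystems. Graphs are countable, coded by $V\subseteq\mathbb{N}$ and symmetric $E\subseteq V\times V$; connected means any two vertices are joined by a finite path. Triangulated: every simple cycle of length $\ge4$ has a chord (an edge $(v_i,v_j)$ with $2\le j-i\le n-2$ in a simple cycle $v_0\,E\cdots E\,v_n=v_0$). Asteroidal triple: three pairwise non-adjacent vertices any two of which are joined by a path avoiding all vertices adjacent to the third. A closed interval graph is a graph $(V,E)$ with a linear order $(L,<_L)$ and functions $f_L,f_R\colon V\to L$ such that $f_L(p)<_L f_R(p)$ and $p\,E\,q\iff f_L(p)\le_L f_R(q)\le_L f_R(p)\ \lor\ f_L(q)\le_L f_R(p)\le_L f_R(q)$.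 $W=\{(x,y)\in V\times V\mid\neg\,x\,E\,y\}$ and $(x,y)\,Q\,(z,t)$ iff $x\,E\,z$ and $y\,E\,t$. A strict partial order $\prec$ is associated to $(V,E)$ if $\neg\,u\,E\,v$ iff ($u\prec v$ or $v\prec u$); $(V,E)$ is uniquely orderable if it has an associated order and the only other one is its dual. For $B\subseteq V$, $K(B)=\{x\mid\forall b\in B\,(x\,E\,b)\}$, $R(B)=V\setminus(B\cup K(B))$; $B$ is a buried subgraph if (i) some $x,y\in B$ satisfy $\neg\,x\,E\,y$; (ii) $K(B)\cap B=\emptyset$ and $R(B)\ne\emptyset$; (iii) $\neg\,b\,E\,r$ for all $b\in B$, $r\in R(B)$. *)

(* Defs.v *)
From mathcomp Require Import all_boot.

Set Implicit Arguments.
Unset Strict Implicit.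
Unset Printing Implicit Defensive.

(** * Structures for the language of second order arithmetic

    These are the two-sorted ("general") structures: the number sort need not
    be the standard natural numbers, and the set sort is any nonempty
    collection of subsets of the number sort.  By the completeness theorem,
    RCA_0 proves a sentence iff the sentence holds in all such structures that
    satisfy the axioms of RCA_0. *)

Record L2_structure : Type := L2Structure {
  num :> Type;
  zero : num;
  one : num;
  add : num -> num -> num;
  mul : num -> num -> num;
  lt : num -> num -> Prop;
  is_set : (num -> Prop) -> Prop;
  is_set_inhabited : exists X, is_set X
}.

Arguments zero {_}.
Arguments one {_}.
Arguments add {_} _ _.
Arguments mul {_} _ _.
Arguments lt {_} _ _.
Arguments is_set {_} _.

Declare Scope L2_scope.
Delimit Scope L2_scope with L2.
Bind Scope L2_scope with num.

Notation "0" := zero : L2_scope.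
Notation "1" := one : L2_scope.
Notation "2" := (add one one) : L2_scope.
Notation "4" := (add (add one one) (add one one)) : L2_scope.
Notation "x + y" := (add x y) : L2_scope.
Notation "x * y" := (mul x y) : L2_scope.
Notation "x < y" := (lt x y) : L2_scope.
Notation "x <= y" := (lt x y \/ x = y) : L2_scope.

Local Open Scope L2_scope.

(** * Arithmetical formulas

    De Bruijn indices for number variables; set variables are numbered
    separately and are always free (they are the set parameters), so the type
    [formula] consists exactly of the arithmetical formulas. *)

Inductive term : Type :=
| t_var (i : nat)
| t_zero
| t_one
| t_add (t u : term)
| t_mul (t u : term).

Inductive formula : Type :=
| f_eq (t u : term)
| f_lt (t u : term)
| f_mem (t : term) (X : nat)
| f_not (p : formula)
| f_and (p q : formula)
| f_or (p q : formula)
| f_imp (p q : formula)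
| f_all (p : formula)
| f_ex (p : formula).

Fixpoint shift (t : term) : term :=
  match t with
  | t_var i => t_var (S i)
  | t_zero => t_zero
  | t_one => t_one
  | t_add t u => t_add (shift t) (shift u)
  | t_mul t u => t_mul (shift t) (shift u)
  end.

(** The bound of a bounded quantifier must not contain the quantified variable,
    hence [shift t]. *)
Inductive bounded : formula -> Prop :=
| bounded_eq t u : bounded (f_eq t u)
| bounded_lt t u : bounded (f_lt t u)
| bounded_mem t X : bounded (f_mem t X)
| bounded_not p : bounded p -> bounded (f_not p)
| bounded_and p q : bounded p -> bounded q -> bounded (f_and p q)
| bounded_or p q : bounded p -> bounded q -> bounded (f_or p q)
| bounded_imp p q : bounded p -> bounded q -> bounded (f_imp p q)
| bounded_all t p :
    bounded p -> bounded (f_all (f_imp (f_lt (t_var 0) (shift t)) p))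
| bounded_ex t p :
    bounded p -> bounded (f_ex (f_and (f_lt (t_var 0) (shift t)) p)).

Definition Sigma01 (p : formula) : Prop := exists2 q, p = f_ex q & bounded q.
Definition Pi01 (p : formula) : Prop := exists2 q, p = f_all q & bounded q.

Definition scons (T : Type) (x : T) (e : nat -> T) : nat -> T :=
  fun i => match i with O => x | S j => e j end.

Fixpoint eval (M : L2_structure) (e : nat -> M) (t : term) : M :=
  match t with
  | t_var i => e i
  | t_zero => 0
  | t_one => 1
  | t_add t u => eval e t + eval e u
  | t_mul t u => eval e t * eval e u
  end.

Fixpoint sat (M : L2_structure) (s : nat -> M -> Prop) (e : nat -> M)
    (p : formula) : Prop :=
  match p with
  | f_eq t u => eval e t = eval e u
  | f_lt t u => eval e t < eval e u
  | f_mem t X => s X (eval e t)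
  | f_not p => ~ sat s e p
  | f_and p q => sat s e p /\ sat s e q
  | f_or p q => sat s e p \/ sat s e q
  | f_imp p q => sat s e p -> sat s e q
  | f_all p => forall x : M, sat s (scons x e) p
  | f_ex p => exists x : M, sat s (scons x e) p
  end.

(** * The systems RCA_0 and ACA_0

    [s] and [e] interpret the set and number parameters of the instances;
    number variable 0 is the variable of induction or comprehension. *)

Record basic_axioms (M : L2_structure) : Prop := {
  succ_neq0 : forall n : M, n + 1 <> 0;
  succ_inj : forall m n : M, m + 1 = n + 1 -> m = n;
  add_0 : forall m : M, m + 0 = m;
  add_succ : forall m n : M, m + (n + 1) = (m + n) + 1;
  mul_0 : forall m : M, m * 0 = 0;
  mul_succ : forall m n : M, m * (n + 1) = m * n + m;
  nlt_0 : forall m : M, ~ m < 0;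
  lt_succ : forall m n : M, m < n + 1 <-> m < n \/ m = n
}.

Definition Sigma01_induction (M : L2_structure) : Prop :=
  forall (s : nat -> M -> Prop) (e : nat -> M) (p : formula),
    (forall i, is_set (s i)) -> Sigma01 p ->
    sat s (scons 0 e) p ->
    (forall n : M, sat s (scons n e) p -> sat s (scons (n + 1) e) p) ->
    forall n : M, sat s (scons n e) p.

Definition Delta01_comprehension (M : L2_structure) : Prop :=
  forall (s : nat -> M -> Prop) (e : nat -> M) (p q : formula),
    (forall i, is_set (s i)) -> Sigma01 p -> Pi01 q ->
    (forall n : M, sat s (scons n e) p <-> sat s (scons n e) q) ->
    exists2 X : M -> Prop,
      is_set X & forall n : M, X n <-> sat s (scons n e) p.

Definition set_induction (M : L2_structure) : Prop :=
  forall X : M -> Prop, is_set X ->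
    X 0 -> (forall n : M, X n -> X (n + 1)) -> forall n : M, X n.

Definition arithmetical_comprehension (M : L2_structure) : Prop :=
  forall (s : nat -> M -> Prop) (e : nat -> M) (p : formula),
    (forall i, is_set (s i)) ->
    exists2 X : M -> Prop,
      is_set X & forall n : M, X n <-> sat s (scons n e) p.

Definition RCA0 (M : L2_structure) : Prop :=
  [/\ basic_axioms M, Sigma01_induction M & Delta01_comprehension M].

Definition ACA0 (M : L2_structure) : Prop :=
  [/\ basic_axioms M, set_induction M & arithmetical_comprehension M].

(** * Coding inside a structure *)

Section Coding.
Variable M : L2_structure.
Implicit Types (x y z i j k l m n s : M) (X Y F : M -> Prop).

Definition npair x y : M := (x + y) * (x + y) + x.

Definition related X x y : Prop := X (npair x y).

Definition subclass X Y : Prop := forall x, X x -> Y x.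

(** [X] is a set of pairs contained in the product of [Y] and [Z]. *)
Definition subset_prod X Y (Z : M -> Prop) : Prop :=
  forall z, X z -> exists x y, [/\ z = npair x y, Y x & Z y].

(** Goedel's beta function: the number [npair k (npair m n)] codes the finite set
    of all [i < k] such that [m * (i + 1) + 1] divides [n].  A finite set has
    several codes, which is harmless below. *)
Definition in_code s i : Prop :=
  exists k m n, [/\ s = npair k (npair m n), i < k &
                    exists q, n = q * (m * (i + 1) + 1)].

(** [s] codes a finite sequence whose [i]-th entry is [x] iff [at_ s i x]. *)
Definition at_ s i x : Prop := in_code s (npair i x).

Definition is_seq s l : Prop :=
  [/\ forall z, in_code s z -> exists i x, z = npair i x,
      forall i x y, at_ s i x -> at_ s i y -> x = y &
      forall i, i < l <-> exists x, at_ s i x].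

Definition is_function F X Y : Prop :=
  [/\ is_set F, subset_prod F X Y,
      forall x, X x -> exists y, related F x y &
      forall x y z, related F x y -> related F x z -> y = z].

(** [s] codes a path with [n] edges (hence [n + 1] entries) from [x] to [y] in
    the relation [Rl]. *)
Definition is_path (Rl : M -> M -> Prop) s n x y : Prop :=
  [/\ is_seq s (n + 1), at_ s 0 x, at_ s n y &
      forall i u v, i < n -> at_ s i u -> at_ s (i + 1) v -> Rl u v].

Definition joined (Rl : M -> M -> Prop) x y : Prop :=
  exists s n, is_path Rl s n x y.

End Coding.

(** * Graphs *)

Section Graphs.
Variable M : L2_structure.
Implicit Types (V E B P : M -> Prop) (a b c u v x y z w : M).

Definition is_graph V E : Prop :=
  [/\ is_set V, is_set E, subset_prod E V V &
      forall x y, related E x y -> related E y x].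

Definition reflexive_graph V E : Prop := forall x, V x -> related E x x.

Definition connected_graph V E : Prop :=
  forall x y, V x -> V y -> joined (related E) x y.

Definition simple_cycle E (s n : M) : Prop :=
  (exists x, is_path (related E) s n x x) /\
  (forall i j u, i < n -> j < n -> at_ s i u -> at_ s j u -> i = j).

(** [i + 2 <= j] and [j + 2 <= i + n] express [2 <= j - i <= n - 2]. *)
Definition has_chord E (s n : M) : Prop :=
  exists i j u v, [/\ at_ s i u, at_ s j v, related E u v,
                      i + 2 <= j & j + 2 <= i + n].

Definition triangulated E : Prop :=
  forall s n : M, 4 <= n -> simple_cycle E s n -> has_chord E s n.

Definition joined_avoiding E c x y : Prop :=
  exists s n, is_path (related E) s n x y /\
              forall i u, at_ s i u -> ~ related E u c.

Definition asteroidal_triple V E a b c : Prop :=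
  [/\ [/\ V a, V b & V c],
      [/\ a <> b, b <> c & a <> c],
      [/\ ~ related E a b, ~ related E b c & ~ related E a c] &
      [/\ joined_avoiding E c a b, joined_avoiding E a b c &
          joined_avoiding E b a c]].

Definition is_linear_order (L lt_L : M -> Prop) : Prop :=
  [/\ [/\ is_set L, is_set lt_L & subset_prod lt_L L L],
      forall x, ~ related lt_L x x,
      forall x y z, related lt_L x y -> related lt_L y z -> related lt_L x z &
      forall x y, L x -> L y -> [\/ related lt_L x y, x = y | related lt_L y x]].

Definition closed_interval_graph V E : Prop :=
  is_graph V E /\
  exists L lt_L f_L f_R : M -> Prop,
    let le_L x y := related lt_L x y \/ x = y in
    [/\ is_linear_order L lt_L, is_function f_L V L, is_function f_R V L,
        forall p lp rp : M, related f_L p lp -> related f_R p rp -> related lt_L lp rp &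
        forall p q lp rp lq rq : M,
          related f_L p lp -> related f_R p rp -> related f_L q lq -> related f_R q rq ->
          (related E p q <->
           (le_L lp rq /\ le_L rq rp) \/ (le_L lq rp /\ le_L rp rq))].

Definition W V E z : Prop :=
  exists x y, [/\ z = npair x y, V x, V y & ~ related E x y].

Definition Q V E z w : Prop :=
  [/\ W V E z, W V E w &
      exists x y u v, [/\ z = npair x y, w = npair u v, related E x u & related E y v]].

Definition more_than_two_components V E : Prop :=
  exists z1 z2 z3 : M,
    [/\ W V E z1, W V E z2 & W V E z3] /\
    [/\ ~ joined (Q V E) z1 z2, ~ joined (Q V E) z1 z3 &
        ~ joined (Q V E) z2 z3].

Definition is_strict_order V P : Prop :=
  [/\ is_set P, subset_prod P V V, forall x, ~ related P x x &
      forall x y z, related P x y -> related P y z -> related P x z].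

Definition associated_order V E P : Prop :=
  is_strict_order V P /\
  forall u v, V u -> V v -> (~ related E u v <-> related P u v \/ related P v u).

(** An order may coincide with its dual: this happens iff it is empty, so that
    complete graphs are uniquely orderable. *)
Definition uniquely_orderable V E : Prop :=
  exists P, associated_order V E P /\
    forall P', associated_order V E P' ->
      (forall u v, related P' u v <-> related P u v) \/
      (forall u v, related P' u v <-> related P v u).

(** [K] and [R] are classes; they need not belong to the structure. *)
Definition K V E B x : Prop := V x /\ forall b, B b -> related E x b.
Definition R V E B x : Prop := V x /\ ~ (B x \/ K V E B x).

Definition buried V E B : Prop :=
  [/\ is_set B /\ subclass B V,
      exists x y, [/\ B x, B y & ~ related E x y],
      (forall x, ~ (K V E B x /\ B x)) /\ (exists r, R V E B r) &
      forall b r, B b -> R V E B r -> ~ related E b r].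

Definition minimal_buried V E B a b : Prop :=
  [/\ buried V E B, B a, B b &
      forall A : M -> Prop, is_set A -> subclass A B -> ~ subclass B A ->
        A a -> A b -> ~ buried V E A].

End Graphs.

Definition separated_pairs_buried (M : L2_structure) : Prop :=
  forall V E : M -> Prop,
    is_graph V E -> reflexive_graph V E -> connected_graph V E ->
    triangulated E -> (forall a b c, ~ asteroidal_triple V E a b c) ->
    forall a b c d : M, V a -> V b -> V c -> V d ->
      W V E (npair a b) -> W V E (npair c d) ->
      ~ joined (Q V E) (npair a b) (npair c d) ->
      ~ joined (Q V E) (npair a b) (npair d c) ->
      exists B : M -> Prop,
        minimal_buried V E B a b \/ minimal_buried V E B c d.

Definition many_components_buried (M : L2_structure) : Prop :=
  forall V E : M -> Prop,
    closed_interval_graph V E -> connected_graph V E ->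
    more_than_two_components V E ->
    exists B : M -> Prop, buried V E B.

Definition not_uniquely_orderable_buried (M : L2_structure) : Prop :=
  forall V E : M -> Prop,
    closed_interval_graph V E -> connected_graph V E ->
    ~ uniquely_orderable V E ->
    exists B : M -> Prop, buried V E B.

(* Main.v *)
Require Import Defs.
From mathcomp Require Import all_boot.
From Stdlib Require Import Ring Classical FunctionalExtensionality PropExtensionality.

Set Implicit Arguments.
Unset Strict Implicit.
Unset Printing Implicit Defensive.

Local Open Scope L2_scope.

(** Call two nonadjacent pairs equally colored if [(W, Q)] joins the first one to the
    second one or to its reversal, and let the span of a pair be the set of all
    vertices of the pairs of its color.

    (1) => (2): with [ACA_0] spans are sets. A span is a module of the graph and lies
    inside every buried subgraph containing the pair, because there is no induced
    4-cycle. So if neither of the two given spans is buried, each of them is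
    dominated by all vertices outside it; the absence of induced 4-cycles then makes
    the two spans equal, and by Gallai's triangle lemma the two pairs have the same
    color.

    (2) => (3): in an interval graph the two neighbours, on a cycle, of the vertex
    whose interval ends first are adjacent, and of three disjoint intervals the middle
    one separates the other two.

    (3) => (4): an associated order is preserved along [Q], so with only two components
    it is determined by its value at one pair.

    (4) => (1): given an enumeration [D], a vertex [(x, s)] guesses that no number below
    [x - 1] is enumerated after stage [s + 2]. Its interval starts together with an
    infinite induced path of intervals [0, 1, 2, ...] and ends when the guess is
    refuted, which places all right ends in a computable linear order. After adding
    a universal vertex and a pendant to it on the left, the only buried subgraph
    consists of the path and of the refuted guesses, and it computes the range of the
    enumeration. *)

(** * Bounded predicates *)

(** Under $\mathsf{RCA}_0$ the components of [(W, Q)] may fail to be sets, and an induction along a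
    coded path requires an invariant that is a set. So outside (1) => (2) nothing is proved by
    induction on a component; the invariants are [bef], an associated order, or one side of a
    vertex. To check such invariants without writing formulas, boundedness is tracked on Rocq
    predicates by [D0]; object-level formulas matter only where the axiom schemes are applied or
    derived.

    In the reversal, the time at which a guess is refuted cannot be computed, yet the right ends
    must be ordered by a set. Two features make the order decidable: a guess [(x, s)] is never
    injured up to time [s + 2], and an enumeration that comes late enough for both of two guesses
    injures the one with larger first coordinate whenever it injures the other. Hence two guesses
    need to be compared only up to a time computed from their stages. The pendant is what destroys
    unique orderability, since it can be moved from the left of the graph to its right; the
    universal vertex keeps it connected to the rest. *)

Fixpoint ren_term (f : nat -> nat) (t : term) : term :=
  match t with
  | t_var i => t_var (f i)
  | t_zero => t_zero
  | t_one => t_one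
  | t_add t u => t_add (ren_term f t) (ren_term f u)
  | t_mul t u => t_mul (ren_term f t) (ren_term f u)
  end.

Definition lift_ren (f : nat -> nat) (i : nat) : nat :=
  match i with O => O | S j => S (f j) end.

Fixpoint ren (f g : nat -> nat) (p : formula) : formula :=
  match p with
  | f_eq t u => f_eq (ren_term f t) (ren_term f u)
  | f_lt t u => f_lt (ren_term f t) (ren_term f u)
  | f_mem t X => f_mem (ren_term f t) (g X)
  | f_not p => f_not (ren f g p)
  | f_and p q => f_and (ren f g p) (ren f g q)
  | f_or p q => f_or (ren f g p) (ren f g q)
  | f_imp p q => f_imp (ren f g p) (ren f g q)
  | f_all p => f_all (ren (lift_ren f) g p)
  | f_ex p => f_ex (ren (lift_ren f) g p)
  end.

Lemma ren_shift f t : ren_term (lift_ren f) (shift t) = shift (ren_term f t).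
Proof. by elim: t => //= [t -> u ->|t -> u ->]. Qed.

Lemma bounded_ren f g p : bounded p -> bounded (ren f g p).
Proof.
move=> bp; elim: bp f => /=; try by constructor.
- by move=> t {}p _ IH f; rewrite ren_shift; constructor.
- by move=> t {}p _ IH f; rewrite ren_shift; constructor.
Qed.

Section Semantics.
Variable M : L2_structure.
Implicit Types (e c : nat -> M) (s : nat -> M -> Prop).

Lemma predext (T : Type) (P P' : T -> Prop) : (forall x, P x <-> P' x) -> P = P'.
Proof.
move=> h; apply: functional_extensionality => x.
by apply: propositional_extensionality.
Qed.

Lemma eval_ren f t e : eval e (ren_term f t) = eval (fun i => e (f i)) t.
Proof. by elim: t => //= [t -> u ->|t -> u ->]. Qed.

Lemma eval_shift t x e : eval (scons x e) (shift t) = eval e t.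
Proof. by elim: t => //= [t -> u ->|t -> u ->]. Qed.

Lemma scons_lift f x e :
  (fun i => scons x e (lift_ren f i)) = scons x (fun i => e (f i)).
Proof. by apply: functional_extensionality => -[]. Qed.

Lemma sat_ren f g p s e :
  sat s e (ren f g p) <-> sat (fun i => s (g i)) (fun i => e (f i)) p.
Proof.
elim: p f e => /=.
- by move=> t u f e; rewrite !eval_ren.
- by move=> t u f e; rewrite !eval_ren.
- by move=> t X f e; rewrite !eval_ren.
- by move=> p IH f e; rewrite IH.
- by move=> p IHp q IHq f e; rewrite IHp IHq.
- by move=> p IHp q IHq f e; rewrite IHp IHq.
- by move=> p IHp q IHq f e; rewrite IHp IHq.
- by move=> p IH f e; split=> h x; move: (h x); rewrite IH scons_lift.
- by move=> p IH f e; split=> -[x]; rewrite ?IH ?scons_lift => h;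
    exists x; rewrite ?IH ?scons_lift.
Qed.

(** Number parameters sit at odd indices, the genuine variables at even ones. *)
Definition mix (T : Type) (e c : nat -> T) (i : nat) : T :=
  if odd i then c i./2 else e i./2.

Lemma mix_even T (e c : nat -> T) i : mix e c i.*2 = e i.
Proof. by rewrite /mix odd_double doubleK. Qed.

Lemma mix_odd T (e c : nat -> T) i : mix e c i.*2.+1 = c i.
Proof. by rewrite /mix /= odd_double /= uphalf_double. Qed.

Definition to_params (h : nat -> nat) (i : nat) : nat :=
  if odd i then (h i./2).*2.+1 else i.

Lemma mix_to_params e c h :
  (fun i => mix e c (to_params h i)) = mix e (fun i => c (h i)).
Proof.
apply: functional_extensionality => i; rewrite /to_params.
by case: ifP => hi; rewrite ?mix_odd /mix ?hi.
Qed.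

(** In [scons x (mix e c)] the bound variable has index 0 and all others move up by one, whereas
    [mix (scons x e) c] moves only the genuine variables, by two. So parameters go one up and
    genuine variables one down; [0.-1 = 0] serves the bound variable itself. *)
Definition under_binder (i : nat) : nat :=
  if odd i then i.+1 else i.-1.

Lemma scons_mix x e c :
  (fun i => scons x (mix e c) (under_binder i)) = mix (scons x e) c.
Proof.
apply: functional_extensionality => i; rewrite /under_binder.
case: ifP => hi; rewrite -(odd_double_half i) hi ?add1n ?add0n.
  rewrite [RHS]mix_odd /=; exact: mix_odd.
rewrite mix_even; case: (i./2) => [|j] //.
by rewrite doubleS /= mix_even.
Qed.

Inductive term_fun : ((nat -> M) -> M) -> Prop :=
| TF_var i : term_fun (fun e => e i)
| TF_const a : term_fun (fun _ => a)
| TF_add t u : term_fun t -> term_fun u -> term_fun (fun e => t e + u e)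
| TF_mul t u : term_fun t -> term_fun u -> term_fun (fun e => t e * u e).

Definition tail (T : Type) (e : nat -> T) : nat -> T := fun i => e (S i).

(** A shallow version of the bounded formulas with parameters: number parameters are elements
    captured by the Rocq function, set parameters are the [X] with [is_set X]. The bounding term is
    evaluated in the outer environment, which replaces [shift]. Bodies have the curried form
    [P e x], so that ordinary Rocq statements match up to conversion. *)
Inductive D0 : ((nat -> M) -> Prop) -> Prop :=
| D0_eq t u : term_fun t -> term_fun u -> D0 (fun e => t e = u e)
| D0_lt t u : term_fun t -> term_fun u -> D0 (fun e => t e < u e)
| D0_mem X t : is_set X -> term_fun t -> D0 (fun e => X (t e))
| D0_not P : D0 P -> D0 (fun e => ~ P e)
| D0_and P P' : D0 P -> D0 P' -> D0 (fun e => P e /\ P' e)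
| D0_or P P' : D0 P -> D0 P' -> D0 (fun e => P e \/ P' e)
| D0_imp P P' : D0 P -> D0 P' -> D0 (fun e => P e -> P' e)
| D0_all t P : term_fun t -> D0 (fun e => P (tail e) (e O)) ->
    D0 (fun e => forall x, x < t e -> P e x)
| D0_ex t P : term_fun t -> D0 (fun e => P (tail e) (e O)) ->
    D0 (fun e => exists x, x < t e /\ P e x).

Lemma D0_ext P P' : (forall e, P e <-> P' e) -> D0 P -> D0 P'.
Proof. by move=> h; rewrite (predext h). Qed.

Lemma term_fun_sound T : term_fun T ->
  exists c t, forall e, T e = eval (mix e c) t.
Proof.
elim=> {T}.
- by move=> i; exists (fun _ => 0), (t_var i.*2) => e /=; rewrite mix_even.
- by move=> a; exists (fun _ => a), (t_var 1) => e.
- move=> t u _ [c [t' h]] _ [d [u' k]].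
  exists (mix c d), (t_add (ren_term (to_params (fun i => i.*2)) t')
                           (ren_term (to_params (fun i => i.*2.+1)) u')) => e /=.
  rewrite !eval_ren !mix_to_params h k.
  by congr (eval (mix _ _) _ + eval (mix _ _) _);
    apply: functional_extensionality => i; rewrite ?mix_even ?mix_odd.
- move=> t u _ [c [t' h]] _ [d [u' k]].
  exists (mix c d), (t_mul (ren_term (to_params (fun i => i.*2)) t')
                           (ren_term (to_params (fun i => i.*2.+1)) u')) => e /=.
  rewrite !eval_ren !mix_to_params h k.
  by congr (eval (mix _ _) _ * eval (mix _ _) _);
    apply: functional_extensionality => i; rewrite ?mix_even ?mix_odd.
Qed.

Definition defined_by (P : (nat -> M) -> Prop) s c (p : formula) : Prop :=
  [/\ forall i, is_set (s i), bounded p & forall e, P e <-> sat s (mix e c) p].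

Lemma defined_by_left P s c p s' c' : (forall i, is_set (s' i)) ->
  defined_by P s c p ->
  defined_by P (mix s s') (mix c c')
    (ren (to_params (fun i => i.*2)) (fun i => i.*2) p).
Proof.
move=> hs' [hs bp h]; split.
- by move=> i; rewrite /mix; case: ifP.
- exact: bounded_ren.
- move=> e; rewrite sat_ren mix_to_params h.
  have -> : (fun i => mix s s' i.*2) = s
    by apply: functional_extensionality => i; rewrite mix_even.
  have -> // : (fun i => mix c c' i.*2) = c
    by apply: functional_extensionality => i; rewrite mix_even.
Qed.

Lemma defined_by_right P s c p s' c' : (forall i, is_set (s i)) ->
  defined_by P s' c' p ->
  defined_by P (mix s s') (mix c c')
    (ren (to_params (fun i => i.*2.+1)) (fun i => i.*2.+1) p).
Proof.
move=> hs' [hs bp h]; split.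
- by move=> i; rewrite /mix; case: ifP.
- exact: bounded_ren.
- move=> e; rewrite sat_ren mix_to_params h.
  have -> : (fun i => mix s s' i.*2.+1) = s'
    by apply: functional_extensionality => i; rewrite mix_odd.
  have -> // : (fun i => mix c c' i.*2.+1) = c'
    by apply: functional_extensionality => i; rewrite mix_odd.
Qed.

Lemma defined_by_common P P' s c p s' c' p' :
  defined_by P s c p -> defined_by P' s' c' p' ->
  exists s0 c0 q q', defined_by P s0 c0 q /\ defined_by P' s0 c0 q'.
Proof.
move=> h h'; case: (h) (h') => hs _ _ [hs' _ _].
by do 4!eexists; split; [exact: (defined_by_left c' hs' h) |
  exact: (defined_by_right c hs h')].
Qed.

Lemma sat_under_binder s x e c p :
  sat s (scons x (mix e c)) (ren under_binder id p) <-> sat s (mix (scons x e) c) p.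
Proof. by rewrite sat_ren scons_mix. Qed.

Lemma term_le_sound t P s c p : term_fun t -> defined_by P s c p ->
  exists s0 c0 u q, defined_by P s0 c0 q /\ forall e, t e = eval (mix e c0) u.
Proof.
move=> /term_fun_sound [d [u hu]] h; case: (h) => hs _ _.
exists (mix s s), (mix c d), (ren_term (to_params (fun i => i.*2.+1)) u).
eexists; split; first exact: defined_by_left h.
move=> e; rewrite eval_ren mix_to_params hu; congr (eval (mix _ _) _).
by apply: functional_extensionality => i; rewrite mix_odd.
Qed.

Lemma term2_sound t u : term_fun t -> term_fun u ->
  exists c t' u', (forall e, t e = eval (mix e c) t') /\
    (forall e, u e = eval (mix e c) u').
Proof.
move=> /term_fun_sound [c [t' h]] /term_fun_sound [d [u' k]].
exists (mix c d), (ren_term (to_params (fun i => i.*2)) t'),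
  (ren_term (to_params (fun i => i.*2.+1)) u').
by split=> e; rewrite eval_ren mix_to_params ?h ?k; congr (eval (mix _ _) _);
  apply: functional_extensionality => i; rewrite ?mix_even ?mix_odd.
Qed.

(** Each subformula comes with its own lists of parameters; [defined_by_common] interleaves two such
    lists, so that one formula can contain both parts. *)
Lemma D0_sound P : D0 P -> exists s c p, defined_by P s c p.
Proof.
have [Z hZ] := is_set_inhabited M.
elim=> {P}.
- move=> t u /term2_sound h /h [c [t' [u' [ht hu]]]].
  exists (fun _ => Z), c, (f_eq t' u'); split=> //; first by constructor.
  by move=> e; rewrite ht hu.
- move=> t u /term2_sound h /h [c [t' [u' [ht hu]]]].
  exists (fun _ => Z), c, (f_lt t' u'); split=> //; first by constructor.
  by move=> e; rewrite ht hu.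
- move=> X t hX /term_fun_sound [c [t' h]].
  exists (fun _ => X), c, (f_mem t' 0%N); split=> //; first by constructor.
  by move=> e; rewrite h.
- move=> P _ [s [c [p [hs bp h]]]]; exists s, c, (f_not p); split=> //.
    by constructor.
  by move=> e; rewrite h.
- move=> P P' _ [s [c [p h]]] _ [s' [c' [p' h']]].
  have [s0 [c0 [q [q' [[hs bq hq] [_ bq' hq']]]]]] := defined_by_common h h'.
  exists s0, c0, (f_and q q'); split=> //; first by constructor.
  by move=> e; rewrite hq hq'.
- move=> P P' _ [s [c [p h]]] _ [s' [c' [p' h']]].
  have [s0 [c0 [q [q' [[hs bq hq] [_ bq' hq']]]]]] := defined_by_common h h'.
  exists s0, c0, (f_or q q'); split=> //; first by constructor.
  by move=> e; rewrite hq hq'.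
- move=> P P' _ [s [c [p h]]] _ [s' [c' [p' h']]].
  have [s0 [c0 [q [q' [[hs bq hq] [_ bq' hq']]]]]] := defined_by_common h h'.
  exists s0, c0, (f_imp q q'); split=> //; first by constructor.
  by move=> e; rewrite hq hq'.
- move=> t P ht _ [s [c [p h]]].
  have [s0 [c0 [u [q [[hs bq hq] hu]]]]] := term_le_sound ht h.
  exists s0, c0, (f_all (f_imp (f_lt (t_var 0) (shift u)) (ren under_binder id q))).
  split=> //; first by constructor; exact: bounded_ren.
  move=> e /=; split=> [k x|k x hx].
    by rewrite eval_shift -hu => /k hP; rewrite sat_under_binder -hq.
  by move: (k x); rewrite eval_shift -hu sat_under_binder -hq; apply.
- move=> t P ht _ [s [c [p h]]].
  have [s0 [c0 [u [q [[hs bq hq] hu]]]]] := term_le_sound ht h.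
  exists s0, c0, (f_ex (f_and (f_lt (t_var 0) (shift u)) (ren under_binder id q))).
  split=> //; first by constructor; exact: bounded_ren.
  move=> e /=; split=> [[x [hx k]]|[x [hx k]]]; exists x.
    by rewrite eval_shift -hu sat_under_binder -hq.
  by move: hx k; rewrite eval_shift -hu sat_under_binder -hq.
Qed.

Lemma term_fun_ren T f : term_fun T -> term_fun (fun e => T (fun i => e (f i))).
Proof. by elim=> {T}; intros; constructor. Qed.

Definition lift_sub (f : nat -> (nat -> M) -> M) (i : nat) (e : nat -> M) : M :=
  match i with O => e O | S j => f j (tail e) end.

Lemma term_fun_sub T f : (forall i, term_fun (f i)) -> term_fun T ->
  term_fun (fun e => T (fun i => f i e)).
Proof. by move=> hf; elim=> {T} //; intros; constructor. Qed.

Lemma D0_sub P f : (forall i, term_fun (f i)) -> D0 P ->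
  D0 (fun e => P (fun i => f i e)).
Proof.
move=> hf h; elim: h f hf => {P};
  try by intros; constructor; auto; exact: term_fun_sub.
- move=> t P ht _ IH f hf; apply: D0_all (term_fun_sub hf ht) (IH (lift_sub f) _).
  by case=> [|i]; [exact: TF_var | exact: term_fun_ren].
- move=> t P ht _ IH f hf; apply: D0_ex (term_fun_sub hf ht) (IH (lift_sub f) _).
  by case=> [|i]; [exact: TF_var | exact: term_fun_ren].
Qed.

Lemma D0_ren P f : D0 P -> D0 (fun e => P (fun i => e (f i))).
Proof. by apply: (D0_sub (f := fun i e => e (f i))) => i; exact: TF_var. Qed.

Lemma D0_app1 (P : M -> Prop) t : term_fun t ->
  D0 (fun e => P (e O)) -> D0 (fun e => P (t e)).
Proof. by move=> ht; apply: (D0_sub (f := fun i => t)). Qed.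

Lemma D0_app2 (A : M -> M -> Prop) t u : term_fun t -> term_fun u ->
  D0 (fun e => A (e O) (e 1%N)) -> D0 (fun e => A (t e) (u e)).
Proof.
move=> ht hu; apply: (D0_sub (f := fun i => if i is O then t else u)).
by case.
Qed.

Lemma D0_app3 (A : M -> M -> M -> Prop) t u v : term_fun t -> term_fun u ->
  term_fun v -> D0 (fun e => A (e O) (e 1%N) (e 2%N)) -> D0 (fun e => A (t e) (u e) (v e)).
Proof.
move=> ht hu hv.
apply: (D0_sub (f := fun i => match i with O => t | 1%N => u | _ => v end)).
by case=> [|[]].
Qed.

Lemma D0_and3 P P' P'' : D0 P -> D0 P' -> D0 P'' ->
  D0 (fun e => [/\ P e, P' e & P'' e]).
Proof.
move=> h h' h''; apply: D0_ext (D0_and h (D0_and h' h'')) => e.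
by split=> [[? []]|[? ? ?]].
Qed.

Lemma D0_and4 P P' P'' P''' : D0 P -> D0 P' -> D0 P'' -> D0 P''' ->
  D0 (fun e => [/\ P e, P' e, P'' e & P''' e]).
Proof.
move=> h h' h'' h'''; apply: D0_ext (D0_and (D0_and h h') (D0_and h'' h''')) => e.
by split=> [[[? ?] []]|[? ? ? ?]].
Qed.

Lemma D0_exb t (P : (nat -> M) -> M -> Prop) : term_fun t ->
  (forall e x, P e x -> x < t e) ->
  D0 (fun e => P (tail e) (e O)) -> D0 (fun e => exists x, P e x).
Proof.
move=> ht hb h; apply: D0_ext (D0_ex ht h) => e.
by split=> -[x hx]; exists x; [case: hx | split; [exact: hb hx|]].
Qed.

(** By excluded middle a statement independent of the variables is equivalent to [0 = 0] or to its
    negation. Facts about fixed parameters, however complex, may therefore occur inside a bounded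
    predicate. *)
Lemma D0_const (A : Prop) : D0 (fun _ => A).
Proof.
have h0 : D0 (fun _ => (0:M) = 0) by do 2!constructor.
case: (classic A) => hA; first by apply: D0_ext h0.
by apply: D0_ext (D0_not h0).
Qed.

End Semantics.

Ltac tf :=
  cbv beta delta [tail npair];
  match goal with
  | |- term_fun (fun e => e ?i) => apply (@TF_var _ i)
  | |- term_fun (fun e => Defs.add (@?a e) (@?b e)) => apply (@TF_add _ a b); tf
  | |- term_fun (fun e => Defs.mul (@?a e) (@?b e)) => apply (@TF_mul _ a b); tf
  | |- term_fun (fun e => ?c) => apply (@TF_const _ c)
  end.

Ltac d0_ext := fail.

Ltac d0 :=
  cbv beta delta [tail related at_ iff];
  match goal with
  | _ => d0_ext
  | |- D0 (fun e => ?A) => apply (@D0_const _ A)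
  | |- D0 (fun e => @?A e /\ @?B e) => apply (@D0_and _ A B); d0
  | |- D0 (fun e => @?A e \/ @?B e) => apply (@D0_or _ A B); d0
  | |- D0 (fun e => ~ (@?A e)) => apply (@D0_not _ A); d0
  | |- D0 (fun e => forall x, Defs.lt x (@?t e) -> @?P e x) =>
      apply (@D0_all _ t P); [tf | d0]
  | |- D0 (fun e => exists x, Defs.lt x (@?t e) /\ @?P e x) =>
      apply (@D0_ex _ t P); [tf | d0]
  | |- D0 (fun e => @?A e -> @?B e) => apply (@D0_imp _ A B); d0
  | |- D0 (fun e => Defs.lt (@?a e) (@?b e)) => apply (@D0_lt _ a b); tf
  | |- D0 (fun e => (@?a e) = (@?b e)) => apply (@D0_eq _ a b); tf
  | |- D0 (fun e => [/\ @?A e, @?B e & @?C e]) =>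
      apply (@D0_and3 _ A B C); d0
  | |- D0 (fun e => [/\ @?A e, @?B e, @?C e & @?D e]) =>
      apply (@D0_and4 _ A B C D); d0
  | |- D0 (fun e => ?F (@?a e) (@?b e) (@?c e)) =>
      match goal with
      | h : D0 (fun e => F (e O) (e 1%N) (e 2%N)) |- _ =>
          apply (@D0_app3 _ F a b c); [tf | tf | tf | exact h]
      end
  | |- D0 (fun e => ?F (@?a e) (@?b e)) =>
      match goal with
      | h : D0 (fun e => F (e O) (e 1%N)) |- _ =>
          apply (@D0_app2 _ F a b); [tf | tf | exact h]
      end
  | |- D0 (fun e => ?X (@?t e)) =>
      match goal with
      | h : D0 (fun e => X (e O)) |- _ => apply (@D0_app1 _ X t); [tf | exact h]
      | hX : is_set X |- _ => apply (@D0_mem _ X t hX); tf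
      end
  | _ => idtac
  end.

(** * Induction and comprehension for bounded predicates *)

Section Principles.
Variable M : L2_structure.
Hypothesis hM : RCA0 M.
Implicit Types (P : M -> Prop) (A B : M -> M -> Prop).

(** The axiom schemes expect the witness at index 0, the argument at 1 and the parameters from 2 on.
    Even indices from 4 on belong to variables on which the predicate does not depend; all of them
    receive the dummy value [c 0], found at index 2. *)
Definition flatten_env (i : nat) : nat :=
  if odd i then i./2.+2 else minn i./2 2.

Lemma sat_flatten A s c p : defined_by (fun e => A (e O) (e 1%N)) s c p ->
  forall x n, A x n <-> sat s (scons x (scons n c)) (ren flatten_env id p).
Proof.
move=> [_ _ h] x n; rewrite sat_ren.
have -> : (fun i => scons x (scons n c) (flatten_env i)) =
    mix (scons x (scons n (fun=> c O))) c.
  apply: functional_extensionality => i; rewrite /mix /flatten_env.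
  by case: ifP => // _; case: i./2 => [|[|j]].
by rewrite -h.
Qed.

Lemma sigma1_ind A : D0 (fun e => A (e O) (e 1%N)) ->
  (exists x, A x 0) -> (forall n, (exists x, A x n) -> exists x, A x (n + 1)) ->
  forall n, exists x, A x n.
Proof.
case: hM => _ ind _ /D0_sound [s [c [p h]]] h0 hS n.
have hA := @sat_flatten A _ _ _ h.
have key k : sat s (scons k c) (f_ex (ren flatten_env id p)) <-> exists x, A x k.
  by split=> -[x hx]; exists x; apply/hA.
case: (h) => hs bp _; apply/key; apply: ind => //.
- by eexists; [reflexivity | exact: bounded_ren].
- by apply/key.
- by move=> k /key /hS /key.
Qed.

Lemma delta1_set P A B :
  D0 (fun e => A (e O) (e 1%N)) -> D0 (fun e => B (e O) (e 1%N)) ->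
  (forall n, P n <-> exists x, A x n) -> (forall n, ~ P n <-> exists x, B x n) ->
  is_set P.
Proof.
case: hM => _ _ delta /D0_sound [s1 [c1 [p1 h1]]] /D0_sound [s2 [c2 [p2 h2]]] PA PB.
have [s [c [p [q [hp hq]]]]] := defined_by_common h1 h2.
have [[hs bp _] [_ bq _]] := (hp, hq).
have hA := @sat_flatten A _ _ _ hp; have hB := @sat_flatten B _ _ _ hq.
have pP k : sat s (scons k c) (f_ex (ren flatten_env id p)) <-> P k.
  by rewrite PA; split=> -[x hx]; exists x; apply/hA.
have qP k : sat s (scons k c) (f_all (f_not (ren flatten_env id q))) <-> P k.
  split=> [h|hP x /hB hx].
    by apply: NNPP => /PB [x /hB]; apply: h.
  by have : ~ P k by apply/PB; exists x.
have [|X hX XP] := delta s c _ _ hs (ex_intro2 _ _ _ erefl (bounded_ren flatten_env id bp))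
    (ex_intro2 _ _ _ erefl (bounded_not (bounded_ren flatten_env id bq))).
  by move=> k; rewrite pP qP.
by rewrite (_ : P = X) //; apply: predext => k; rewrite XP pP.
Qed.

Lemma d0_set P : D0 (fun e => P (e O)) -> is_set P.
Proof.
move=> h; apply: (@delta1_set _ (fun _ n => P n) (fun _ n => ~ P n)).
- exact: (D0_ren S h).
- exact: D0_not (D0_ren S h).
- by move=> n; split=> [?|[]] //; exists 0.
- by move=> n; split=> [?|[]] //; exists 0.
Qed.

Lemma d0_ind P : D0 (fun e => P (e O)) -> P 0 -> (forall n, P n -> P (n + 1)) ->
  forall n, P n.
Proof.
move=> h h0 hS n.
have [||_ //] := @sigma1_ind (fun _ n => P n) (D0_ren S h) _ _ n.
- by exists 0.
- by move=> k [_ /hS hk]; exists 0.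
Qed.

End Principles.

(** * Arithmetic *)

Section Arithmetic.
Variable M : L2_structure.
Hypothesis hM : RCA0 M.
Implicit Types (x y z i j k l m n q : M).

Let axM : basic_axioms M. Proof. by case: hM. Qed.

Lemma add0m n : 0 + n = n.
Proof.
move: n; apply: (d0_ind hM); first by d0.
- exact: add_0.
- by move=> n h; rewrite add_succ // h.
Qed.

Lemma addmA m n k : m + (n + k) = m + n + k.
Proof.
move: k; apply: (d0_ind hM); first by d0.
- by rewrite !add_0.
- by move=> k h; rewrite !add_succ // h.
Qed.

Lemma add1m n : 1 + n = n + 1.
Proof.
move: n; apply: (d0_ind hM); first by d0.
- by rewrite add_0 // add0m.
- by move=> n h; rewrite add_succ // h.
Qed.

Lemma addmC m n : m + n = n + m.
Proof.
move: n; apply: (d0_ind hM); first by d0.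
- by rewrite add_0 // add0m.
- by move=> n h; rewrite add_succ // h -addmA -add1m addmA.
Qed.

Lemma mul0m n : 0 * n = 0.
Proof.
move: n; apply: (d0_ind hM); first by d0.
- exact: mul_0.
- by move=> n h; rewrite mul_succ // h add_0.
Qed.

Lemma mulmDr m n k : m * (n + k) = m * n + m * k.
Proof.
move: k; apply: (d0_ind hM); first by d0.
- by rewrite mul_0 // !add_0.
- by move=> k h; rewrite add_succ // !mul_succ // h addmA.
Qed.

Lemma mulSm m n : (m + 1) * n = m * n + n.
Proof.
move: n; apply: (d0_ind hM); first by d0.
- by rewrite !mul_0 // add_0.
- move=> n h; rewrite !mul_succ // h -!addmA; congr (_ + _).
  by rewrite addmA [n + m]addmC -addmA.
Qed.

Lemma mulmC m n : m * n = n * m.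
Proof.
move: n; apply: (d0_ind hM); first by d0.
- by rewrite mul_0 // mul0m.
- by move=> n h; rewrite mul_succ // h mulSm.
Qed.

Lemma mulmA m n k : m * (n * k) = m * n * k.
Proof.
move: k; apply: (d0_ind hM); first by d0.
- by rewrite !mul_0.
- by move=> k h; rewrite !mul_succ // mulmDr h.
Qed.

Lemma mul1m n : 1 * n = n.
Proof. by rewrite -[1]add0m mulSm mul0m add0m. Qed.

Lemma M_semiring : semi_ring_theory 0 1 (@Defs.add M) (@Defs.mul M) eq.
Proof.
split.
- exact: add0m.
- exact: addmC.
- exact: addmA.
- exact: mul1m.
- exact: mul0m.
- exact: mulmC.
- exact: mulmA.
- by move=> m n k; rewrite mulmC mulmDr ![k * _]mulmC.
Qed.

Add Ring M_ring : M_semiring.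

Lemma addmI k m n : m + k = n + k -> m = n.
Proof.
move: k; apply: (d0_ind hM); first by d0.
- by rewrite !add_0.
- by move=> k h; rewrite !add_succ // => /succ_inj /h; apply.
Qed.

(** $\Sigma^0_1$ induction wants an existential quantifier in front of a bounded matrix, so the case
    distinction is moved inside as [n <> 0 -> n = k + 1]. *)
Lemma zero_or_succ n : n = 0 \/ exists k, n = k + 1.
Proof.
suff [k hk] : exists k, n <> 0 -> n = k + 1.
  by case: (classic (n = 0)); [left | right; exists k; auto].
move: n; apply: (sigma1_ind hM (A := fun k n => n <> 0 -> n = k + 1)); first by d0.
- by exists 0.
- by move=> n _; exists n.
Qed.

Lemma lt_ex m n : m < n <-> exists k, n = m + k + 1.
Proof.
split=> [h|[k ->]].
  suff [k hk] : exists k, m < n -> n = m + k + 1 by exists k; auto.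
  move: n {h}; apply: (sigma1_ind hM (A := fun k n => m < n -> n = m + k + 1)); first by d0.
  - by exists 0 => /nlt_0 [].
  - move=> n [k hk]; case: (classic (m = n)) => [<-|hmn].
      by exists 0; rewrite add_0.
    exists (k + 1) => /lt_succ -/(_ axM) [/hk {1}->|//]; ring.
move: k; apply: (d0_ind hM); first by d0.
- by rewrite add_0 // lt_succ; auto.
- by move=> k h; rewrite lt_succ // addmA; left.
Qed.

Lemma le_ex m n : m <= n <-> exists k, n = m + k.
Proof.
split=> [[/lt_ex [k ->]|->]|[k ->]].
- by exists (k + 1); ring.
- by exists 0; ring.
- case: (zero_or_succ k) => [->|[j ->]]; [right | left]; first ring.
  by apply/lt_ex; exists j; ring.
Qed.

Lemma lt_irr n : ~ n < n.
Proof.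
move=> /lt_ex [k h]; apply: (@succ_neq0 M axM k).
by apply: (@addmI n); rewrite add0m {2}h; ring.
Qed.

Lemma lt_trans m n k : m < n -> n < k -> m < k.
Proof.
move=> /lt_ex [a ->] /lt_ex [b ->]; apply/lt_ex; exists (a + b + 1); ring.
Qed.

Lemma lt_total m n : m < n \/ m = n \/ n < m.
Proof.
move: n; apply: (d0_ind hM); first by d0.
- case: (zero_or_succ m) => [|[k ->]]; first by right; left.
  by right; right; apply/lt_ex; exists k; ring.
- move=> n [h|[->|/lt_ex [k ->]]].
  + by left; apply/lt_succ => //; left.
  + by left; apply/lt_succ => //; right.
  + right; case: (zero_or_succ k) => [->|[j ->]]; [left|right]; first ring.
    by apply/lt_ex; exists j; ring.
Qed.

Lemma le_lt_trans m n k : m <= n -> n < k -> m < k.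
Proof. by case=> [h|->] //; apply: lt_trans. Qed.

Lemma lt_le_trans m n k : m < n -> n <= k -> m < k.
Proof. by move=> h [|<-] //; apply: lt_trans. Qed.

Lemma le_trans m n k : m <= n -> n <= k -> m <= k.
Proof. by move=> [h|->] // h'; left; apply: lt_le_trans h'. Qed.

Lemma le_refl m : m <= m. Proof. by right. Qed.

Lemma le_or_lt m n : m <= n \/ n < m.
Proof. by have := lt_total m n; tauto. Qed.

Lemma lt_not_le m n : m < n -> ~ n <= m.
Proof. by move=> h /(lt_le_trans h) /lt_irr. Qed.

Lemma le_anti m n : m <= n -> n <= m -> m = n.
Proof. by move=> [h|->] // /(lt_not_le h). Qed.

Lemma le0m n : 0 <= n.
Proof. by apply/le_ex; exists n; ring. Qed.

Lemma lt_S n : n < n + 1. Proof. by apply/lt_succ => //; right. Qed.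

Lemma ltS_le m n : m < n + 1 <-> m <= n. Proof. exact: lt_succ. Qed.

Lemma leS_lt m n : m + 1 <= n <-> m < n.
Proof.
rewrite le_ex lt_ex; split=> -[k ->]; exists k; ring.
Qed.

Lemma lt_neq m n : m < n -> m <> n.
Proof. by move=> h e; apply: (@lt_irr n); rewrite -{1}e. Qed.

Lemma lt_add2r k m n : m + k < n + k <-> m < n.
Proof.
rewrite !lt_ex; split=> -[j h]; exists j.
  by apply: (@addmI k); rewrite h; ring.
rewrite h; ring.
Qed.

Lemma le_add2r k m n : m + k <= n + k <-> m <= n.
Proof.
rewrite !le_ex; split=> -[j h]; exists j.
  by apply: (@addmI k); rewrite h; ring.
rewrite h; ring.
Qed.

Lemma le_addr m n : m <= m + n. Proof. by apply/le_ex; exists n. Qed.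
Lemma le_addl m n : m <= n + m. Proof. by apply/le_ex; exists n; ring. Qed.

Lemma gt0_succ n : 0 < n <-> exists k, n = k + 1.
Proof. by rewrite lt_ex; split=> -[k ->]; exists k; ring. Qed.

Lemma mul_gt0 m n : 0 < m -> 0 < n -> 0 < m * n.
Proof.
rewrite !gt0_succ => -[a ->] [b ->]; exists (a * b + a + b); ring.
Qed.

Lemma neq_01 : 0 <> 1 :> M.
Proof. by move=> h; apply: (@succ_neq0 M axM 0); rewrite -h add_0. Qed.

Lemma le_sqr m : m <= m * m.
Proof.
case: (zero_or_succ m) => [->|[k ->]]; first by right; ring.
by apply/le_ex; exists (k * k + k); ring.
Qed.

(** With [s = x + y], the code lies between [s * s] and [s * s + s], hence below the next square. So
    a code determines first the sum and then [x]. *)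
Lemma npair_lt x y x' y' : x + y < x' + y' -> npair x y < npair x' y'.
Proof.
rewrite /npair => /lt_ex [k ->]; apply/lt_ex.
exists (x + 2 * y + 2 * (x + y) * k + k * k + 2 * k + x'); ring.
Qed.

Lemma npair_inj x y x' y' : npair x y = npair x' y' -> x = x' /\ y = y'.
Proof.
move=> h; have e : x + y = x' + y'.
  case: (lt_total (x + y) (x' + y')) => [/npair_lt|[//|/npair_lt]];
    by rewrite h => /lt_irr.
have ex : x = x'.
  apply: (@addmI ((x + y) * (x + y))); rewrite {3 4}e.
  by move: h; rewrite /npair => h; rewrite addmC h; ring.
split=> //; apply: (@addmI x); rewrite {2}ex addmC e; ring.
Qed.

Lemma le_npair1 x y : x <= npair x y. Proof. exact: le_addl. Qed.

Lemma le_npair2 x y : y <= npair x y.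
Proof.
apply: le_trans (le_addl y x) _; apply: le_trans (le_sqr _) _; exact: le_addr.
Qed.

Lemma npair_lt_bound i x l b : i < l -> x < b -> npair i x < npair l b.
Proof.
move=> /lt_ex [j ->] /lt_ex [k ->]; apply: npair_lt; apply/lt_ex.
by exists (j + k + 1); ring.
Qed.

Lemma set_least (X : M -> Prop) n : is_set X -> X n ->
  exists2 m, X m & forall k, k < m -> ~ X k.
Proof.
move=> hX Xn; apply: NNPP => hno.
suff h k : forall j, j < k -> ~ X j.
  by case: hno; exists n => //; apply: h.
move: k; apply: (d0_ind hM); first by d0.
- by move=> j /nlt_0 [].
- move=> k hk j /lt_succ -/(_ axM) [/hk //|->] Xk.
  by apply: hno; exists k.
Qed.

End Arithmetic.

(** * Coded sequences and paths *)

Section Sequences.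
Variable M : L2_structure.
Hypothesis hM : RCA0 M.
Implicit Types (X P : M -> Prop) (F Rl : M -> M -> Prop).
Implicit Types (x y z u v i j k l m n p q s t b d : M).

Add Ring M_ring' : (M_semiring hM).

Let axM : basic_axioms M. Proof. by case: hM. Qed.

Definition dvd p n : Prop := exists q, n = q * p.

Lemma le_mul_pos q p : 0 < p -> q <= q * p.
Proof.
move=> /(gt0_succ hM) [k ->]; apply/(le_ex hM); exists (q * k); ring.
Qed.

Lemma dvd_bound p n : 0 < p -> dvd p n <-> exists q, q < n + 1 /\ n = q * p.
Proof.
move=> hp; split=> [[q ->]|[q [_ ->]]]; exists q => //; split=> //.
by apply/(ltS_le hM); exact: le_mul_pos.
Qed.

(** The components of a code do not exceed it, and a quotient by a positive modulus does not exceed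
    [n]; so every existential quantifier in [in_code] can be bounded. *)
Lemma D0_in_code S I : term_fun S -> term_fun I ->
  D0 (fun e => in_code (S e : M) (I e)).
Proof.
move=> hS hI; apply: (@D0_app2 _ (fun s i => in_code s i) S I) => //.
have lt1 x y : x <= y -> x < y + 1 by move/(ltS_le hM).
apply: (@D0_exb _ (fun e => e O + 1)); first by tf.
  move=> e k [m [n [-> _ _]]]; apply: lt1; exact: le_npair1.
apply: (@D0_exb _ (fun e => e 1%N + 1)); first by tf.
  move=> e m [n]; rewrite /tail => -[-> _ _]; apply: lt1.
  by apply: (le_trans hM) (le_npair2 hM _ _); exact: le_npair1.
apply: (@D0_exb _ (fun e => e 2%N + 1)); first by tf.
  move=> e n; rewrite /tail => -[-> _ _]; apply: lt1.
  by apply: (le_trans hM) (le_npair2 hM _ _); exact: le_npair2.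
apply: D0_and3; [by d0 | by d0 |].
apply: (@D0_exb _ (fun e => e O + 1)); last by d0.
  by tf.
move=> e q ->; apply: lt1; apply: le_mul_pos.
by apply/(gt0_succ hM); eexists.
Qed.

(** A factorial, built by multiplying with each new number. Divisibility is written with a bounded
    quotient to keep the induction $\Sigma^0_1$. *)
Lemma common_multiple k :
  exists m, 0 < m /\ forall d, 0 < d -> d <= k -> dvd d m.
Proof.
have [m [m0 hm]] : exists m, 0 < m /\ forall d, d < k + 1 -> 0 < d ->
    exists q, q < m + 1 /\ m = q * d.
  move: k; apply: (sigma1_ind hM (A := fun m k => 0 < m /\
    forall d, d < k + 1 -> 0 < d -> exists q, q < m + 1 /\ m = q * d)).
  - by d0.
  - exists 1; split; first by apply/(gt0_succ hM); exists 0; ring.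
    by move=> d /(ltS_le hM) [/(nlt_0 axM) //|->] /(lt_irr hM).
  - move=> k [m [m0 hm]]; exists (m * (k + 1)); split.
      by apply: (mul_gt0 hM) => //; apply/(gt0_succ hM); exists k.
    move=> d hd d0; apply/dvd_bound => //.
    case/(ltS_le hM): hd => [/hm/(_ d0) [q [_ ->]]|->]; last by exists m.
    by exists (q * (k + 1)); ring.
exists m; split=> // d d0 hd; apply/dvd_bound => //.
by apply: hm => //; apply/(ltS_le hM).
Qed.

Lemma dvd_sub p x y : 0 < p -> dvd p (x + y * p) -> dvd p x.
Proof.
move=> /(gt0_succ hM) [r ->] [a h].
case: (le_or_lt hM y a) => [/(le_ex hM) [b eb]|/(lt_ex hM) [c ec]].
  by exists b; apply: (addmI hM (k := y * (r + 1))); rewrite h eb; ring.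
case: (@succ_neq0 M axM (x + c * r + c + r)).
by apply: (addmI hM (k := a * (r + 1))); rewrite (add0m hM) -[RHS]h ec; ring.
Qed.

Lemma dvd_mull p x y : dvd p x -> dvd p (y * x).
Proof. by case=> q ->; exists (y * q); ring. Qed.

Definition beta_modulus m i := m * (i + 1) + 1.

Lemma beta_modulus_gt0 m i : 0 < beta_modulus m i.
Proof. by apply/(gt0_succ hM); eexists. Qed.

(** Coprimality of two moduli, phrased as cancellation. The moduli differ by [m * d], so the modulus
    of [i] divides [n * m * d]; here [d] divides [m]. *)
Lemma beta_coprime m n i j d : dvd d m -> i = j + d \/ j = i + d ->
  dvd (beta_modulus m i) (n * beta_modulus m j) -> dvd (beta_modulus m i) n.
Proof.
move=> [e hd] hij [a h]; set p := beta_modulus m i in h *.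
have p0 : 0 < p := beta_modulus_gt0 m i.
have nmd : dvd p (n * m * d).
  case: hij => hij.
  - apply: (@dvd_sub _ _ a) => //; rewrite -h.
    by exists n; rewrite /p /beta_modulus hij; ring.
  - apply: (@dvd_sub _ _ n) => //; exists a.
    by rewrite -h /p /beta_modulus hij; ring.
(* Modulo [p], [m (i + 1)] is [-1], so [n = n (m (i + 1))^2]. *)
apply: (@dvd_sub _ _ (n * p)) => //.
have -> : n + n * p * p = (e * (i + 1) * (i + 1)) * (n * m * d) + 2 * n * p.
  have -> : e * (i + 1) * (i + 1) * (n * m * d) = n * m * (e * d) * (i + 1) * (i + 1).
    by ring.
  by rewrite -hd /p /beta_modulus; ring.
case: nmd => c ->; exists (e * (i + 1) * (i + 1) * c + 2 * n); ring.
Qed.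

Lemma beta_code X k : is_set X ->
  exists m n, forall i, i < k -> (dvd (beta_modulus m i) n <-> X i).
Proof.
move=> hX; have [m [m0 hm]] := common_multiple k; exists m.
have [n hn] : exists n, forall i, i < k ->
    ((exists q, q < n + 1 /\ n = q * (m * (i + 1) + 1)) <-> (i < k /\ X i)).
  (* The bound [k] on the indices stays fixed while [j] grows: [n] is the product of the moduli of
     the elements of [X] below [j], starting from the empty product 1. *)
  move: {2}k => j; move: j.
  apply: (sigma1_ind hM (A := fun n j => forall i, i < k ->
    ((exists q, q < n + 1 /\ n = q * (m * (i + 1) + 1)) <-> (i < j /\ X i)))).
  - by d0.
  - exists 1 => i _; split=> [|[/(nlt_0 axM)]] // -[q [_]].
    case: (zero_or_succ hM q) => [->|[r ->]] h.
      by case: (neq_01 hM); rewrite h; ring.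
    move: m0 h => /(gt0_succ hM) [m' ->] h.
    case: (@succ_neq0 M axM (r * ((m' + 1) * (i + 1) + 1) + (m' * i + m' + i))).
    by apply: (addmI hM (k := 1)); rewrite (add0m hM) [RHS]h; ring.
  - move=> j [n hn].
    have hn' i : i < k -> (dvd (beta_modulus m i) n <-> i < j /\ X i).
      by move=> hi; rewrite -(hn i hi); apply: dvd_bound; exact: beta_modulus_gt0.
    suff [n' hn''] : exists n', forall i, i < k ->
        (dvd (beta_modulus m i) n' <-> i < j + 1 /\ X i).
      exists n' => i hi; rewrite -(hn'' i hi); symmetry; apply: dvd_bound.
      exact: beta_modulus_gt0.
    case: (classic (j < k /\ X j)) => [hj|hj]; last first.
      exists n => i hi; rewrite hn' // (ltS_le hM).
      by split=> [] [] hij Xi; split; auto; case: hij => // e; case: hj; rewrite -e.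
    exists (n * beta_modulus m j) => i hi; rewrite (ltS_le hM).
    split=> [h|[[hij|->] Xi]]; last by exists n.
      case: (classic (i = j)) => [-> //|nij]; first by case: hj; split; [right|].
      have {}h : dvd (beta_modulus m i) n.
        have [hij|[//|hij]] := lt_total hM i j.
        + move: (hij) => /(lt_ex hM) [d e].
          apply: (beta_coprime (d := d + 1)) h; last by right; rewrite e; ring.
          apply: hm; first by apply/(gt0_succ hM); exists d.
          left; apply: (le_lt_trans hM) hj.1; rewrite e; apply/(le_ex hM).
          by exists i; ring.
        + move: (hij) => /(lt_ex hM) [d e].
          apply: (beta_coprime (d := d + 1)) h; last by left; rewrite e; ring.
          apply: hm; first by apply/(gt0_succ hM); exists d.
          left; apply: (le_lt_trans hM) hi; rewrite e; apply/(le_ex hM).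
          by exists j; ring.
      by case/(hn' i hi): h; auto.
    rewrite (mulmC hM); apply: dvd_mull; exact/hn'.
exists n => i hi; rewrite -[X i]/(X i).
split=> [/dvd_bound h|Xi].
  by case/(hn i hi): (h (beta_modulus_gt0 _ _)).
by apply/dvd_bound; [exact: beta_modulus_gt0 | apply/(hn i hi)].
Qed.

End Sequences.

Ltac d0_ext ::=
  match goal with
  | |- D0 (fun e => in_code (@?s e) (@?i e)) =>
      match goal with
      | hM : RCA0 _ |- _ => apply (@D0_in_code _ hM s i); tf
      end
  end.

(** * Building and transforming coded paths *)

Section Paths.
Variable M : L2_structure.
Hypothesis hM : RCA0 M.
Implicit Types (X P : M -> Prop) (F Rl : M -> M -> Prop).
Implicit Types (x y z u v i j k l m n p q s t b d : M).

Add Ring M_ring'' : (M_semiring hM).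

Let axM : basic_axioms M. Proof. by case: hM. Qed.

Lemma in_code_lt s z : in_code s z -> z < s.
Proof.
move=> [k [m [n [-> h _]]]]; apply: (lt_le_trans hM) h _; exact: le_npair1.
Qed.

Lemma at_lt s i x : at_ s i x -> i < s /\ x < s.
Proof.
move=> /in_code_lt h; split; apply: (le_lt_trans hM) h; first exact: le_npair1.
exact: le_npair2.
Qed.

Lemma is_pathE Rl s n x y : is_path Rl s n x y <->
  [/\ [/\ forall z, z < s -> in_code s z ->
            exists i, i < z + 1 /\ exists x, x < z + 1 /\ z = npair i x,
          forall i, i < s -> forall x, x < s -> forall y, y < s ->
            at_ s i x -> at_ s i y -> x = y,
          forall i, i < n + 1 -> exists x, x < s /\ at_ s i x &
          forall i, i < s -> forall x, x < s -> at_ s i x -> i < n + 1],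
      at_ s 0 x, at_ s n y &
      forall i, i < n -> forall u, u < s -> forall v, v < s ->
        at_ s i u -> at_ s (i + 1) v -> Rl u v].
Proof.
split=> [[[h1 h2 h3] hx hy hR]|[[h1 h2 h3 h4] hx hy hR]]; split=> //.
- split.
  + move=> z _ /h1 [i [u ->]]; exists i; split; first exact/ltS_le/le_npair1.
    by exists u; split=> //; exact/ltS_le/le_npair2.
  + by move=> i _ u _ v _; apply: h2.
  + by move=> i /h3 [u hu]; exists u; split=> //; case: (at_lt hu).
  + by move=> i _ u _ hu; apply/h3; exists u.
- by move=> i hi u _ v _; apply: hR.
- split.
  + move=> z hz; case: (h1 z (in_code_lt hz) hz) => i [_ [u [_ ->]]].
    by exists i, u.
  + move=> i u v hu hv; have [[hi us] [_ vs]] := (at_lt hu, at_lt hv).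
    exact: (h2 i).
  + move=> i; split=> [/h3 [u [_ hu]]|[u hu]]; first by exists u.
    have [hi us] := at_lt hu; exact: h4 hu.
- move=> i u v hi hu hv; have [[_ us] [_ vs]] := (at_lt hu, at_lt hv).
  exact: (hR i).
Qed.

Lemma D0_is_path Rl : D0 (fun e => Rl (e O) (e 1%N)) ->
  D0 (fun e => is_path Rl (e O) (e 1%N) (e 2%N) (e 3%N)).
Proof.
move=> hR; apply: D0_ext (_ : D0 _); first by move=> e; symmetry; exact: is_pathE.
by d0.
Qed.

Lemma seq_code F l b : D0 (fun e => F (e O) (e 1%N)) ->
  (forall i x, i < l -> F i x -> x < b) ->
  exists s, (forall i x, at_ s i x <-> i < l /\ F i x) /\
    forall z, in_code s z -> exists i x, z = npair i x.
Proof.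
move=> hF hb; pose X z := exists i x, [/\ z = npair i x, i < l & F i x].
have hX : is_set X.
  apply: (d0_set hM); apply: (@D0_exb _ (fun e => e O + 1)); first by tf.
    by move=> e i [x [-> _ _]]; apply/(ltS_le hM); exact: le_npair1.
  apply: (@D0_exb _ (fun e => e 1%N + 1)); first by tf.
    by move=> e x; rewrite /tail => -[-> _ _]; apply/(ltS_le hM); exact: le_npair2.
  by d0.
have [m [n h]] := beta_code hM (npair l b) hX.
exists (npair (npair l b) (npair m n)).
have hcode z : in_code (npair (npair l b) (npair m n)) z <-> z < npair l b /\ X z.
  split=> [[k [m' [n' [/(npair_inj hM) [<- /(npair_inj hM) [<- <-]] hz /h hX']]]]|].
    by split=> //; apply: hX'.
  by move=> [hz hX']; exists (npair l b), m, n; split=> //; apply/h.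
split=> [i x|z /hcode [_ [i [x [-> _ _]]]]]; last by exists i, x.
rewrite /at_ hcode; split=> [[_ [j [y [/(npair_inj hM) [-> ->]]]]] //|[hi hx]].
split; last by exists i, x.
by apply: npair_lt_bound => //; exact: hb hx.
Qed.

(** Paths are not built entry by entry: a bounded description [F] of the entries, with a common
    bound [b] on their values, is coded in one stroke. *)
Lemma path_code Rl F n b x y : D0 (fun e => F (e O) (e 1%N)) ->
  (forall i u, i < n + 1 -> F i u -> u < b) ->
  (forall i, i < n + 1 -> exists u, F i u) ->
  (forall i u v, i < n + 1 -> F i u -> F i v -> u = v) ->
  F 0 x -> F n y ->
  (forall i u v, i < n -> F i u -> F (i + 1) v -> Rl u v) ->
  exists s, is_path Rl s n x y /\ forall i u, at_ s i u <-> i < n + 1 /\ F i u.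
Proof.
move=> hF hb ht hf hx hy hR; have [s [hs hz]] := seq_code hF hb.
have n0 : 0 < n + 1 by apply/(gt0_succ hM); exists n.
exists s; split=> //; split; [split=> // | | |].
- by move=> i u v /hs [hi hu] /hs [_ hv]; exact: hf hu hv.
- move=> i; split=> [hi|[u /hs [] //]]; have [u hu] := ht i hi.
  by exists u; apply/hs.
- exact/hs.
- by apply/hs; split=> //; exact: lt_S.
- by move=> i u v hi /hs [_ hu] /hs [_ hv]; exact: hR hu hv.
Qed.

(** The induction is on the index [i]. Its statement is bounded because [P] is a set and the entries
    are quantified below the code. *)
Lemma path_closed Rl P s n x y : is_set P -> is_path Rl s n x y -> P x ->
  (forall u v, P u -> Rl u v -> P v) -> forall i u, at_ s i u -> P u.
Proof.
move=> hP [[_ hfun hdom] hx hy hR] Px hcl i.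
suff h : forall u, u < s -> at_ s i u -> P u.
  by move=> u hu; apply: h (hu); case: (at_lt hu).
move: i; apply: (d0_ind hM); first by d0.
- by move=> u _ hu; rewrite (hfun _ _ _ hu hx).
- move=> i IH v _ hv.
  have hi : i + 1 < n + 1 by apply/hdom; exists v.
  have {}hi : i < n by move/(lt_add2r hM): hi.
  have [u hu] : exists u, at_ s i u.
    by apply/hdom; apply: (lt_trans hM) hi (lt_S hM n).
  by apply: hcl (hR _ _ _ hi hu hv); apply: IH (hu); case: (at_lt hu).
Qed.

Lemma joined_closed Rl P x y : is_set P -> joined Rl x y -> P x ->
  (forall u v, P u -> Rl u v -> P v) -> P y.
Proof.
move=> hP [s [n h]] Px hcl; have [_ _ hy _] := h.
exact: path_closed hP h Px hcl n y hy.
Qed.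

Lemma joined_refl Rl x : joined Rl x x.
Proof.
have [|||||s [hs _]] := @path_code Rl (fun _ u => u = x) 0 (x + 1) x x _ _ _ _ erefl erefl.
- by d0.
- by move=> i u _ ->; exact: lt_S.
- by move=> i _; exists x.
- by move=> i u v _ -> ->.
- by move=> i u v /(nlt_0 axM).
- by exists s, 0.
Qed.

Lemma joined_step Rl x y : Rl x y -> joined Rl x y.
Proof.
move=> hxy; pose F i u := (i = 0 /\ u = x) \/ (i = 1 /\ u = y).
have n01 := neq_01 hM.
have [|||||||s [hs _]] := @path_code Rl F 1 (x + y + 1) x y.
- by rewrite /F; d0.
- move=> i u _ [[_ ->]|[_ ->]]; apply/(ltS_le hM); first exact: le_addr.
  exact: le_addl.
- move=> i /(ltS_le hM) [|->]; last by exists y; right.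
  have e : 1 = 0 + 1 :> M by ring.
  by rewrite e (ltS_le hM) => -[/(nlt_0 axM) //|->]; exists x; left.
- by move=> i u v _ [[-> ->]|[-> ->]] [[h ->]|[h ->]] //; case: n01.
- by left.
- by right.
- move=> i u v; have e : 1 = 0 + 1 :> M by ring.
  rewrite {1}e (ltS_le hM) => -[/(nlt_0 axM) //|->].
  by move=> [[_ ->]|[]//] [[h _]|[_ ->]] //; case: n01; rewrite -h; ring.
- by exists s, 1.
Qed.

Lemma joined_trans Rl x y z : joined Rl x y -> joined Rl y z -> joined Rl x z.
Proof.
move=> [s [n [[_ sf sd] sx sy sR]]] [t [m [[_ tf' td] ty tz tR]]].
(* The second path is shifted by [n] and read only from index [n + 1] on, so the common vertex comes
   from the first path. The clause [j < i + 1] makes [F] bounded. *)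
pose F i u := (i < n + 1 /\ at_ s i u) \/ (n < i /\ exists j, j < i + 1 /\ (i = n + j /\ at_ t j u)).
have [|||||||r [hr _]] := @path_code Rl F (n + m) (s + t) x z.
- by rewrite /F; d0.
- move=> i u _ [[_ /at_lt [_ h]]|[_ [j [_ [_ /at_lt [_ h]]]]]].
    by apply: (lt_le_trans hM) h _; exact: le_addr.
  by apply: (lt_le_trans hM) h _; exact: le_addl.
- move=> i hi; case: (le_or_lt hM i n) => [/(ltS_le hM) h|h].
    by have [u hu] := (sd i).1 h; exists u; left.
  move: (h) => /(lt_ex hM) [k e].
  have [u hu] : exists u, at_ t (k + 1) u.
    apply/td; apply/(lt_add2r hM n).
    have -> : k + 1 + n = i by rewrite e; ring.
    by have -> : m + 1 + n = n + m + 1 by ring.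
  exists u; right; split=> //; exists (k + 1); split; last by split=> //; rewrite e; ring.
  by rewrite e; apply/(ltS_le hM); apply/(le_ex hM); exists n; ring.
- move=> i u v _ [[h hu]|[h [j [_ [e hu]]]]] [[h' hv]|[h' [j' [_ [e' hv]]]]].
  + exact: sf hu hv.
  + by case: (lt_not_le hM h'); apply/(ltS_le hM).
  + by case: (lt_not_le hM h); apply/(ltS_le hM).
  + have ej : j = j' by apply: (addmI hM (k := n)); rewrite addmC // -e e' addmC.
    by move: hv; rewrite -ej; exact: tf' hu.
- by left; split=> //; apply/(gt0_succ hM); exists n.
- case: (zero_or_succ hM m) => [e|[k e]].
    left; move: tz; rewrite e => /tf' /(_ ty) ->; rewrite add_0 //.
    by split=> //; exact: lt_S.
  right; split; first by apply/(lt_ex hM); exists k; rewrite e; ring.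
  by exists m; split=> //; apply/(ltS_le hM); exact: le_addl.
- move=> i u v hi [[h hu]|[h [j [_ [e hu]]]]] [[h' hv]|[h' [j' [_ [e' hv]]]]].
  + by apply: (sR i) => //; apply/(lt_add2r hM 1).
  + have ein : i = n by apply: (le_anti hM); apply/(ltS_le hM).
    have ej : j' = 1 by apply: (addmI hM (k := n)); rewrite addmC // -e' ein addmC.
    move: hu hv; rewrite ein ej => /(sf _ _ _ sy) <- hv.
    apply: (tR 0) => //; last by rewrite (add0m hM).
    by apply/(lt_add2r hM n); rewrite (add0m hM) addmC // -{1}ein.
  + case: (lt_not_le hM h); apply/(ltS_le hM); apply: (lt_trans hM) h'; exact: lt_S.
  + have ej : j' = j + 1 by apply: (addmI hM (k := n)); rewrite addmC // -e' e; ring.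
    move: hv; rewrite ej => hv; apply: (tR j) hu hv.
    by apply/(lt_add2r hM n); rewrite addmC // -e addmC.
- by exists r, (n + m).
Qed.

Lemma joined_sym Rl x y : (forall u v, Rl u v -> Rl v u) ->
  joined Rl x y -> joined Rl y x.
Proof.
move=> Rsym [s [n [[_ sf sd] sx sy sR]]].
pose F i u := exists j, j < n + 1 /\ (i + j = n /\ at_ s j u).
have [|||||||r [hr _]] := @path_code Rl F n s y x.
- by rewrite /F; d0.
- by move=> i u _ [j [_ [_ /at_lt []]]].
- move=> i /(ltS_le hM) /(le_ex hM) [j e].
  have hj : j < n + 1 by apply/(ltS_le hM); rewrite e; exact: le_addl.
  by have [u hu] := (sd j).1 hj; exists u, j.
- move=> i u v _ [j [_ [e hu]]] [k [_ [e' hv]]].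
  have ej : j = k by apply: (addmI hM (k := i)); rewrite addmC // e -e' addmC.
  by move: hv; rewrite -ej; exact: sf hu.
- by exists n; split; [exact: lt_S | split=> //; exact: add0m].
- exists 0; split; first by apply/(gt0_succ hM); exists n.
  by rewrite add_0.
- move=> i u v _ [j [hj [e hu]]] [k [hk [e' hv]]].
  have ej : j = k + 1 by apply: (addmI hM (k := i)); rewrite addmC // e -e'; ring.
  apply: Rsym; apply: (sR k) => //; last by rewrite -ej.
  by apply/(lt_add2r hM 1); rewrite -ej.
- by exists r, n.
Qed.

(** The invariant [P] keeps every entry in the domain of [G], and the uniform bound on the values of
    [G] below [s] is what allows the image of the path to be coded. *)
Lemma joined_map Rl Rl' P G x y x' y' : is_set P ->
  D0 (fun e => G (e O) (e 1%N)) ->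
  (forall u, P u -> exists v, G u v) ->
  (forall u v v', G u v -> G u v' -> v = v') ->
  (forall s, exists b, forall u v, u < s -> G u v -> v < b) ->
  P x -> (forall u v, P u -> Rl u v -> P v) ->
  (forall u v u' v', Rl u v -> G u u' -> G v v' -> Rl' u' v') ->
  G x x' -> G y y' -> joined Rl x y -> joined Rl' x' y'.
Proof.
move=> hP hG Gt Gf Gb Px Pcl RR' gx gy [s [n hp]].
have Ps := path_closed hP hp Px Pcl.
have [[_ sf sd] sx sy sR] := hp; have [b hb] := Gb s.
pose F i u := exists v, v < s /\ (at_ s i v /\ G v u).
have [|||||||r [hr _]] := @path_code Rl' F n b x' y'.
- by rewrite /F; d0.
- by move=> i u _ [v [vs [_ h]]]; exact: hb h.
- move=> i /sd [v hv]; have [u hu] := Gt v (Ps _ _ hv).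
  by exists u, v; split=> //; case: (at_lt hv).
- move=> i u u' _ [v [_ [hv gu]]] [v' [_ [hv' gu']]].
  by move: gu'; rewrite (sf _ _ _ hv' hv); exact: Gf.
- by exists x; split=> //; case: (at_lt sx).
- by exists y; split=> //; case: (at_lt sy).
- move=> i u u' hi [v [_ [hv gu]]] [v' [_ [hv' gu']]].
  exact: RR' (sR _ _ _ hi hv hv') gu gu'.
- by exists r, n.
Qed.

End Paths.

(** * The relation [Q] on nonadjacent pairs *)

Section Pairs.
Variable M : L2_structure.
Hypothesis hM : RCA0 M.
Variables V E : M -> Prop.
Hypotheses (gVE : is_graph V E) (reflE : reflexive_graph V E).
Implicit Types (x y z u v w i j k l m n p q s t a b c d r : M) (A B : M -> Prop).

Let VS : is_set V. Proof. by case: gVE. Qed.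
Let ES : is_set E. Proof. by case: gVE. Qed.
Let Esym x y : related E x y -> related E y x. Proof. by case: gVE => _ _ _; apply. Qed.

Definition nonadj V E x y : Prop := [/\ V x, V y & ~ related E x y].

Notation N := (nonadj V E).
Notation J x y := (joined (Q V E) (npair x y)).

Lemma nonadj_sym x y : N x y -> N y x.
Proof. by move=> [vx vy h]; split=> // /Esym. Qed.

Lemma W_npair x y : W V E (npair x y) <-> N x y.
Proof.
split=> [[x' [y' [/(npair_inj hM) [-> ->]]]] //|[]].
by exists x, y.
Qed.

Lemma Q_npair x y z t : Q V E (npair x y) (npair z t) <->
  [/\ N x y, N z t, related E x z & related E y t].
Proof.
split=> [[/W_npair h /W_npair h' [x' [y' [z' [t' [ez ew h1 h2]]]]]]|].
  by move: ez ew h h' h1 h2 => /(npair_inj hM) [-> ->] /(npair_inj hM) [-> ->].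
by move=> [/W_npair ? /W_npair ? ? ?]; split=> //; exists x, y, z, t.
Qed.

Lemma Q_pairs z w : Q V E z w -> exists x y z' t', [/\ z = npair x y, w = npair z' t',
  N x y, N z' t' & related E x z' /\ related E y t'].
Proof.
move=> [hz hw [x [y [z' [t' [ez ew h1 h2]]]]]]; exists x, y, z', t'.
by move: hz hw; rewrite ez ew !W_npair.
Qed.

Lemma D0_Q : D0 (fun e => Q V E (e O) (e 1%N)).
Proof.
have lt1 x y : x <= y -> x < y + 1 by move/(ltS_le hM).
pose A (z w : M) := exists x, x < z + 1 /\ exists y, y < z + 1 /\
  exists x', x' < w + 1 /\ exists y', y' < w + 1 /\
  ([/\ z = npair x y, V x, V y & ~ related E x y] /\
   [/\ w = npair x' y', V x', V y' & ~ related E x' y'] /\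
   related E x x' /\ related E y y').
apply: (@D0_ext _ (fun e => A (e O) (e 1%N))); last by rewrite /A; d0.
move=> e; split=> [|/Q_pairs [x [y [z' [t' [-> -> [? ? ?] [? ? ?] [? ?]]]]]]].
  move=> [x [_ [y [_ [x' [_ [y' [_ [[-> ? ? ?] [[-> ? ? ?] []]]]]]]]]]] ? ?.
  exact/Q_npair.
exists x; split; first exact/lt1/le_npair1; exists y; split; first exact/lt1/le_npair2.
by exists z'; split; first exact/lt1/le_npair1; exists t'; split; first exact/lt1/le_npair2.
Qed.

Lemma Q_sym z w : Q V E z w -> Q V E w z.
Proof.
move=> /Q_pairs [x [y [z' [t' [-> -> h h' [exz eyt]]]]]].
by apply/Q_npair; split=> //; exact: Esym.
Qed.

Lemma joined_pair z w : joined (Q V E) z w -> W V E z -> W V E w.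
Proof.
have hW : is_set (W V E).
  apply: (d0_set hM); apply: (@D0_exb _ (fun e => e O + 1)); first by tf.
    by move=> e x [y [-> _ _ _]]; apply/(ltS_le hM); exact: le_npair1.
  apply: (@D0_exb _ (fun e => e 1%N + 1)); last by d0.
    by tf.
  by move=> e y; rewrite /tail => -[-> _ _ _]; apply/(ltS_le hM); exact: le_npair2.
by move=> h hz; apply: (joined_closed hM hW h hz) => u v _ [].
Qed.

Lemma J_nonadj x y z t : N x y -> J x y (npair z t) -> N z t.
Proof. by move=> /W_npair h /joined_pair /(_ h) /W_npair. Qed.

Lemma J_closed (P : M -> M -> Prop) x y z t : D0 (fun e => P (e O) (e 1%N)) ->
  P x y ->
  (forall x y z t, P x y -> N x y -> N z t -> related E x z -> related E y t -> P z t) ->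
  J x y (npair z t) -> P z t.
Proof.
move=> hP Pxy hcl h.
pose X w := exists u v, w = npair u v /\ P u v.
have hX : is_set X.
  apply: (d0_set hM); apply: (@D0_exb _ (fun e => e O + 1)); first by tf.
    by move=> e u [v [-> _]]; apply/(ltS_le hM); exact: le_npair1.
  apply: (@D0_exb _ (fun e => e 1%N + 1)); last by d0.
    by tf.
  by move=> e v; rewrite /tail => -[-> _]; apply/(ltS_le hM); exact: le_npair2.
suff [z' [t' [/(npair_inj hM) [-> ->]]]] : X (npair z t) by [].
apply: (joined_closed hM hX h); first by exists x, y.
move=> u v [x' [y' [-> hxy]]] /Q_pairs [x1 [y1 [z1 [t1 [e -> h1 h2 [h3 h4]]]]]].
exists z1, t1; split=> //; case/(npair_inj hM): e hxy => -> -> hxy.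
exact: (hcl x1 y1).
Qed.

Lemma J_sym x y z t : J x y (npair z t) -> J z t (npair x y).
Proof. by apply: (joined_sym hM) => u v /Q_sym. Qed.

Lemma J_swap x y z t : J x y (npair z t) -> J y x (npair t z).
Proof.
pose P u := exists a b, u = npair a b.
pose G u v := exists a b, u = npair a b /\ v = npair b a.
apply: (joined_map hM (P := P) (G := G)).
- apply: (d0_set hM); apply: (@D0_exb _ (fun e => e O + 1)); first by tf.
    by move=> e a [b ->]; apply/(ltS_le hM); exact: le_npair1.
  apply: (@D0_exb _ (fun e => e 1%N + 1)); last by d0.
    by tf.
  by move=> e b; rewrite /tail => ->; apply/(ltS_le hM); exact: le_npair2.
- apply: (@D0_exb _ (fun e => e O + 1)); first by tf.
    by move=> e a [b [-> _]]; apply/(ltS_le hM); exact: le_npair1.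
  apply: (@D0_exb _ (fun e => e 1%N + 1)); last by d0.
    by tf.
  by move=> e b; rewrite /tail => -[-> _]; apply/(ltS_le hM); exact: le_npair2.
- by move=> u [a [b ->]]; exists (npair b a), a, b.
- by move=> u v v' [a [b [-> ->]]] [a' [b' [/(npair_inj hM) [-> ->] ->]]].
- move=> s; exists (npair s s) => u v hu [a [b [eu ->]]].
  by apply: npair_lt_bound => //; apply: (le_lt_trans hM) hu; rewrite eu;
    [exact: le_npair2 | exact: le_npair1].
- by exists x, y.
- move=> u v _ /Q_pairs [? [? [a [b [_ -> _ _ _]]]]]; by exists a, b.
- move=> u v u' v' /Q_pairs [a [b [c [d [-> -> h h' [h1 h2]]]]]].
  move=> [a' [b' [/(npair_inj hM) [<- <-] ->]]] [c' [d' [/(npair_inj hM) [<- <-] ->]]].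
  by apply/Q_npair; split=> //; exact: nonadj_sym.
- by exists x, y.
- by exists z, t.
Qed.

Lemma J_step x y z t : N x y -> N z t -> related E x z -> related E y t ->
  J x y (npair z t).
Proof. by move=> *; apply: (joined_step hM); apply/Q_npair. Qed.

Lemma J_trans x y z t w : J x y (npair z t) -> J z t w -> J x y w.
Proof. exact: joined_trans. Qed.

End Pairs.

(** * Colors and spans *)

Definition sigma1_comprehension (M : L2_structure) : Prop :=
  forall A : M -> M -> Prop, D0 (fun e => A (e O) (e 1%N)) ->
    is_set (fun n => exists x, A x n).

Lemma ACA0_sigma1 (M : L2_structure) : ACA0 M -> sigma1_comprehension M.
Proof.
move=> [_ _ aca] A /D0_sound [s [c [p h]]]; case: (h) => hs _ _.
have hA := @sat_flatten M A _ _ _ h.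
have [X hX XP] := aca s c (f_ex (ren flatten_env id p)) hs.
rewrite (_ : (fun n => _) = X) //; apply: predext => n; rewrite XP.
by split=> -[x hx]; exists x; apply/hA.
Qed.

(** * Triangulated graphs have no induced 4-cycle *)

Section FourCycles.
Variable M : L2_structure.
Hypothesis hM : RCA0 M.
Implicit Types (x y z u v w i j s t : M).

Add Ring M_ring3 : (M_semiring hM).

(** The positions on a 4-cycle form a standard finite set; numerals transfer them to [nat], where
    they can be enumerated. *)
Definition numeral (n : nat) : M := iter n (fun x => x + 1) 0.

Lemma lt_numeral i (n : nat) : i < numeral n -> exists2 j, (j < n)%N & i = numeral j.
Proof.
elim: n => [|n IH]; first by case: hM => ax _ _ /(nlt_0 ax).
move=> /(ltS_le hM) [/IH [j hj ->]|->]; last by exists n.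
by exists j => //; exact: ltnW.
Qed.

Lemma numeral_ltn (m n : nat) : (m < n)%N -> numeral m < numeral n.
Proof.
elim: n => // n IH; rewrite ltnS leq_eqVlt => /orP [/eqP ->|/IH h].
  exact: lt_S.
exact: (lt_trans hM) h (lt_S hM _).
Qed.

Lemma numeral_inj (m n : nat) : numeral m = numeral n -> m = n.
Proof.
by case: (ltngtP m n) => // /numeral_ltn h e; case: (lt_neq hM h).
Qed.

Lemma no_C4 V E x y z t : is_graph V E -> reflexive_graph V E -> triangulated E ->
  V x -> V y -> nonadj V E x z -> nonadj V E y t ->
  related E x y -> related E y z -> related E z t -> related E t x -> False.
Proof.
move=> [_ _ _ Esym] reflE triE Vx Vy [_ Vz nxz] [_ Vt nyt] exy eyz ezt etx.
pose f (k : nat) := match k with O => x | 1%N => y | 2%N => z | 3%N => t | _ => x end.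
pose at_k i u k := i = numeral k /\ u = f k.
pose F i u := at_k i u 0%N \/ at_k i u 1%N \/ at_k i u 2%N \/ at_k i u 3%N \/ at_k i u 4%N.
have FP i u : F i u <-> exists2 k, (k < 5)%N & at_k i u k.
  split.
    by move=> [h|[h|[h|[h|h]]]]; [exists 0%N|exists 1%N|exists 2%N|exists 3%N|exists 4%N].
  by move=> [[|[|[|[|[|//]]]]] _ h]; rewrite /F; tauto.
have e5 : 4 + 1 = numeral 5 by rewrite /=; ring.
have adj k : (k < 4)%N -> related E (f k) (f k.+1).
  by case: k => [|[|[|[|]]]].
have fin (k l : nat) : (k < 4)%N -> (l < 4)%N -> f k = f l -> k = l.
  have nxy : x <> y by move=> e; apply: nyt; rewrite -e; exact: Esym.
  have nyz : y <> z by move=> e; apply: nxz; rewrite -e.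
  have nzt : z <> t by move=> e; apply: nyt; rewrite -e.
  have nxt : x <> t by move=> e; apply: nyt; rewrite -e; exact: Esym.
  have nxz' : x <> z by move=> e; apply: nxz; rewrite -e; exact: reflE.
  have nyt' : y <> t by move=> e; apply: nyt; rewrite -e; exact: reflE.
  by case: k => [|[|[|[|//]]]]; case: l => [|[|[|[|//]]]] //= _ _ e; subst.
have [|||||||s [hs sF]] := @path_code M hM (related E) F 4 (x + y + z + t + 1) x x.
- by rewrite /F /at_k; d0.
- move=> i u _ /FP [k hk [_ ->]]; apply/(ltS_le hM)/(le_ex hM).
  case: k hk => [|[|[|[|[|//]]]]] _ /=.
  + by exists (y + z + t); ring.
  + by exists (x + z + t); ring.
  + by exists (x + y + t); ring.
  + by exists (x + y + z); ring.
  + by exists (y + z + t); ring.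
- move=> i; rewrite e5 => /lt_numeral [k hk ->]; exists (f k); apply/FP.
  by exists k.
- move=> i u v _ /FP [k hk [-> ->]] /FP [l hl [/numeral_inj -> ->]] //.
- by left.
- by do 4!right; split=> //=; ring.
- move=> i u v hi /FP [k hk [ei ->]] /FP [l hl []].
  rewrite ei => /(@numeral_inj k.+1) el ->; rewrite -el; apply: adj.
  by move: hl; rewrite -el.
have atP i u : at_ s i u <-> F i u.
  rewrite sF; split=> [[] //|h]; split=> //; rewrite e5.
  by case/FP: h => k hk [-> _]; exact: numeral_ltn.
have [|i [j [u [v [/atP/FP [k hk [-> ->]] /atP/FP [l hl [-> ->]] ekl h1 h2]]]]] :=
  triE s 4 (le_refl _) _.
  split; first by exists x.
  have e4 : 4 = numeral 4 by rewrite /=; ring.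
  move=> i j u; rewrite e4 => /lt_numeral [k hk ->] /lt_numeral [l hl ->].
  move=> /atP /FP [k' hk' [/numeral_inj <- ->]] /atP /FP [l' hl' [/numeral_inj <- e]].
  by rewrite (fin k l).
(* For a cycle of length 4 the chord conditions read [k + 2 <= l] and [l + 2 <= k + 4], so a chord
   joins opposite vertices. *)
have elk : l = k.+2.
  apply: numeral_inj; apply: (le_anti hM).
    apply/(le_add2r hM 2); rewrite (_ : numeral k.+2 + 2 = numeral k + 4) //=; ring.
  by rewrite (_ : numeral k.+2 = numeral k + 2) //=; ring.
move: hl ekl; rewrite elk; case: k {hk h1 h2 elk} => [|[|[|//]]] _ //= /Esym //.
Qed.

End FourCycles.

(** * Color classes, their spans and buried subgraphs *)

Section Colors.
Variable M : L2_structure.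
Hypothesis hM : RCA0 M.
Hypothesis sigma1_set : sigma1_comprehension M.
Variables V E : M -> Prop.
Hypotheses (gVE : is_graph V E) (reflE : reflexive_graph V E).
Hypothesis triE : triangulated E.
Implicit Types (x y z u v w i j k l n p q s t a b c d r : M) (A B : M -> Prop).

Notation N := (nonadj V E).
Notation J x y := (joined (Q V E) (npair x y)).

Let ES : is_set E. Proof. by case: gVE. Qed.
Let Esym x y : related E x y -> related E y x. Proof. by case: gVE => _ _ _; apply. Qed.
Let Nsym x y : N x y -> N y x. Proof. exact: nonadj_sym. Qed.

(** The length of a path is below its code, so only the quantifier over codes is unbounded. *)
Lemma joined_set w : is_set (joined (Q V E) w).
Proof.
apply: (sigma1_set (A := fun s z => exists n, is_path (Q V E) s n w z)).
apply: (@D0_exb _ (fun e => e O)); first by tf.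
  by move=> e n [_ _ /at_lt -/(_ hM) []].
pose f (i : nat) (e : nat -> M) :=
  match i with O => e 1%N | 1%N => e O | 2%N => w | _ => e 2%N end.
have hf (i : nat) : term_fun (f i) by rewrite /f; case: i => [|[|[|i]]]; tf.
exact: (D0_sub hf (D0_is_path hM (D0_Q hM gVE))).
Qed.

Definition color x y z t : Prop := J x y (npair z t) \/ J x y (npair t z).

Definition span a b x : Prop := exists y, color a b x y.

Lemma span_set a b : is_set (span a b).
Proof.
have h := joined_set (npair a b).
by apply: (sigma1_set (A := fun y x => color a b x y)); rewrite /color; d0.
Qed.

Lemma color_refl x y : color x y x y.
Proof. by left; exact: joined_refl. Qed.

Lemma color_swapr x y z t : color x y z t -> color x y t z.
Proof. by case; [right | left]. Qed.

Lemma color_swapl x y z t : color x y z t -> color y x z t.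
Proof. by case=> /(J_swap hM gVE) h; [right | left]. Qed.

Lemma color_sym x y z t : color x y z t -> color z t x y.
Proof.
case=> [/(J_sym hM gVE)|/(J_sym hM gVE) /(J_swap hM gVE)]; [by left | by right].
Qed.

Lemma color_trans x y z t u v : color x y z t -> color z t u v -> color x y u v.
Proof.
case=> h [] h'; [left | right | right | left]; apply: (J_trans hM h) => //;
  exact: (J_swap hM gVE).
Qed.

Lemma color_step x y z t : N x y -> N z t -> related E x z -> related E y t ->
  color x y z t.
Proof. by move=> *; left; exact: (J_step hM). Qed.

Lemma color_nonadj x y z t : N x y -> color x y z t -> N z t.
Proof.
by move=> h [] /(J_nonadj hM gVE h) // /Nsym.
Qed.

Lemma span_left x y : span x y x. Proof. by exists y; exact: color_refl. Qed.
Lemma span_right x y : span x y y.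
Proof. by exists x; apply: color_swapr; exact: color_refl. Qed.

Lemma spanP a b x : N a b -> span a b x -> exists y, [/\ color a b x y, N x y & span a b y].
Proof.
move=> Nab [y h]; exists y; split=> //; first exact: color_nonadj h.
by exists x; exact: color_swapr.
Qed.

Lemma color_closed (P : M -> M -> Prop) a b : N a b -> D0 (fun e => P (e O) (e 1%N)) ->
  (forall x y, P x y -> P y x) -> P a b ->
  (forall x y z t, P x y -> color a b x y -> N x y -> N z t ->
     related E x z -> related E y t -> P z t) ->
  forall x y, color a b x y -> P x y.
Proof.
move=> Nab hP Psym Pab hcl.
have h := joined_set (npair a b).
suff key x y : J a b (npair x y) -> P x y /\ J a b (npair x y).
  by move=> x y [/key [] //|/key [/Psym]].
apply: (J_closed hM (P := fun x y => P x y /\ J a b (npair x y))); first by d0.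
  by split=> //; exact: joined_refl.
move=> {}x {}y z t [Pxy Jxy] Nxy Nzt exz eyt; split.
  by apply: (hcl x y) => //; left.
by apply: (J_trans hM Jxy); apply: (J_step hM).
Qed.

(** Suppose [v] misses one entry [c] of a pair [(c, d)] of the color. If it saw [d], then [(c, v)]
    would be one [Q] step from [(c, d)], and [v] would lie in the span. So [v] misses both entries,
    and this property propagates along [Q] through the whole color class. *)
Lemma span_module a b v x y : N a b -> V v -> ~ span a b v ->
  span a b x -> span a b y -> ~ related E v x -> ~ related E v y.
Proof.
move=> Nab Vv Bv Bx By nvx.
have cl c d : N c d -> color a b c d -> ~ related E v c -> forall z, span a b z -> ~ related E v z.
  move=> Ncd Kcd nvc z [w /(color_trans (color_sym Kcd)) Kzw].
  suff [] : ~ related E v z /\ ~ related E v w by [].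
  move: Kzw; have [Vc Vd _] := Ncd.
  apply: (@color_closed (fun z w => ~ related E v z /\ ~ related E v w) c d) => //; first by d0.
  - by move=> ? ? [].
  - split=> // evd; apply: Bv; exists c; apply: color_swapr.
    apply: (color_trans Kcd); apply: color_step => //; last exact: Esym.
    - by split=> // /Esym.
    - exact: reflE.
  - move=> p q p' q' [nvp nvq] Kpq Npq Npq' epp eqq.
    have [[Vp Vq _] [Vp' Vq' _]] := (Npq, Npq').
    have {}Kpq' : color a b p' q'.
      by apply: (color_trans Kcd); apply: (color_trans Kpq); exact: color_step.
    (* A vertex [v] that sees [w1] but misses a neighbour [w3] of [w2] gives the pair [(v, w3)] the
       color of [(w1, w2)], which puts [v] into the span. *)
    have off w1 w2 : related E v w1 -> N w1 w2 -> color a b w1 w2 ->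
        forall w3, V w3 -> ~ related E v w3 -> related E w3 w2 -> False.
      move=> e1 N12 K12 w3 V3 n3 e3; apply: Bv; exists w3.
      by apply: (color_trans K12); apply: color_sym; apply: color_step.
    split=> e; first exact: (off p' q' e Npq' Kpq' q).
    exact: (off q' p' e (Nsym Npq') (color_swapr Kpq') p).
have [w [Kxw Nxw _]] := spanP Nab Bx.
exact: (cl x w).
Qed.

(** Triangle lemma: along a path in [(W, Q)] starting from [(y, z)], the vertex [x]
    keeps seeing both entries with the colors of [(x, y)] and [(x, z)]. *)
Lemma triangle x y z : N x y -> N x z -> N y z ->
  ~ color y z x y -> ~ color y z x z -> ~ span y z x.
Proof.
move=> Nxy Nxz Nyz ny nz [w]; have hJ := joined_set; have [Vx _ _] := Nxy.
have key y' z' : J y z (npair y' z') ->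
    [/\ ~ related E x y', ~ related E x z', color x y x y' & color x z x z']
    /\ J y z (npair y' z').
  have [h1 h2 h3] := And3 (hJ (npair x y)) (hJ (npair x z)) (hJ (npair y z)).
  apply: (J_closed hM (P := fun y' z' =>
    [/\ ~ related E x y', ~ related E x z', color x y x y' & color x z x z']
    /\ J y z (npair y' z'))).
  - by rewrite /color; d0.
  - split; last exact: joined_refl.
    have [[_ _ ?] [_ _ ?]] := (Nxy, Nxz).
    by split=> //; exact: color_refl.
  move=> p q p' q' [[np nq Kp Kq] Jpq] Npq Npq' ep eq.
  have [[Vp Vq _] [Vp' Vq' _]] := (Npq, Npq').
  have J' : J y z (npair p' q') by apply: (J_trans hM Jpq); exact: (J_step hM).
  have np' : ~ related E x p'.
    move=> e; apply: nz; apply: (color_trans (z := p') (t := q')); first by left.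
    apply: color_sym; apply: (color_trans Kq); apply: color_step => //.
  have nq' : ~ related E x q'.
    move=> e; apply: ny; apply: (color_trans (z := p') (t := q')); first by left.
    apply: color_sym; apply: (color_trans Kp); apply: color_swapl.
    by apply: color_step => //; apply: Nsym.
  split=> //; split=> //.
    by apply: (color_trans Kp); apply: color_step => //; exact: reflE.
  by apply: (color_trans Kq); apply: color_step => //; exact: reflE.
by case=> /key [[h h' _ _] _]; [apply: h | apply: h']; exact: reflE.
Qed.

(** Choose [z] so that [(a, z)] has the color of [(c, d)]. If the colors differ, [b] and [z] are
    nonadjacent. The triangle lemma at [z] gives [(b, z)] the color of [(a, b)]; applied at [b], it
    then excludes [b] from the span of [(a, z)], although the spans are equal. *)
Lemma same_span a b c d : N a b -> N c d ->
  (forall x, span a b x <-> span c d x) -> color a b c d.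
Proof.
move=> Nab Ncd same; apply: NNPP => ncol.
have [z [Kaz Naz Bz]] : exists z, [/\ color c d a z, N a z & span c d z].
  by apply: spanP => //; apply/same; exact: span_left.
have [[Va Vb _] [_ Vz _]] := (Nab, Naz).
have nabz : ~ color a b a z.
  by move=> h; apply: ncol; apply: color_trans h (color_sym Kaz).
have Nbz : N b z.
  split=> // e; apply: nabz; apply: color_step => //; exact: reflE.
have K1 : color a b b z.
  apply: NNPP => n1; apply: (@triangle z a b) => //; try exact: Nsym.
  - by move/color_swapr.
  - by move/color_swapr.
  - exact/same.
apply: (@triangle b a z) => //; try exact: Nsym.
- by move=> /color_sym /color_swapl.
- by move=> h; apply: nabz; apply: color_trans K1 (color_sym h).
- have /same [w Kw] := span_right a b.
  by exists w; apply: color_trans (color_sym Kaz) Kw.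
Qed.

Let C4_free x y z t : V x -> V y -> N x z -> N y t ->
  related E x y -> related E y z -> related E z t -> related E t x -> False.
Proof. by move=> *; apply: (@no_C4 M hM V E x y z t gVE reflE triE). Qed.

(** A vertex [x] of the second span outside the first sees all of the first. So its nonadjacent
    partner [y] is outside as well and also sees all of it; then [a], [x], [b], [y] form an induced
    4-cycle. *)
Lemma span_dominating_subset a b c d : N a b -> N c d ->
  (forall r, ~ R V E (span a b) r) -> forall x, span c d x -> span a b x.
Proof.
move=> Nab Ncd noR x Sx; apply: NNPP => nSx.
have dom z : V z -> ~ span a b z -> forall u, span a b u -> related E z u.
  move=> Vz nSz; case: (classic (K V E (span a b) z)) => [[_ //]|nK].
  by case: (noR z); split=> // -[].
have [y [Kxy [Vx Vy nxy] Sy]] := spanP Ncd Sx.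
have xab := dom x Vx nSx.
have yab : forall u, span a b u -> related E y u.
  by apply: dom => // /xab.
have [Sa Sb] := (span_left a b, span_right a b).
have [Va _ _] := Nab.
by apply: (C4_free Va Vx Nab (And3 Vx Vy nxy)); auto.
Qed.

Lemma span_minimal_buried a b r : N a b -> R V E (span a b) r ->
  minimal_buried V E (span a b) a b.
Proof.
move=> Nab Rr; have [Sa Sb] := (span_left a b, span_right a b).
split=> //.
  split.
  - split; first exact: span_set.
    by move=> x /(spanP Nab) [y [_ [] //]].
  - by exists a, b; have [_ _ ?] := Nab.
  - split; last by exists r.
    move=> x [[_ Kx] /(spanP Nab) [y [_ [_ _ nxy] Sy]]]; exact: nxy (Kx y Sy).
  - move=> x q Sx [Vq nSK] exq; apply: nSK.
    case: (classic (span a b q)) => [|nS]; [by left | right; split=> // y Sy].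
    apply: NNPP => nqy; apply: (span_module Nab Vq nS Sy Sx) => //.
    exact: Esym.
move=> A AS sub nsub Aa Ab [[_ AV] _ [KA _] RA]; apply: nsub.
have out x : V x -> ~ A x -> (forall u, A u -> related E x u) \/ (forall u, A u -> ~ related E u x).
  move=> Vx nAx; case: (classic (K V E A x)) => [[_ ?]|nK]; [by left | right].
  by move=> u Au; apply: RA => //; split=> // -[].
(* If [z] were outside the buried set [A], its neighbour [x] would force it to dominate [A]. Then
   [t] is outside too and, seeing [y], dominates [A]; this makes [x], [z], [y], [t] an induced
   4-cycle. Hence [A] is closed under [Q] and contains the span. *)
have cl x y z t : A x -> A y -> N x y -> N z t -> related E x z -> related E y t -> A z.
  move=> Ax Ay Nxy Nzt exz eyt; have [Vz Vt nzt] := Nzt; have [Vx Vy nxy] := Nxy.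
  apply: NNPP => nAz; case: (out z Vz nAz) => [Kz|/(_ x Ax) //].
  have nAt : ~ A t by move/Kz.
  case: (out t Vt nAt) => [Kt|/(_ y Ay) //].
  by apply: (C4_free Vx Vz Nxy Nzt); auto.
have key x y : color a b x y -> A x /\ A y.
  apply: (@color_closed (fun x y => A x /\ A y)) => //; first by d0.
    by move=> ? ? [].
  move=> p q p' q' [Ap Aq] _ Npq Npq' e1 e2.
  by split; [apply: (cl p q p' q') | apply: (cl q p q' p'); auto].
by move=> x [y /key []].
Qed.

Lemma some_span_buried a b c d : N a b -> N c d -> ~ color a b c d ->
  minimal_buried V E (span a b) a b \/ minimal_buried V E (span c d) c d.
Proof.
move=> Nab Ncd ncol.
case: (classic (exists r, R V E (span a b) r)) => [[r hr]|n1].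
  by left; apply: span_minimal_buried hr.
case: (classic (exists r, R V E (span c d) r)) => [[r hr]|n2].
  by right; apply: span_minimal_buried hr.
case: ncol; apply: same_span => // x; split; apply: span_dominating_subset => // r hr.
- by apply: n2; exists r.
- by apply: n1; exists r.
Qed.

End Colors.

Lemma ACA0_separated_pairs (M : L2_structure) : RCA0 M ->
  ACA0 M -> separated_pairs_buried M.
Proof.
move=> hM /ACA0_sigma1 hS V E gVE rE _ tE _ a b c d _ _ _ _.
move=> /(W_npair hM) Nab /(W_npair hM) Ncd n1 n2.
have [] := some_span_buried hM hS gVE rE tE Nab Ncd; first by case.
- by exists (span V E a b); left.
- by exists (span V E c d); right.
Qed.

(** * Interval graphs *)

Section Overlap.
Variable M : L2_structure.
Variables L lt_L : M -> Prop.
Hypothesis hL : is_linear_order L lt_L.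
Implicit Types (x y u v l r : M).

Lemma overlapE lu ru lv rv : L lu -> L ru -> L lv -> L rv ->
  related lt_L lu ru -> related lt_L lv rv ->
  ((related lt_L lu rv \/ lu = rv) /\ (related lt_L rv ru \/ rv = ru)) \/
  ((related lt_L lv ru \/ lv = ru) /\ (related lt_L ru rv \/ ru = rv)) <->
  ~ related lt_L ru lv /\ ~ related lt_L rv lu.
Proof.
have [_ irr trans tot] := hL => Llu Lru Llv Lrv lru lrv.
have nlt x y : related lt_L x y \/ x = y -> ~ related lt_L y x.
  move=> [h|->] h'; last exact: irr h'.
  exact: irr (trans _ _ _ h h').
have nltI x y : L x -> L y -> ~ related lt_L y x -> related lt_L x y \/ x = y.
  by move=> Lx Ly h; case: (tot x y Lx Ly); auto.
have letr x y z : related lt_L x y -> related lt_L y z \/ y = z -> related lt_L x z.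
  by move=> h [h'|<-] //; exact: trans h h'.
split=> [[[h1 h2]|[h1 h2]]|[h1 h2]].
- split; last exact: nlt.
  by apply: nlt; left; exact: letr lrv h2.
- split; first exact: nlt.
  by apply: nlt; left; exact: letr lru h2.
- have h1' := nltI _ _ Llv Lru h1; have h2' := nltI _ _ Llu Lrv h2.
  by case: (tot ru rv Lru Lrv) => h; [right|left|left]; auto.
Qed.

End Overlap.

(** [bef u v]: the interval of [u] lies entirely to the left of that of [v];
    [endle u v]: the interval of [u] ends no later than that of [v]. *)
Record interval_model (M : L2_structure) (V E : M -> Prop) (bef endle : M -> M -> Prop)
  : Prop := IntervalModel {
  im_bef : D0 (fun e => bef (e O) (e 1%N));
  im_endle : D0 (fun e => endle (e O) (e 1%N));
  im_vertex : forall u v, bef u v -> V u /\ V v;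
  im_adj : forall u v, V u -> V v -> (related E u v <-> ~ bef u v /\ ~ bef v u);
  im_irr : forall u, ~ bef u u;
  im_trans : forall u v w, bef u v -> bef v w -> bef u w;
  im_cross : forall u v w z, bef u v -> bef w z -> bef u z \/ bef w v;
  im_total : forall u v, V u -> V v -> endle u v \/ endle v u;
  im_endle_trans : forall u v w, endle u v -> endle v w -> endle u w;
  im_endle_bef : forall u v w, V u -> endle u v -> bef v w -> bef u w
}.

Section IntervalModels.
Variable M : L2_structure.
Hypothesis hM : RCA0 M.
Implicit Types (V E : M -> Prop) (x y z u v w i j k l m n p q s t a b c d r : M).

Lemma D0_rel_set (P : M -> M -> Prop) :
  is_set (fun w => exists u v, w = npair u v /\ P u v) <->
  D0 (fun e => P (e O) (e 1%N)).
Proof.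
split=> [h|h].
  apply: (@D0_ext _ (fun e => exists u v, npair (e O) (e 1%N) = npair u v /\ P u v)).
    move=> e; split=> [[u [v [/(npair_inj hM) [-> ->]]]] //|hP].
    by exists (e O), (e 1%N).
  by apply: (@D0_mem _ (fun w => exists u v, w = npair u v /\ P u v)
    (fun e => npair (e O) (e 1%N)) h); tf.
apply: (d0_set hM); apply: (@D0_exb _ (fun e => e O + 1)); first by tf.
  by move=> e u [v [-> _]]; apply/(ltS_le hM); exact: le_npair1.
apply: (@D0_exb _ (fun e => e 1%N + 1)); last by d0.
  by tf.
by move=> e v; rewrite /tail => -[-> _]; apply/(ltS_le hM); exact: le_npair2.
Qed.

Lemma related_pairs (P : M -> M -> Prop) u v :
  related (fun w => exists u v, w = npair u v /\ P u v) u v <-> P u v.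
Proof.
by split=> [[u' [v' [/(npair_inj hM) [-> ->]]]] //|h]; exists u, v.
Qed.

(** The values [r] and [l] admit no bound in terms of the arguments, so this is an instance of
    $\Delta^0_1$ comprehension: the negation is also existential, since either the arguments are not
    both in [V] or the unique values violate [T]. The resulting set then serves as a parameter. *)
Lemma D0_compose V F G Y Z (T : M -> M -> Prop) :
  is_set V -> is_function F V Y -> is_function G V Z -> D0 (fun e => T (e O) (e 1%N)) ->
  D0 (fun e => exists r l, [/\ related F (e O) r, related G (e 1%N) l & T r l]).
Proof.
move=> hV [hF Fsub Ftot Ffun] [hG Gsub Gtot Gfun] hT.
pose P u v := exists r l, [/\ related F u r, related G v l & T r l].
apply/(D0_rel_set P).
have lt1 x y : x <= y -> x < y + 1 by move/(ltS_le hM).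
have FV u r : related F u r -> V u.
  by move=> /Fsub [u' [r' [/(npair_inj hM) [-> _]]]].
have GV u r : related G u r -> V u.
  by move=> /Gsub [u' [r' [/(npair_inj hM) [-> _]]]].
apply: (@delta1_set _ hM _
  (fun x n => exists u, u < n + 1 /\ exists v, v < n + 1 /\ (n = npair u v /\
     exists r, r < x + 1 /\ exists l, l < x + 1 /\
     [/\ related F u r, related G v l & T r l]))
  (fun x n => (forall u, u < n + 1 -> forall v, v < n + 1 -> n = npair u v ->
     ~ (V u /\ V v)) \/
     exists u, u < n + 1 /\ exists v, v < n + 1 /\ (n = npair u v /\
     exists r, r < x + 1 /\ exists l, l < x + 1 /\
     [/\ related F u r, related G v l & ~ T r l]))).
- by d0.
- by d0.
- move=> n; split=> [[u [v [-> [r [l h]]]]]|]; last first.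
    by move=> [x [u [_ [v [_ [-> [r [_ [l [_ h]]]]]]]]]]; exists u, v; split=> //; exists r, l.
  exists (npair r l), u; split; first exact/lt1/le_npair1.
  exists v; split; first exact/lt1/le_npair2; split=> //.
  exists r; split; first exact/lt1/le_npair1.
  by exists l; split; first exact/lt1/le_npair2.
- move=> n; split=> [h|]; last first.
    move=> [x h] [u [v [e [r [l [hr hl hrl]]]]]]; case: h => [h|].
      apply: (h u _ v _ e); [| |by split; [exact: FV hr | exact: GV hl]].
        by rewrite e; exact/lt1/le_npair1.
      by rewrite e; exact/lt1/le_npair2.
    move=> [u' [_ [v' [_ [e' [r' [_ [l' [_ [hr' hl' n']]]]]]]]]].
    move: e'; rewrite e => /(npair_inj hM) [eu ev].
    by subst u' v'; apply: n'; rewrite (Ffun _ _ _ hr' hr) (Gfun _ _ _ hl' hl).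
  case: (classic (exists u v, [/\ n = npair u v, V u & V v])) => [[u [v [e Vu Vv]]]|hn].
    have [[r hr] [l hl]] := (Ftot _ Vu, Gtot _ Vv).
    exists (npair r l); right; exists u; split; first by rewrite e; exact/lt1/le_npair1.
    exists v; split; first by rewrite e; exact/lt1/le_npair2.
    split=> //; exists r; split; first exact/lt1/le_npair1.
    exists l; split; first exact/lt1/le_npair2.
    by split=> // hT'; apply: h; exists u, v; split=> //; exists r, l.
  exists 0; left=> u _ v _ e [Vu Vv]; by apply: hn; exists u, v.
Qed.

Definition between F (T : M -> M -> Prop) G u v : Prop :=
  exists r l, [/\ related F u r, related G v l & T r l].

Lemma interval_model_of_ends V E L lt_L fL fR : is_graph V E -> is_linear_order L lt_L ->
  is_function fL V L -> is_function fR V L ->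
  (forall p lp rp : M, related fL p lp -> related fR p rp -> related lt_L lp rp) ->
  (forall p q lp rp lq rq : M,
     related fL p lp -> related fR p rp -> related fL q lq -> related fR q rq ->
     (related E p q <->
      ((related lt_L lp rq \/ lp = rq) /\ (related lt_L rq rp \/ rq = rp)) \/
      ((related lt_L lq rp \/ lq = rp) /\ (related lt_L rp rq \/ rp = rq)))) ->
  interval_model V E (between fR (related lt_L) fL)
    (between fR (fun r l => related lt_L r l \/ r = l) fR).
Proof.
move=> [hV hE Esub Esym] hL' hfL hfR lr adj.
have [[hL hlt ltsub] irr trans tot] := hL'.
set bef := between fR _ fL; set endle := between fR _ fR.
have [_ Lsub Ltot Lfun] := hfL; have [_ Rsub Rtot Rfun] := hfR.
have LL u l : related fL u l -> V u /\ L l.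
  by move=> /Lsub [u' [l' [/(npair_inj hM) [-> ->]]]].
have RR u l : related fR u l -> V u /\ L l.
  by move=> /Rsub [u' [l' [/(npair_inj hM) [-> ->]]]].
split.
- by apply: (D0_compose hV hfR hfL); d0.
- by apply: (D0_compose hV hfR hfR); d0.
- by move=> u v [r [l [/RR [? _] /LL [? _] _]]].
- move=> u v Vu Vv.
  have [[lu hlu] [ru hru]] := (Ltot u Vu, Rtot u Vu).
  have [[lv hlv] [rv hrv]] := (Ltot v Vv, Rtot v Vv).
  have [[_ Llu] [_ Lru]] := (LL _ _ hlu, RR _ _ hru).
  have [[_ Llv] [_ Lrv]] := (LL _ _ hlv, RR _ _ hrv).
  have befE p q rp lq : related fR p rp -> related fL q lq -> (bef p q <-> related lt_L rp lq).
    move=> hp hq; split=> [[r [l [h1 h2]]]|h]; last by exists rp, lq.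
    by rewrite (Rfun _ _ _ h1 hp) (Lfun _ _ _ h2 hq).
  rewrite (adj u v lu ru lv rv) // !(befE _ _ _ _ hru hlv) !(befE _ _ _ _ hrv hlu).
  have lru := lr _ _ _ hlu hru; have lrv := lr _ _ _ hlv hrv.
  exact: (overlapE hL').
- move=> u [r [l [hr hl hlt']]]; apply: (irr r); apply: (trans _ _ _ hlt').
  exact: lr hl hr.
- move=> u v w [r [l [hr hl hrl]]] [r' [l' [hr' hl' hrl']]]; exists r, l'; split=> //.
  exact: trans (trans _ _ _ hrl (lr _ _ _ hl hr')) hrl'.
- move=> u v w z [r [l [hr hl hrl]]] [r' [l' [hr' hl' hrl']]].
  have [[_ Ll] [_ Ll']] := (LL _ _ hl, LL _ _ hl').
  case: (tot l l' Ll Ll') => h.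
  + by left; exists r, l'; split=> //; exact: trans hrl h.
  + by left; exists r, l'; split=> //; rewrite -h.
  + by right; exists r', l; split=> //; exact: trans hrl' h.
- move=> u v Vu Vv; have [[r hr] [r' hr']] := (Rtot u Vu, Rtot v Vv).
  have [[_ Lr] [_ Lr']] := (RR _ _ hr, RR _ _ hr').
  by case: (tot r r' Lr Lr') => h; [left; exists r, r'|left; exists r, r'|right; exists r', r];
    split; auto.
- move=> u v w [r [l [hr hl hrl]]] [r' [l' [hr' hl' hrl']]]; exists r, l'; split=> //.
  move: hrl hrl'; rewrite (Rfun _ _ _ hl hr') => -[h|->] // [h'|<-]; left=> //.
  exact: trans h h'.
- move=> u v w Vu [r [l [hr hl hrl]]] [r' [l' [hr' hl' hrl']]]; exists r, l'; split=> //.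
  move: hrl; rewrite (Rfun _ _ _ hl hr') => -[h|->] //; exact: trans h hrl'.
Qed.

Lemma closed_interval_model V E : closed_interval_graph V E ->
  exists bef endle, interval_model V E bef endle.
Proof.
move=> [gVE [L [lt_L [fL [fR [hL hfL hfR lr adj]]]]]].
by do 2!eexists; exact: interval_model_of_ends hL hfL hfR lr adj.
Qed.

End IntervalModels.

(** * Cycles, asteroidal triples and associated orders in interval graphs *)

Section IntervalGraphs.
Variable M : L2_structure.
Hypothesis hM : RCA0 M.
Variables (V E : M -> Prop) (bef endle : M -> M -> Prop).
Hypotheses (gVE : is_graph V E) (im : interval_model V E bef endle).
Implicit Types (x y z u v w i j k l m n p q s t a b c d r : M).

Add Ring M_ring4 : (M_semiring hM).

Notation N := (nonadj V E).
Notation J x y := (joined (Q V E) (npair x y)).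

Let hbef := im_bef im.
Let hendle := im_endle im.
Let axM : basic_axioms M. Proof. by case: hM. Qed.
Let EV x y : related E x y -> V x /\ V y.
Proof. by case: gVE => _ _ h _ /h [x' [y' [/(npair_inj hM) [-> ->]]]]. Qed.
Let Esym x y : related E x y -> related E y x. Proof. by case: gVE => _ _ _; apply. Qed.

Lemma interval_reflexive : reflexive_graph V E.
Proof. by move=> x Vx; apply/(im_adj im) => //; split; exact: im_irr im _. Qed.

Lemma bef_nonadj u v : bef u v -> N u v.
Proof.
move=> h; have [Vu Vv] := im_vertex im h; split=> //.
by move=> /(im_adj im Vu Vv) [].
Qed.

Lemma nonadj_bef u v : N u v -> bef u v \/ bef v u.
Proof.
move=> [Vu Vv nE]; apply: NNPP => h; apply: nE; apply/(im_adj im) => //.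
by split=> h'; apply: h; auto.
Qed.

(** The intervals of [v] and [w] both contain the right end of [u]. *)
Lemma common_neighbour u v w : related E u v -> related E u w ->
  endle u v -> endle u w -> related E v w.
Proof.
move=> euv euw; have [[Vu Vv] [_ Vw]] := (EV euv, EV euw).
move: euv euw => /(im_adj im Vu Vv) [n1 n2] /(im_adj im Vu Vw) [n3 n4] le1 le2.
by apply/(im_adj im) => //; split=> h; [apply: n3 | apply: n1];
  apply: (im_endle_bef im) h.
Qed.

(** Induction on the length of a prefix, where [k = 0] is the empty prefix without candidate. Only
    positions below [n] compete, so on a cycle the repeated last vertex is never selected. *)
Lemma earliest_end s n x y : is_path (related E) s n x y ->
  (forall i u, at_ s i u -> V u) -> 0 < n ->
  exists i u, [/\ i < n, at_ s i u & forall j v, j < n -> at_ s j v -> endle u v].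
Proof.
move=> [[_ sf sd] _ _ _] sV n0.
have key k : k < n + 1 -> k = 0 \/ exists i, i < k /\ exists u, u < s /\ (at_ s i u /\
    forall j, j < k -> forall v, v < s -> at_ s j v -> endle u v).
  move: k; apply: (d0_ind hM); first by d0.
    by left.
  move=> k IH hk; right.
  have {}hk : k < n by move/(lt_add2r hM): hk.
  have [w hw] : exists w, at_ s k w by apply/sd; apply: (lt_trans hM) hk (lt_S hM n).
  have refl_w : endle w w by case: (im_total im (sV _ _ hw) (sV _ _ hw)).
  have [k0|[i [ik [u [us [hu hmin]]]]]] := IH (lt_trans hM hk (lt_S hM n)).
    exists k; split; first exact: lt_S.
    exists w; split; first by case: (at_lt hM hw).
    split=> // j /(ltS_le hM) [jk|->] v vs hv; last by rewrite (sf _ _ _ hv hw).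
    by move: jk; rewrite k0 => /(nlt_0 axM).
  case: (im_total im (sV _ _ hu) (sV _ _ hw)) => huw.
    exists i; split; first by apply: (lt_trans hM) ik (lt_S hM k).
    exists u; split=> //; split=> // j /(ltS_le hM) [jk|->] v vs hv; first exact: hmin hv.
    by rewrite (sf _ _ _ hv hw).
  exists k; split; first exact: lt_S.
  exists w; split; first by case: (at_lt hM hw).
  split=> // j /(ltS_le hM) [jk|->] v vs hv; last by rewrite (sf _ _ _ hv hw).
  by apply: (im_endle_trans im) huw _; exact: hmin hv.
have [e|[i [hi [u [_ [hu h]]]]]] := key n (lt_S hM n).
  by case: (lt_irr hM (n := n)); rewrite {1}e.
exists i, u; split=> // j v hj hv; apply: (h j hj v _ hv); by case: (at_lt hM hv).
Qed.

Lemma interval_triangulated : triangulated E.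
Proof.
move=> s n n4 [[x hp] _].
have [[_ sf sd] s0 sn sR] := hp.
have n0 : 0 < n.
  by apply: (lt_le_trans hM) n4; apply/(gt0_succ hM); exists (2 + 1); ring.
have n1 : 0 + 1 < n + 1 by apply/(lt_add2r hM).
have Vx : V x.
  have [v hv] := (sd (0 + 1)).1 n1.
  by have [] := EV (sR _ _ _ n0 s0 hv).
have sV i u : at_ s i u -> V u.
  apply: (path_closed hM (P := V)) hp Vx _ i u; first by case: gVE.
  by move=> u' v' _ /EV [].
have [i [u [hi hu hmin]]] := earliest_end hp sV n0.
have {}hmin j v : j <= n -> at_ s j v -> endle u v.
  move=> [hj|->] hv; first exact: hmin hv.
  by rewrite (sf _ _ _ hv sn); exact: hmin s0.
have [m em] := (le_ex hM _ _).1 n4.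
have has_at j : j <= n -> exists v, at_ s j v by move=> hj; apply/sd/(ltS_le hM).
(* At position 0 the two neighbours on the cycle have positions 1 and [n - 1], the latter written
   [m + 2 + 1] because [n = 4 + m]. At [k + 1] they have positions [k] and [k + 2]. *)
case: (zero_or_succ hM i) => [i0|[k ek]].
- have jn : m + 2 + 1 < n by apply/(lt_ex hM); exists 0; rewrite em; ring.
  have [w hw] := has_at (m + 2 + 1) (or_introl jn).
  have [v hv] : exists v, at_ s (0 + 1) v by apply/sd.
  have ux : u = x by move: hu; rewrite i0 => /sf; apply.
  have euv : related E u v by rewrite ux; exact: sR n0 s0 hv.
  have euw : related E u w.
    apply: Esym; rewrite ux; apply: (sR _ _ _ jn hw).
    by rewrite (_ : m + 2 + 1 + 1 = n) // em; ring.
  exists (0 + 1), (m + 2 + 1), v, w; split=> //.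
  + apply: common_neighbour euv euw _ _; apply: hmin; [|exact: hv| |exact: hw].
      by apply/(ltS_le hM).
    by left.
  + by apply/(le_ex hM); exists m; ring.
  + by right; rewrite em; ring.
- have kn : k < n by apply: (lt_trans hM) hi; rewrite ek; exact: lt_S.
  have k2n : k + 1 + 1 <= n by apply/(leS_lt hM); rewrite -ek.
  have [v hv] := has_at k (or_introl kn).
  have [w hw] := has_at _ k2n.
  have euv : related E u v by apply: Esym; apply: (sR _ _ _ kn hv); rewrite -ek.
  have euw : related E u w by apply: (sR _ _ _ hi hu); rewrite ek.
  exists k, (k + 1 + 1), v, w; split=> //.
  + apply: common_neighbour euv euw _ _; apply: hmin; [|exact: hv| |exact: hw] => //.
    by left.
  + by right; ring.
  + by apply/(le_ex hM); exists m; rewrite em; ring.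
Qed.

Lemma joined_avoiding_stays (P : M -> Prop) c x y : is_set P ->
  (forall u v, P u -> related E u v -> ~ related E v c -> P v) ->
  joined_avoiding E c x y -> P x -> P y.
Proof.
move=> hP hcl [s [n [[hs s0 sn sR] sc]]] Px.
apply: (joined_closed hM hP (Rl := fun u v => related E u v /\ ~ related E v c)
  _ Px (fun u v Pu h => hcl u v Pu h.1 h.2)).
exists s, n; split=> // i u v hi hu hv; split; last exact: sc hv.
exact: sR hi hu hv.
Qed.

(** A path avoiding the neighbours of [c] stays on one side of [c]: a step from one side to the
    other would join two intervals separated by [c]. *)
Lemma no_path_across x c y : bef x c -> bef c y ->
  ~ joined_avoiding E c x y /\ ~ joined_avoiding E c y x.
Proof.
move=> hxc hcy; have [_ Vc] := im_vertex im hxc.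
have side u v : related E u v -> ~ related E v c -> bef v c \/ bef c v.
  by move=> /EV [_ Vv] h; apply: nonadj_bef.
split=> h.
- have : bef y c.
    apply: (joined_avoiding_stays (P := fun u => bef u c)) h hxc.
      by apply: (d0_set hM); d0.
    move=> u v uc euv /(side _ _ euv) [//|cv].
    by case: (bef_nonadj (im_trans im uc cv)).
  by move=> /(im_trans im hcy) /(im_irr im).
- have : bef c x.
    apply: (joined_avoiding_stays (P := fun u => bef c u)) h hcy.
      by apply: (d0_set hM); d0.
    move=> u v uc euv /(side _ _ euv) [cv|//].
    by case: (bef_nonadj (im_trans im cv uc)) => _ _ []; apply: Esym.
  by move=> /(im_trans im hxc) /(im_irr im).
Qed.

Lemma interval_no_asteroidal a b c : ~ asteroidal_triple V E a b c.
Proof.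
move=> [[Va Vb Vc] _ [nab nbc nac] [jc ja jb]].
have ab := nonadj_bef (And3 Va Vb nab).
have bc := nonadj_bef (And3 Vb Vc nbc).
have ac := nonadj_bef (And3 Va Vc nac).
have mid := no_path_across.
have tr := im_trans im.
case: ab => ab; case: bc => bc.
- by case: (mid _ _ _ ab bc).
- case: ac => ac; first by case: (mid _ _ _ ac bc).
  by case: (mid _ _ _ ac ab).
- case: ac => ac; first by case: (mid _ _ _ ab ac).
  by case: (mid _ _ _ bc ac).
- by case: (mid _ _ _ bc ab).
Qed.

(** By the crossing property of [bef], [x], [t] or [z], [y] are nonadjacent, so [P] compares them.
    If [P] had [t] before [z], either direction of that comparison would yield by transitivity a
    comparison between adjacent vertices. *)
Lemma associated_order_Q P x y z t : associated_order V E P ->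
  N x y -> N z t -> related E x z -> related E y t ->
  related P x y -> related P z t.
Proof.
move=> [[_ Psub irr trans] ass] Nxy Nzt exz eyt pxy.
have [[Vx Vy _] [Vz Vt nzt]] := (Nxy, Nzt).
have noP u v : related E u v -> ~ related P u v.
  move=> e h; have [Vu Vv] := EV e.
  by have /(ass u v Vu Vv) : related P u v \/ related P v u by left.
have [zt|tz] := (ass z t Vz Vt).1 nzt => //.
have [] : ~ related E x t \/ ~ related E z y.
  apply: NNPP => h; have [ext ezy] : related E x t /\ related E z y.
    by split; apply: NNPP => h'; apply: h; auto.
  have nb u v : related E u v -> ~ bef u v by move=> e /bef_nonadj [].
  case: (nonadj_bef Nxy) => h1; case: (nonadj_bef Nzt) => h2;
    case: (im_cross im h1 h2); apply: nb => //; exact: Esym.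
- move=> /(ass x t Vx Vt) [xt|tx].
    by case: (noP _ _ exz (trans _ _ _ xt tz)).
  by case: (noP _ _ (Esym eyt) (trans _ _ _ tx pxy)).
- move=> /(ass z y Vz Vy) [zy|yz].
    by case: (noP _ _ (Esym eyt) (trans _ _ _ tz zy)).
  by case: (noP _ _ exz (trans _ _ _ pxy yz)).
Qed.

Lemma associated_order_joined P x y z t : associated_order V E P ->
  J x y (npair z t) -> related P x y -> related P z t.
Proof.
move=> aP; have hP : is_set P by case: aP => -[].
move=> h h'; apply: (J_closed hM (P := fun u v => related P u v)) h' _ h; first by d0.
by move=> {}x {}y {}z {}t h Nxy Nzt exz eyt; exact: associated_order_Q h.
Qed.

Definition bef_set w : Prop := exists u v, w = npair u v /\ bef u v.

Lemma bef_setE u v : related bef_set u v <-> bef u v.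
Proof. exact: related_pairs. Qed.

Lemma bef_associated : associated_order V E bef_set.
Proof.
split; first split.
- exact/D0_rel_set.
- by move=> _ [u [v [-> h]]]; have [Vu Vv] := im_vertex im h; exists u, v.
- by move=> u /bef_setE /(im_irr im).
- by move=> u v w /bef_setE h /bef_setE h'; apply/bef_setE; exact: (im_trans im) h h'.
- move=> u v Vu Vv; rewrite !bef_setE; split=> [h|]; first exact: nonadj_bef.
  by move=> [/bef_nonadj []|/bef_nonadj [_ _ h] /Esym].
Qed.

(** [bef] is itself an associated order and is preserved along [Q]. Thus a pair and its reversal
    always account for two components. *)
Lemma bef_not_reversed a b : N a b -> ~ J a b (npair b a).
Proof.
have inv := associated_order_joined bef_associated.
have asym u v : bef u v -> ~ bef v u by move=> h /(im_trans im h) /(im_irr im).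
move=> Nab h; case: (nonadj_bef Nab) => hab.
  by apply: (asym a b) => //; apply/bef_setE; apply: inv h _; apply/bef_setE.
have h' := J_sym hM gVE h.
by apply: (asym b a) => //; apply/bef_setE; apply: inv h' _; apply/bef_setE.
Qed.

Definition dual P w : Prop := exists u v, w = npair u v /\ related P v u.

Lemma dualE P u v : related (dual P) u v <-> related P v u.
Proof. exact: (related_pairs hM (fun u v => related P v u)). Qed.

Lemma dual_associated P : associated_order V E P -> associated_order V E (dual P).
Proof.
move=> [[hP Psub irr trans] ass]; split; first split.
- by apply/(D0_rel_set hM (fun u v => related P v u)); d0.
- move=> _ [u [v [-> /Psub [v' [u' [/(npair_inj hM) [-> ->]]]]]]]; by exists u', v'.
- by move=> u /dualE /irr.
- by move=> u v w /dualE h /dualE h'; apply/dualE; exact: trans h' h.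
- by move=> u v Vu Vv; rewrite !dualE ass //; tauto.
Qed.

Lemma associated_orders_agree P P' a b :
  associated_order V E P -> associated_order V E P' ->
  (forall c d, N c d -> J a b (npair c d) \/ J a b (npair d c)) ->
  related P a b -> related P' a b -> forall u v, related P u v -> related P' u v.
Proof.
move=> aP aP' tot pab pab' u v puv.
have [[_ Psub irr trans] ass] := aP.
have Nuv : N u v.
  have [u' [v' [/(npair_inj hM) [eu ev] Vu Vv]]] := Psub _ puv.
  by split; rewrite ?eu ?ev //; rewrite -eu -ev; apply/ass; rewrite ?eu ?ev //; rewrite -eu -ev; left.
case: (tot u v Nuv) => h; first exact: (associated_order_joined aP' h).
by case: (irr u); apply: (trans _ _ _ puv); exact: (associated_order_joined aP h).
Qed.

End IntervalGraphs.

Lemma many_components_of_separated (M : L2_structure) : RCA0 M ->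
  separated_pairs_buried M -> many_components_buried M.
Proof.
move=> hM hS V E ci conn [z1 [z2 [z3 [[w1 w2 w3] [n12 n13 n23]]]]].
have gVE := ci.1; have [bef [endle im]] := closed_interval_model hM ci.
have [a [b [e1 Va Vb nab]]] := w1.
have [c [d [e2 Vc Vd ncd]]] := w2.
have [p [q [e3 Vp Vq npq]]] := w3.
move: w1 w2 w3 n12 n13 n23; rewrite {}e1 {}e2 {}e3 => w1 w2 w3 n12 n13 n23.
have main x y z t : V x -> V y -> V z -> V t ->
    W V E (npair x y) -> W V E (npair z t) ->
    ~ joined (Q V E) (npair x y) (npair z t) ->
    ~ joined (Q V E) (npair x y) (npair t z) -> exists B, buried V E B.
  move=> Vx Vy Vz Vt wxy wzt n n'.
  have [B [[]|[]]] := hS V E gVE (interval_reflexive im) conn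
    (interval_triangulated hM gVE im) (interval_no_asteroidal hM gVE im)
    x y z t Vx Vy Vz Vt wxy wzt n n'; by exists B.
(* If neither [(c, d)] nor [(p, q)] can serve as the second pair, then [(a, b)] is joined to both
   reversals, and reversing again joins [(c, d)] to [(p, q)]. *)
case: (classic (joined (Q V E) (npair a b) (npair d c))) => [h|]; last exact: main n12.
case: (classic (joined (Q V E) (npair a b) (npair q p))) => [h'|]; last exact: main n13.
case: n23; apply: (J_swap hM gVE).
exact: (J_trans hM (J_sym hM gVE h) h').
Qed.

Lemma uniquely_orderable_of_few_components (M : L2_structure) V E : RCA0 M ->
  closed_interval_graph V E -> ~ @more_than_two_components M V E ->
  uniquely_orderable V E.
Proof.
move=> hM ci few; have gVE := ci.1.
have [bef [endle im]] := closed_interval_model hM ci.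
have aB := bef_associated hM gVE im.
exists (bef_set bef); split=> // P aP.
(* Without nonadjacent pairs every associated order is empty. *)
case: (classic (exists a b, nonadj V E a b)) => [|none]; last first.
  left=> u v; have no R : associated_order V E R -> ~ related R u v.
    move=> [[_ Rsub _ _] ass] h; apply: none; exists u, v.
    have [u' [v' [/(npair_inj hM) [eu ev] Vu Vv]]] := Rsub _ h.
    by split; rewrite ?eu ?ev //; rewrite -eu -ev; apply/ass; rewrite ?eu ?ev //; rewrite -eu -ev; left.
  by split=> /no [].
move=> [a0 [b0 N0]].
have [a [b [Nab bab]]] : exists a b, nonadj V E a b /\ bef a b.
  case: (nonadj_bef im N0) => h; first by exists a0, b0.
  by exists b0, a0; split=> //; exact: nonadj_sym.
have tot x y c d : nonadj V E x y -> nonadj V E c d ->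
    joined (Q V E) (npair x y) (npair c d) \/ joined (Q V E) (npair x y) (npair d c).
  move=> Nxy Ncd; apply: NNPP => n; apply: few.
  (* A pair, its reversal and a pair joined to neither lie in three components. *)
  exists (npair x y), (npair y x), (npair c d); split.
    by split; apply/(W_npair hM) => //; exact: (nonadj_sym gVE).
  split; first exact: (bef_not_reversed hM gVE im).
    by move=> h; apply: n; left.
  by move=> /(J_swap hM gVE) h; apply: n; right.
have rab : related (bef_set bef) a b by apply/(bef_setE hM).
have [[Va Vb nab] Nba] := (Nab, nonadj_sym gVE Nab).
case: (aP.2 a b Va Vb).1 => // hP.
  by left=> u v; split; apply: (associated_orders_agree hM gVE im (a := a) (b := b)) => //;
    move=> c d; exact: tot.
have aD := dual_associated hM aB.
have rba : related (dual (bef_set bef)) b a by apply/(dualE hM).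
right=> u v; rewrite -(dualE hM (bef_set bef)).
by split; apply: (associated_orders_agree hM gVE im (a := b) (b := a)) => //;
  move=> c d; exact: tot.
Qed.

Lemma not_uniquely_orderable_of_many_components (M : L2_structure) : RCA0 M ->
  many_components_buried M -> not_uniquely_orderable_buried M.
Proof.
move=> hM h3 V E ci conn nu; apply: h3 => //; apply: NNPP => few.
by apply: nu; exact: uniquely_orderable_of_few_components.
Qed.

(** * The injury graph *)

Section LinearOrders.
Variable M : L2_structure.
Hypothesis hM : RCA0 M.
Variables L lt_L : M -> Prop.
Hypothesis hL : is_linear_order L lt_L.
Implicit Types (x y u v l r : M).

Lemma interval_graph_of_functions V fL fR : is_set V ->
  is_function fL V L -> is_function fR V L ->
  (forall p lp rp : M, related fL p lp -> related fR p rp -> related lt_L lp rp) ->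
  exists E, closed_interval_graph V E /\
    interval_model V E (between fR (related lt_L) fL)
      (between fR (fun r l => related lt_L r l \/ r = l) fR).
Proof.
move=> hV hfL hfR lr; have [[_ hlt _] irr trans tot] := hL.
have [_ Lsub Ltot Lfun] := hfL; have [_ Rsub Rtot Rfun] := hfR.
have LL u l : related fL u l -> V u /\ L l.
  by move=> /Lsub [u' [l' [/(npair_inj hM) [-> ->]]]].
have RR u l : related fR u l -> V u /\ L l.
  by move=> /Rsub [u' [l' [/(npair_inj hM) [-> ->]]]].
set bef := between fR (related lt_L) fL.
have hbef : D0 (fun e => bef (e O) (e 1%N)) by apply: (D0_compose hM hV hfR hfL); d0.
pose adj u v := [/\ V u, V v, ~ bef u v & ~ bef v u].
pose E w := exists u v, w = npair u v /\ adj u v.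
have EE u v : related E u v <-> adj u v by exact: related_pairs.
have befE p q rp lq : related fR p rp -> related fL q lq -> (bef p q <-> related lt_L rp lq).
  move=> hp hq; split=> [[r [l [h1 h2]]]|h]; last by exists rp, lq.
  by rewrite (Rfun _ _ _ h1 hp) (Lfun _ _ _ h2 hq).
have gE : is_graph V E.
  split=> //.
  - by apply/(D0_rel_set hM); rewrite /adj; d0.
  - by move=> _ [u [v [-> [Vu Vv _ _]]]]; exists u, v.
  - by move=> u v /EE [? ? ? ?]; apply/EE.
have EP u v lu ru lv rv : related fL u lu -> related fR u ru -> related fL v lv ->
    related fR v rv -> (related E u v <->
    ((related lt_L lu rv \/ lu = rv) /\ (related lt_L rv ru \/ rv = ru)) \/
    ((related lt_L lv ru \/ lv = ru) /\ (related lt_L ru rv \/ ru = rv))).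
  move=> hlu hru hlv hrv; have [[Vu ?] [Vv ?]] := (LL _ _ hlu, LL _ _ hlv).
  have [[_ ?] [_ ?]] := (RR _ _ hru, RR _ _ hrv).
  have [? ?] := (lr _ _ _ hlu hru, lr _ _ _ hlv hrv).
  rewrite EE (overlapE hL) // -(befE _ _ _ _ hru hlv) -(befE _ _ _ _ hrv hlu).
  by split=> [[]|[]].
exists E; split; last exact: interval_model_of_ends hL hfL hfR lr EP.
by split=> //; exists L, lt_L, fL, fR.
Qed.

End LinearOrders.

Section InjuryGraph.
Variable M : L2_structure.
Hypothesis hM : RCA0 M.
Variable D : M -> M -> Prop.
Hypotheses (hD : D0 (fun e => D (e O) (e 1%N)))
           (Duniq : forall m t t', D m t -> D m t' -> t = t').
Implicit Types (x y z u v w i j k l m n p q s t a b c d r : M).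

Add Ring M_ring5 : (M_semiring hM).

Let axM : basic_axioms M. Proof. by case: hM. Qed.

(** [(x, s)] with [x > 0] guesses that no [m < x - 1] is enumerated after stage
    [s + 2]; it is injured when this guess is refuted. *)
Definition injured x s t : Prop :=
  exists t', t' < t + 1 /\ (s + 2 < t' /\ exists m, m < x /\ (m + 1 < x /\ D m t')).

(** The left cut in time of the point [(x, s)] of the line: [(0, s)] sits at time
    [s], and [(x, s)] with [x > 0] just before its injury. *)
Definition cut x s t : Prop := (x = 0 /\ t < s) \/ (~ x = 0 /\ ~ injured x s t).

(** Points are ordered by inclusion of their cuts, tested only up to time [s + u + 2] so that the
    order is bounded. In a tie the larger first coordinate comes first, hence a guess precedes a
    time and the more easily injured guess precedes the other; after that, the later stage comes
    first. *)
Definition point_lt x s y u : Prop :=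
  (exists t, t < s + u + 2 + 1 /\ (cut y u t /\ ~ cut x s t)) \/
  ((forall t, t < s + u + 2 + 1 -> (cut x s t <-> cut y u t)) /\
   (y < x \/ (x = y /\ u < s))).

Lemma D0_cut : D0 (fun e => cut (e O) (e 1%N) (e 2%N)).
Proof. by rewrite /cut /injured; d0. Qed.

Lemma injuredP x s t : injured x s t <->
  exists t' m, [/\ t' <= t, s + 2 < t', m + 1 < x & D m t'].
Proof.
split=> [[t' [/(ltS_le hM) h1 [h2 [m [_ [h3 h4]]]]]]|[t' [m [h1 h2 h3 h4]]]].
  by exists t', m.
exists t'; split; first exact/(ltS_le hM).
split=> //; exists m; split=> //; apply: (lt_trans hM) h3; exact: lt_S.
Qed.

Lemma injured_late x s t : injured x s t -> s + 2 < t.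
Proof. by move=> /injuredP [t' [m [h1 h2 _ _]]]; exact: (lt_le_trans hM) h2 h1. Qed.

Lemma injured_mono x s t u : t <= u -> injured x s t -> injured x s u.
Proof.
move=> tu /injuredP [t' [m [h1 h2 h3 h4]]]; apply/injuredP; exists t', m.
by split=> //; exact: (le_trans hM) h1 tu.
Qed.

Lemma cut_down x s t u : t <= u -> cut x s u -> cut x s t.
Proof.
move=> tu [[-> h]|[hx h]]; [left|right]; split=> //.
  exact: (le_lt_trans hM) tu h.
by move/(injured_mono tu).
Qed.

Lemma cut_comparable x s y u t : cut y u t -> ~ cut x s t ->
  forall t', cut x s t' -> cut y u t'.
Proof.
move=> hy hx t' hx'; apply: cut_down hy.
by case: (le_or_lt hM t' t) => // h; case: hx; apply: cut_down hx'; left.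
Qed.

(** The bounded test loses nothing. Consider a tie of two guesses and an injury of [(y, u)] at [t'].
    If [t' <= s + 2], it lies in the tested range at a time when [(x, s)] is still uninjured,
    contradicting agreement. If [t'] is later, the same event injures [(x, s)], because a tie has
    [y <= x]. *)
Lemma point_lt_sub x s y u t : point_lt x s y u -> cut x s t -> cut y u t.
Proof.
case=> [[t' [_ [h1 h2]]]|[agree tie]]; first exact: cut_comparable h1 h2 t.
case: (classic (x = 0)) => [x0|x0].
  move: tie; rewrite x0 => -[/(nlt_0 axM)|[y0 us]] //.
  have hu : u < s + u + 2 + 1 by apply/(lt_ex hM); exists (s + 2); ring.
  case: (agree u hu) => /(_ (or_introl (conj x0 us))) [[_ /(lt_irr hM)] //|[]].
  by rewrite -y0.
case: (classic (y = 0)) => [y0|y0].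
  have hu : u < s + u + 2 + 1 by apply/(lt_ex hM); exists (s + 2); ring.
  have nu : ~ cut x s u.
    by move/(agree u hu) => [[_ /(lt_irr hM)]|[]].
  move=> ct; left; split=> //; case: (le_or_lt hM u t) => // ut.
  by case: nu; exact: cut_down ct.
move=> [[//]|[_ ninj]]; right; split=> // /injuredP [t' [m [t't ut' my Dm]]].
have yx : y <= x by case: tie => [h|[-> _]]; [left | right].
case: (le_or_lt hM t' (s + 2)) => ht'; last first.
  by apply: ninj; apply/injuredP; exists t', m; split=> //; exact: (lt_le_trans hM) my yx.
have hb : t' < s + u + 2 + 1.
  by apply/(ltS_le hM); apply: (le_trans hM) ht' _; apply/(le_ex hM); exists u; ring.
have [h _] := agree t' hb; have [] : cut y u t'.
- apply: h; right; split=> // /injured_late /(lt_not_le hM); exact.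
- by case.
- by case=> _; apply; apply/injuredP; exists t', m; split=> //; right.
Qed.

Lemma point_lt_irr x s : ~ point_lt x s x s.
Proof. by case=> [[t [_ []]]|[_ [/(lt_irr hM)|[_ /(lt_irr hM)]]]]. Qed.

Lemma point_lt_total x s y u :
  [\/ point_lt x s y u, x = y /\ s = u | point_lt y u x s].
Proof.
case: (classic (exists t, t < s + u + 2 + 1 /\ (cut y u t /\ ~ cut x s t))) => [h|h1].
  by constructor 1; left.
have e : u + s = s + u by ring.
case: (classic (exists t, t < u + s + 2 + 1 /\ (cut x s t /\ ~ cut y u t))) => [h|h2].
  by constructor 3; left.
have agree t : t < s + u + 2 + 1 -> (cut x s t <-> cut y u t).
  by move=> ht; split=> hc; apply: NNPP => n; [apply: h2 | apply: h1]; exists t; rewrite ?e.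
have agree' t : t < u + s + 2 + 1 -> (cut y u t <-> cut x s t).
  by rewrite e => /agree ->.
have [yx|[exy|xy]] := lt_total hM y x.
- by constructor 1; right; split; [|left].
- have [us|[esu|su]] := lt_total hM u s.
  + by constructor 1; right; split; [|right].
  + by constructor 2.
  + by constructor 3; right; split; [|right].
- by constructor 3; right; split; [|left].
Qed.

Lemma point_lt_trans x s y u z v :
  point_lt x s y u -> point_lt y u z v -> point_lt x s z v.
Proof.
move=> h1 h2.
have tie x' s' y' u' : point_lt x' s' y' u' -> (forall t, cut y' u' t -> cut x' s' t) ->
    y' < x' \/ (x' = y' /\ u' < s').
  by case=> [[t [_ [h n]]] sub|[]] //; case: n; exact: sub.
(* Otherwise the points form a cycle. Their cuts then coincide and every comparison in the cycle is
   a tie, but the tie rule is lexicographic and admits no cycle. *)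
have [//|[exz esv]|h3] := point_lt_total x s z v.
  subst z v; have [yx|[exy us]] := tie _ _ _ _ h1 (fun t => point_lt_sub h2).
    have [xy|[eyx _]] := tie _ _ _ _ h2 (fun t => point_lt_sub h1).
      by case: (lt_irr hM (lt_trans hM xy yx)).
    by case: (lt_neq hM yx).
  have [xy|[eyx su]] := tie _ _ _ _ h2 (fun t => point_lt_sub h1).
    by case: (lt_neq hM xy).
  by case: (lt_irr hM (lt_trans hM su us)).
have s1 := point_lt_sub h1; have s2 := point_lt_sub h2; have s3 := point_lt_sub h3.
have t1 := tie _ _ _ _ h1 (fun t h => s3 t (s2 t h)).
have t2 := tie _ _ _ _ h2 (fun t h => s1 t (s3 t h)).
have t3 := tie _ _ _ _ h3 (fun t h => s2 t (s1 t h)).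
have : z < x \/ (x = z /\ v < s).
  case: t1 t2 => [yx|[-> us]] [zy|[<- vu]].
  - by left; exact: (lt_trans hM) zy yx.
  - by left.
  - by left.
  - by right; split=> //; exact: (lt_trans hM) vu us.
case: t3 => [xz|[ezx sv]] [zx|[exz vs]].
- by case: (lt_irr hM (lt_trans hM xz zx)).
- by case: (lt_neq hM xz).
- by case: (lt_neq hM zx).
- by case: (lt_irr hM (lt_trans hM sv vs)).
Qed.

Lemma point_lt_times s u : point_lt 0 s 0 u <-> s < u.
Proof.
have key s' u' : s' < u' -> point_lt 0 s' 0 u'.
  move=> su; left; exists s'; split.
    by apply/(lt_ex hM); exists (u' + 2); ring.
  by split; [left | move=> [[_ /(lt_irr hM)]|[]]].
split=> [h|/key //]; have [//|[e|/key h']] := lt_total hM s u.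
  by move: h; rewrite e => /point_lt_irr.
by case: (point_lt_irr (point_lt_trans h h')).
Qed.

Lemma point_lt_injured x s t : ~ x = 0 -> point_lt x s 0 t <-> injured x s t.
Proof.
move=> x0; split=> [h|h].
  apply: NNPP => ninj.
  have : cut 0 t t by apply: (point_lt_sub h); right.
  by case=> [[_ /(lt_irr hM)]|[]].
have [//|[] //|h'] := point_lt_total x s 0 t.
case: h' => [[t' [_ [hc n]]]|[_ [/(nlt_0 axM) //|[e _]]]]; last by case: x0.
case: hc => [[//]|[_ []]]; apply: injured_mono h.
by case: (le_or_lt hM t t') => // h; case: n; left.
Qed.

Lemma injured_or_before x s t : ~ x = 0 -> point_lt 0 t x s <-> ~ injured x s t.
Proof.
move=> x0; split=> [h /(point_lt_injured s t x0) h'|h].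
  by case: (point_lt_irr (point_lt_trans h h')).
have [//|[e _]|/(point_lt_injured s t x0) h'] := point_lt_total 0 t x s.
  by case: x0.
by case: h.
Qed.

Lemma not_injured1 s t : ~ injured 1 s t.
Proof.
move=> /injuredP [t' [m [_ _ h _]]].
by apply: (nlt_0 axM (m := m)); apply/(lt_add2r hM 1); rewrite (add0m hM).
Qed.

Lemma neq_10 : ~ (1 : M) = 0.
Proof. by move=> e; case: (neq_01 hM). Qed.

(** A guess with first coordinate 1 concerns no number, so it is never injured and its cut contains
    all times. Among such points the tie rule leaves [(1, 0)] last, which makes it the right end for
    the universal vertex. *)
Lemma last_point x s : ~ point_lt 1 0 x s.
Proof.
case: (classic (x = 0)) => [->|x0].
  by move/(point_lt_injured 0 s neq_10)/not_injured1.
move=> h; have := h; case=> [[t [_ [_ []]]]|[_ [|[_ /(nlt_0 axM)]]]] //.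
  by right; split; [exact: neq_10 | exact: not_injured1].
by rewrite -[1](add0m hM) (ltS_le hM) => -[/(nlt_0 axM)|].
Qed.

Lemma first_point x s : ~ point_lt x s 0 0.
Proof.
case: (classic (x = 0)) => [->|x0]; first by move/point_lt_times/(nlt_0 axM).
by move/(point_lt_injured s 0 x0)/injured_late/(nlt_0 axM).
Qed.

Definition point w : Prop := exists x y, w = npair x y.

Definition code_lt a b : Prop := exists x s y u,
  [/\ a = npair x s, b = npair y u & point_lt x s y u].

Lemma code_ltE x s y u : code_lt (npair x s) (npair y u) <-> point_lt x s y u.
Proof.
split=> [[x' [s' [y' [u' [/(npair_inj hM) [-> ->] /(npair_inj hM) [-> ->]]]]]] //|h].
by exists x, s, y, u.
Qed.

Definition line_lt w : Prop := exists a b, w = npair a b /\ code_lt a b.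

Lemma line_ltE x s y u : related line_lt (npair x s) (npair y u) <-> point_lt x s y u.
Proof. by rewrite -code_ltE; exact: related_pairs. Qed.

Lemma point_set : is_set point.
Proof.
apply: (d0_set hM); apply: (@D0_exb _ (fun e => e O + 1)); first by tf.
  by move=> e x [s ->]; apply/(ltS_le hM); exact: le_npair1.
apply: (@D0_exb _ (fun e => e 1%N + 1)); last by d0.
  by tf.
by move=> e s; rewrite /tail => ->; apply/(ltS_le hM); exact: le_npair2.
Qed.

Let lt1 x y : x <= y -> x < y + 1. Proof. by move/(ltS_le hM). Qed.

Lemma line_lt_set : is_set line_lt.
Proof.
apply/(D0_rel_set hM); rewrite /code_lt.
have hc := D0_cut.
apply: (@D0_exb _ (fun e => e O + 1)); first by tf.
  by move=> e x [s [y [u [-> _ _]]]]; exact/lt1/le_npair1.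
apply: (@D0_exb _ (fun e => e 1%N + 1)); first by tf.
  by move=> e s [y [u]]; rewrite /tail => -[-> _ _]; exact/lt1/le_npair2.
apply: (@D0_exb _ (fun e => e 3%N + 1)); first by tf.
  by move=> e y [u]; rewrite /tail => -[_ -> _]; exact/lt1/le_npair1.
apply: (@D0_exb _ (fun e => e 4%N + 1)); first by tf.
  by move=> e u; rewrite /tail => -[_ -> _]; exact/lt1/le_npair2.
by rewrite /point_lt; d0.
Qed.

Lemma line_ltP a b : related line_lt a b <-> code_lt a b.
Proof. exact: related_pairs. Qed.

Lemma line_order : is_linear_order point line_lt.
Proof.
split.
- split; [exact: point_set | exact: line_lt_set |].
  by move=> _ [_ [_ [-> [x [s [y [u [-> -> _]]]]]]]]; exists (npair x s), (npair y u);
    split=> //; [exists x, s | exists y, u].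
- move=> w /line_ltP [x [s [y [u [-> /(npair_inj hM) [<- <-]]]]]].
  exact: point_lt_irr.
- move=> a b c /line_ltP [x [s [y [u [-> -> h]]]]].
  move=> /line_ltP [y' [u' [z [v [/(npair_inj hM) [<- <-] -> h']]]]].
  by apply/line_ltE; exact: point_lt_trans h h'.
- move=> _ _ [x [s ->]] [y [u ->]].
  by have [h|[-> ->]|h] := point_lt_total x s y u;
    [constructor 1; apply/line_ltE | constructor 2 | constructor 3; apply/line_ltE].
Qed.

(** The vertex [(0, 0)] is a pendant to the left of everything except the universal
    vertex [(0, 1)]; the [(0, t)] with [t > 1] form an induced path in time, and the
    remaining [(x, s)] start with this path and end when [(x, s)] is injured. *)
Definition left_end a b : Prop := exists x s, a = npair x s /\
  ((x = 0 /\ (s < 2 /\ b = npair 0 0)) \/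
   (x = 0 /\ (~ s < 2 /\ b = npair 0 s)) \/
   (~ x = 0 /\ b = npair 0 2)).

Definition right_end a b : Prop := exists x s, a = npair x s /\
  ((x = 0 /\ (s = 0 /\ b = npair 0 1)) \/
   (x = 0 /\ (s = 1 /\ b = npair 1 0)) \/
   (x = 0 /\ (~ s < 2 /\ b = npair 0 (s + 1))) \/
   (~ x = 0 /\ b = npair x s)).

Definition left_set w : Prop := exists a b, w = npair a b /\ left_end a b.
Definition right_set w : Prop := exists a b, w = npair a b /\ right_end a b.

Lemma D0_left : D0 (fun e => left_end (e O) (e 1%N)).
Proof.
apply: (@D0_exb _ (fun e => e O + 1)); first by tf.
  by move=> e x [s [-> _]]; exact/lt1/le_npair1.
apply: (@D0_exb _ (fun e => e 1%N + 1)); first by tf.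
  by move=> e s; rewrite /tail => -[-> _]; exact/lt1/le_npair2.
by d0.
Qed.

Lemma D0_right : D0 (fun e => right_end (e O) (e 1%N)).
Proof.
apply: (@D0_exb _ (fun e => e O + 1)); first by tf.
  by move=> e x [s [-> _]]; exact/lt1/le_npair1.
apply: (@D0_exb _ (fun e => e 1%N + 1)); first by tf.
  by move=> e s; rewrite /tail => -[-> _]; exact/lt1/le_npair2.
by d0.
Qed.

Lemma lt0_2 : (0 : M) < 2. Proof. by apply/(lt_ex hM); exists 1; ring. Qed.
Lemma lt1_2 : (1 : M) < 2. Proof. exact: lt_S. Qed.

Lemma lt2_cases s : s < 2 -> s = 0 \/ s = 1.
Proof.
move=> /(ltS_le hM) [|]; last by right.
by rewrite -[1](add0m hM) (ltS_le hM) => -[/(nlt_0 axM)|]; left.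
Qed.

Lemma left_setE x s y u : related left_set (npair x s) (npair y u) <->
  [\/ [/\ x = 0, s < 2, y = 0 & u = 0], [/\ x = 0, ~ s < 2, y = 0 & u = s]
    | [/\ ~ x = 0, y = 0 & u = 2]].
Proof.
rewrite (related_pairs hM left_end); split.
  move=> [x' [s' [/(npair_inj hM) [<- <-] h]]].
  case: h => [[h1 [h2 /(npair_inj hM) [-> ->]]]|]; first by constructor 1.
  case=> [[h1 [h2 /(npair_inj hM) [-> ->]]]|]; first by constructor 2.
  by move=> [h1 /(npair_inj hM) [-> ->]]; constructor 3.
move=> h; exists x, s; split=> //; case: h => [[-> ? -> ->]|[-> ? -> ->]|[? -> ->]].
- by left.
- by right; left.
- by right; right.
Qed.

Lemma right_setE x s y u : related right_set (npair x s) (npair y u) <->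
  [\/ [/\ x = 0, s = 0, y = 0 & u = 1], [/\ x = 0, s = 1, y = 1 & u = 0],
      [/\ x = 0, ~ s < 2, y = 0 & u = s + 1] | [/\ ~ x = 0, y = x & u = s]].
Proof.
rewrite (related_pairs hM right_end); split.
  move=> [x' [s' [/(npair_inj hM) [<- <-] h]]].
  case: h => [[h1 [h2 /(npair_inj hM) [-> ->]]]|]; first by constructor 1.
  case=> [[h1 [h2 /(npair_inj hM) [-> ->]]]|]; first by constructor 2.
  case=> [[h1 [h2 /(npair_inj hM) [-> ->]]]|]; first by constructor 3.
  by move=> [h1 /(npair_inj hM) [-> ->]]; constructor 4.
move=> h; exists x, s; split=> //.
case: h => [[-> ? -> ->]|[-> ? -> ->]|[-> ? -> ->]|[? -> ->]].
- by left.
- by right; left.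
- by right; right; left.
- by right; right; right.
Qed.

Lemma left_function : is_function left_set point point.
Proof.
split.
- by apply/(D0_rel_set hM); exact: D0_left.
- move=> _ [a [b [-> [x [s [-> h]]]]]]; exists (npair x s), b; split=> //; first by exists x, s.
  by case: h => [[_ [_ ->]]|[[_ [_ ->]]|[_ ->]]]; do 2!eexists.
- move=> _ [x [s ->]]; case: (classic (x = 0)) => x0; last first.
    by exists (npair 0 2); apply/left_setE; constructor 3.
  case: (classic (s < 2)) => s2.
    by exists (npair 0 0); apply/left_setE; constructor 1.
  by exists (npair 0 s); apply/left_setE; constructor 2.
- move=> a b c; rewrite !(related_pairs hM left_end).
  move=> [x [s [-> h]]] [x' [s' [/(npair_inj hM) [<- <-] h']]].
  by case: h => [[? [? ->]]|[[? [? ->]]|[? ->]]]; case: h' => [[? [? ->]]|[[? [? ->]]|[? ->]]].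
Qed.

Lemma right_function : is_function right_set point point.
Proof.
have h02 := lt0_2; have h12 := lt1_2; have h01 := neq_01 hM.
split.
- by apply/(D0_rel_set hM); exact: D0_right.
- move=> _ [a [b [-> [x [s [-> h]]]]]]; exists (npair x s), b; split=> //; first by exists x, s.
  by case: h => [[_ [_ ->]]|[[_ [_ ->]]|[[_ [_ ->]]|[_ ->]]]]; do 2!eexists.
- move=> _ [x [s ->]]; case: (classic (x = 0)) => x0; last first.
    by exists (npair x s); apply/right_setE; constructor 4.
  case: (classic (s < 2)) => [/lt2_cases [s0|s1]|s2].
  + by exists (npair 0 1); apply/right_setE; constructor 1.
  + by exists (npair 1 0); apply/right_setE; constructor 2.
  + by exists (npair 0 (s + 1)); apply/right_setE; constructor 3.
- move=> a b c; rewrite !(related_pairs hM right_end).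
  move=> [x [s [-> h]]] [x' [s' [/(npair_inj hM) [<- <-] h']]].
  case: h => [[? [e ->]]|[[? [e ->]]|[[? [? ->]]|[? ->]]]];
    case: h' => [[? [e' ->]]|[[? [e' ->]]|[[? [? ->]]|[? ->]]]] //; subst s => //;
    by case: h01.
Qed.

Lemma left_lt_right p lp rp : related left_set p lp -> related right_set p rp ->
  related line_lt lp rp.
Proof.
have h02 := lt0_2; have h12 := lt1_2; have h01 := neq_01 hM.
have [_ sub _ _] := left_function; have [_ sub' _ _] := right_function.
move=> h h'.
have [_ [_ [/(npair_inj hM) [<- <-] [x [s e]] [y [u e1]]]]] := sub _ h.
have [_ [_ [/(npair_inj hM) [_ <-] _ [z [v e2]]]]] := sub' _ h'.
subst p lp rp; move: h h' => /left_setE h /right_setE h'; apply/line_ltE.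
case: h => [[? ? -> ->]|[? ? -> ->]|[? -> ->]];
  case: h' => [[? ? -> ->]|[? ? -> ->]|[? ? -> ->]|[? -> ->]] //; try by subst s.
- by apply/point_lt_times; rewrite -[1](add0m hM); exact: lt_S.
- by apply/(injured_or_before _ _ neq_10); exact: not_injured1.
- by apply/point_lt_times; exact: lt_S.
(* All guesses start at time 2, and the offset 2 in [injured] ensures that they are still uninjured
   then. *)
- apply/injured_or_before => // /injured_late h.
  by case: (lt_not_le hM h); exact: le_addl.
Qed.

Notation bef := (between right_set (related line_lt) left_set).

Lemma befE a y u b z v : related right_set a (npair y u) ->
  related left_set b (npair z v) -> bef a b <-> point_lt y u z v.
Proof.
have [_ _ _ Lfun] := left_function; have [_ _ _ Rfun] := right_function.
move=> ha hb; rewrite -line_ltE; split=> [[r [l [h1 h2]]]|h].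
  by rewrite (Rfun _ _ _ h1 ha) (Lfun _ _ _ h2 hb).
by exists (npair y u), (npair z v).
Qed.

Notation vr := (npair 0 0).
Notation vk := (npair 0 1).
Notation vb t := (npair 0 (t + 2)).

Let nb2 t : ~ t + 2 < 2.
Proof. by move=> h; case: (lt_not_le hM h); exact: le_addl. Qed.

Lemma vertex_cases v : point v -> [\/ v = vr, v = vk, exists t, v = vb t |
  exists x s, ~ x = 0 /\ v = npair x s].
Proof.
move=> [x [s ->]]; case: (classic (x = 0)) => [->|x0]; last first.
  by constructor 4; exists x, s.
case: (classic (s < 2)) => [/lt2_cases [->|->]|h]; [by constructor 1 | by constructor 2 |].
case: (le_or_lt hM 2 s) => [/(le_ex hM) [t ->]|] //.
by constructor 3; exists t; congr (npair _ _); ring.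
Qed.

Let Rr : related right_set vr (npair 0 1). Proof. by apply/right_setE; constructor 1. Qed.
Let Rk : related right_set vk (npair 1 0). Proof. by apply/right_setE; constructor 2. Qed.
Let Rb t : related right_set (vb t) (npair 0 (t + 2 + 1)).
Proof. by apply/right_setE; constructor 3. Qed.
Let Rw x s : ~ x = 0 -> related right_set (npair x s) (npair x s).
Proof. by move=> ?; apply/right_setE; constructor 4. Qed.
Let Lr : related left_set vr (npair 0 0).
Proof. by apply/left_setE; constructor 1; split=> //; exact: lt0_2. Qed.
Let Lk : related left_set vk (npair 0 0).
Proof. by apply/left_setE; constructor 1; split=> //; exact: lt1_2. Qed.
Let Lb t : related left_set (vb t) (npair 0 (t + 2)).
Proof. by apply/left_setE; constructor 2. Qed.
Let Lw x s : ~ x = 0 -> related left_set (npair x s) (npair 0 2).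
Proof. by move=> ?; apply/left_setE; constructor 3. Qed.

Lemma point_ends v : point v -> exists y u z w,
  related right_set v (npair y u) /\ related left_set v (npair z w).
Proof.
have [_ subL totL _] := left_function; have [_ subR totR _] := right_function.
move=> pv; have [[l hl] [r hr]] := (totL v pv, totR v pv).
have [_ [_ [/(npair_inj hM) [_ <-] _ [z [w el]]]]] := subL _ hl.
have [_ [_ [/(npair_inj hM) [_ <-] _ [y [u er]]]]] := subR _ hr.
by exists y, u, z, w; rewrite -el -er.
Qed.

Lemma bef_r v : ~ bef v vr.
Proof.
move=> h; have [r [l [hr _ _]]] := h.
have [_ subR _ _] := right_function.
have [_ [_ [/(npair_inj hM) [_ <-] _ [y [u eyu]]]]] := subR _ hr.
by move: hr h; rewrite eyu => hr /(befE hr Lr) /first_point.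
Qed.

Section Graph.
Variables (E : M -> Prop) (endle : M -> M -> Prop).
Hypothesis ciE : closed_interval_graph point E.
Hypothesis im : interval_model point E bef endle.

Let adj u v : point u -> point v -> (related E u v <-> ~ bef u v /\ ~ bef v u).
Proof. exact: im_adj im u v. Qed.
Let gE : is_graph point E. Proof. exact: ciE.1. Qed.
Let Esym x y : related E x y -> related E y x. Proof. by case: gE => _ _ _; apply. Qed.
Let pt x s : point (npair x s). Proof. by exists x, s. Qed.

Lemma adj_k v : point v -> related E vk v.
Proof.
move=> pv; have [y [u [z [w [hr hl]]]]] := point_ends pv; apply/adj => //; split.
  by move/(befE Rk hl)/last_point.
by move/(befE hr Lk)/first_point.
Qed.

Lemma bef_r_path t : bef vr (vb t).
Proof.
apply/(befE Rr (Lb t))/point_lt_times/(lt_ex hM); exists t; ring.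
Qed.

Lemma bef_r_guess x s : ~ x = 0 -> bef vr (npair x s).
Proof.
move=> x0; apply/(befE Rr (Lw s x0))/point_lt_times; exact: lt1_2.
Qed.

Lemma adj_path t u : related E (vb t) (vb u) <-> ~ t + 1 < u /\ ~ u + 1 < t.
Proof.
rewrite adj // (befE (Rb t) (Lb u)) (befE (Rb u) (Lb t)) !point_lt_times.
have e a : a + 2 + 1 = a + 1 + 2 by ring.
by rewrite !e !(lt_add2r hM).
Qed.

Lemma adj_guesses x s y u : ~ x = 0 -> ~ y = 0 -> related E (npair x s) (npair y u).
Proof.
move=> x0 y0; apply/adj => //.
rewrite (befE (Rw s x0) (Lw u y0)) (befE (Rw u y0) (Lw s x0)).
rewrite (point_lt_injured s 2 x0) (point_lt_injured u 2 y0).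
by split=> /injured_late; exact: nb2.
Qed.

Lemma adj_guess_path x s t : ~ x = 0 ->
  (related E (npair x s) (vb t) <-> ~ injured x s (t + 2)).
Proof.
move=> x0; rewrite adj // (befE (Rw s x0) (Lb t)) (befE (Rb t) (Lw s x0)).
rewrite (point_lt_injured s (t + 2) x0) point_lt_times.
split=> [[] //|h]; split=> // h'; apply: (@nb2 t).
by apply: (lt_trans hM) h'; exact: lt_S.
Qed.

Lemma graph_connected : connected_graph point E.
Proof.
move=> u v pu pv; apply: (joined_trans hM (y := vk)); apply: (joined_step hM).
  by apply: Esym; exact: adj_k.
exact: adj_k.
Qed.

Let nadj_r v : point v -> v <> vr -> v <> vk -> bef vr v.
Proof.
move=> pv n1 n2; case: (vertex_cases pv) => // [[t ->]|[x [s [x0 ->]]]].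
  exact: bef_r_path.
exact: bef_r_guess.
Qed.

(** This is [bef] with the pendant moved to the far right. Transitivity survives because the pendant
    is comparable with every vertex except itself and [vk], and [vk] is comparable with none. *)
Let flipped u v : Prop := (bef u v /\ u <> vr) \/ (bef v u /\ v = vr).

Lemma flipped_associated : associated_order point E
  (fun w => exists u v, w = npair u v /\ flipped u v).
Proof.
have hbef := im_bef im.
have fE u v : related (fun w => exists u v, w = npair u v /\ flipped u v) u v <-> flipped u v.
  exact: related_pairs.
have nk u v : bef u v -> u <> vk /\ v <> vk.
  move=> h; have [pu pv] := im_vertex im h.
  split=> e; move: h; rewrite e => h.
    by have /(adj (pt 0 1) pv) [] := adj_k pv.
  by have /(adj (pt 0 1) pu) [] := adj_k pu.
split; first split.
- apply/(D0_rel_set hM flipped); move: hbef; rewrite /flipped.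
  by set R := between _ _ _ => hbef; d0.
- move=> _ [u [v [-> h]]]; exists u, v; split=> //;
    by case: h => -[h _]; case: (im_vertex im h).
- by move=> u /fE [[h _]|[h _]]; case: (im_irr im h).
- move=> u v w /fE h /fE h'; apply/fE; move: h h' => [[uv ur]|[vu vr]] [[vw vr']|[wv wr]].
  + by left; split=> //; exact: (im_trans im) uv vw.
  + right; rewrite wr; split=> //.
    have [pu _] := im_vertex im uv; have [uk _] := nk _ _ uv.
    exact: nadj_r.
  + by case: vr'.
  + by move: wv; rewrite vr => h; case: (bef_r h).
- move=> u v pu pv; split=> [h|].
    have : bef u v \/ bef v u by apply: (nonadj_bef im); split.
    case: (classic (u = vr)) => [eu|nu]; case: (classic (v = vr)) => [ev|nv].
    + by rewrite eu ev => -[/bef_r|/bef_r].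
    + move=> [h'|]; first by right; apply/fE; right.
      by rewrite eu => /bef_r.
    + move=> [|h']; last by left; apply/fE; right.
      by rewrite ev => /bef_r.
    + by move=> [h'|h']; [left|right]; apply/fE; left.
  by rewrite !fE => -[[[h _]|[h _]]|[[h _]|[h _]]] /(adj pu pv) [].
Qed.

(** The orders [bef] and [flipped] agree on [vb 0], [vb 2] and disagree on [vr], [vb 0]; so they are
    neither equal nor dual, and cannot both be [P] or its dual. *)
Lemma graph_not_uniquely_orderable : ~ uniquely_orderable point E.
Proof.
have hbef := im_bef im.
move=> [P [[[_ _ irr trans] _] uniq]].
have rb := bef_r_path 0; have rb' : ~ bef (vb 0) vr by exact: bef_r.
have nbr : vb 0 <> vr :> M by move=> e; move: rb; rewrite e => /bef_r.
have bb : bef (vb 0) (vb 2).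
  by apply/(befE (Rb 0) (Lb 2))/point_lt_times/(lt_ex hM); exists 0; ring.
have fE u v : related (fun w => exists u v, w = npair u v /\ flipped u v) u v <-> flipped u v.
  exact: related_pairs.
have bE u v := bef_setE hM bef u v.
have f1 : flipped (vb 0) vr by right.
have f2 : flipped (vb 0) (vb 2) by left.
have no u v : related P u v -> related P v u -> False.
  by move=> h h'; exact: irr (trans _ _ _ h h').
have [h1|h1] := uniq _ (bef_associated hM gE im); have [h2|h2] := uniq _ flipped_associated.
- by apply: (no vr (vb 0)); [apply/h1/bE | apply/h2/fE].
- by apply: (no (vb 0) (vb 2)); [apply/h1/bE | apply/h2/fE].
- by apply: (no (vb 0) (vb 2)); [apply/h2/fE | apply/h1/bE].
- by apply: (no vr (vb 0)); [apply/h2/fE | apply/h1/bE].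
Qed.

(** * Which vertices a buried subgraph of the injury graph contains *)

Section Buried.
Variable B : M -> Prop.
Hypothesis bB : buried point E B.

Let BS : is_set B. Proof. by case: bB => -[]. Qed.
Let BV v : B v -> point v. Proof. by case: bB => -[_ h] _ _ _; apply: h. Qed.

(** An outside vertex with a nonneighbour in [B] belongs to [R(B)], and therefore has no neighbour
    in [B]. *)
Let module v y z : point v -> B y -> related E v y -> B z -> ~ related E v z -> B v.
Proof.
case: bB => _ _ _ hR pv By evy Bz nvz; apply: NNPP => nB.
apply: (hR y v By) (Esym evy); split=> // -[//|[_ K]].
exact: nvz (K z Bz).
Qed.

Let not_dominating v : B v -> exists2 z, B z & ~ related E v z.
Proof.
case: bB => _ _ [hK _] _ Bv; apply: NNPP => n; case: (hK v); split=> //.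
split; first exact: BV.
by move=> z Bz; apply: NNPP => nz; apply: n; exists z.
Qed.

Let nB_k : ~ B vk.
Proof. by move=> /not_dominating [z /BV /adj_k]. Qed.

Let path_adj t : related E (vb (t + 1)) (vb t).
Proof.
apply/adj_path; split=> h.
  apply: (lt_irr hM (n := t)); apply: (lt_trans hM) h.
  by apply/(lt_ex hM); exists 1; ring.
exact: lt_irr h.
Qed.

Let nadj_r_path t : ~ related E (vb t) vr.
Proof. by move=> /(adj (pt _ _) (pt _ _)) [_ []]; exact: bef_r_path. Qed.
Let nadj_r_guess x s : ~ x = 0 -> ~ related E (npair x s) vr.
Proof. by move=> x0 /(adj (pt _ _) (pt _ _)) [_ []]; exact: bef_r_guess. Qed.

Let adj_guess_0 x s : ~ x = 0 -> related E (npair x s) (vb 0).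
Proof.
move=> x0; apply/adj_guess_path => // /injured_late.
by rewrite (add0m hM); exact: nb2.
Qed.

(** Downward induction, carried out on the distance [j] from [t]; quantifying [n] below [t + 1]
    keeps it bounded. *)
Let path_down t : (forall n, B (vb (n + 1)) -> B (vb n)) -> B (vb t) ->
  forall n, n <= t -> B (vb n).
Proof.
move=> step Bt; have key j : forall n, n < t + 1 -> n + j = t -> B (vb n).
  move: j; apply: (d0_ind hM); first by d0.
    by move=> n _ e; have -> : n = t by rewrite -e add_0.
  move=> j IH n _ e; apply/step/IH; last by rewrite -e; ring.
  by apply/(lt_ex hM); exists j; rewrite -e; ring.
by move=> n nt; have [j e] := (le_ex hM _ _).1 nt; apply: (key j) => //; exact/lt1.
Qed.

Let path_up j : (forall n, j <= n -> B (vb n) -> B (vb (n + 1))) -> B (vb j) ->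
  forall n, j <= n -> B (vb n).
Proof.
move=> step Bj n /(le_ex hM) [i ->]; move: i; apply: (d0_ind hM); first by d0.
  by rewrite add_0.
by move=> i /(step _ (le_addr hM _ _)); rewrite (addmA hM j i 1).
Qed.

(** With the pendant in [B], any vertex not adjacent to it that sees some element of [B] is drawn
    into [B]. Starting from a nonneighbour of the pendant this captures [vb 0], the whole path and
    all guesses. Only [vk] is left, and it lies in [K(B)], so [R(B)] would be empty. *)
Let nB_r : ~ B vr.
Proof.
move=> Br; have [x Bx nrx] := not_dominating Br.
have near v y : point v -> B y -> related E v y -> ~ related E v vr -> B v.
  by move=> pv By e n; exact: module e Br n.
have B0 : B (vb 0).
  case: (vertex_cases (BV Bx)) => [ex|ex|[t ex]|[y [s [y0 ex]]]].
  - by case: nrx; rewrite ex; apply/adj => //; split; exact: bef_r.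
  - by case: nB_k; rewrite -ex.
  - apply: (path_down (t := t)); last exact: le0m; last by rewrite -ex.
    by move=> n Bn; apply: near Bn (Esym (path_adj n)) _.
  - by apply: near Bx _ _ => //; apply: Esym; rewrite ex; exact: adj_guess_0.
have Bpath t : B (vb t).
  apply: (path_up _ B0); last exact: le0m.
  by move=> n _ Bn; exact: near Bn (path_adj n) _.
case: bB => _ _ [_ [v [pv nv]]] _; apply: nv.
case: (vertex_cases pv) => [->|->|[t ->]|[y [s [y0 ->]]]]; [by left| |by left|left].
  by right; split=> // z /BV /adj_k.
by apply: near B0 _ _ => //; [exact: adj_guess_0 | exact: nadj_r_guess].
Qed.

Let buried_cases v : B v -> (exists t, v = vb t) \/ exists x s, ~ x = 0 /\ v = npair x s.
Proof.
move=> Bv; case: (vertex_cases (BV Bv)) => [e|e|h|h]; [| |by left|by right].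
  by case: nB_r; rewrite -e.
by case: nB_k; rewrite -e.
Qed.

(** Guesses are pairwise adjacent, so a nonadjacent pair in [B] contains a path vertex. The other
    member, or the earlier of two path vertices, misses the path from there on, since an injury is
    permanent. *)
Let far_path_vertex : exists z j, [/\ B z, B (vb j) &
  forall t, j <= t -> ~ related E z (vb t)].
Proof.
have far t u : t + 1 < u -> forall n, u <= n -> ~ related E (vb t) (vb n).
  by move=> h n un /adj_path [h' _]; apply: h'; exact: (lt_le_trans hM) h un.
have farg x s t : ~ x = 0 -> ~ related E (npair x s) (vb t) ->
    forall n, t <= n -> ~ related E (npair x s) (vb n).
  move=> x0 /(adj_guess_path s t x0) h n tn /(adj_guess_path s n x0) h'; apply: h => hi.
  by apply: h'; apply: injured_mono hi; apply/(le_add2r hM).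
case: bB => _ [x [y [Bx By nxy]]] _ _.
case: (buried_cases Bx) (buried_cases By) => [[t ex]|[x' [s [x0 ex]]]]
  [[u ey]|[y' [s' [y0 ey]]]]; subst x y.
- have [h|h] : t + 1 < u \/ u + 1 < t.
    by apply: NNPP => h; apply: nxy; apply/adj_path; split=> h'; apply: h; auto.
  + by exists (vb t), u; split=> //; exact: far.
  + by exists (vb u), t; split=> //; exact: far.
- exists (npair y' s'), t; split=> //; apply: farg => // /Esym; exact: nxy.
- by exists (npair x' s), u; split=> //; exact: farg.
- by case: nxy; exact: adj_guesses.
Qed.

(** Upwards from [j] the missed vertex is [z], which sees none of the later path. Downwards from
    [n + 1] to [n] it is the far path vertex [n + j + 2], already in [B] and not adjacent to
    position [n]. *)
Lemma buried_path t : B (vb t).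
Proof.
have [z [j [Bz Bj far]]] := far_path_vertex.
have up n : j <= n -> B (vb n).
  apply: path_up => // {}n jn Bn; apply: (module (pt _ _) Bn (path_adj n) Bz).
  by move/Esym; apply: far; apply: (le_trans hM) jn _; exact: le_addr.
have step n : B (vb (n + 1)) -> B (vb n).
  move=> Bn; have Bf : B (vb (n + j + 2)) by apply: up; apply/(le_ex hM); exists (n + 2); ring.
  apply: (module (pt _ _) Bn (Esym (path_adj n)) Bf) => /adj_path [h _]; apply: h.
  by apply/(lt_ex hM); exists j; ring.
case: (le_or_lt hM j t) => [/up //|tj].
by apply: (path_down step Bj); left.
Qed.

(** An element of [B] has a nonneighbour in [B]; for a guess this can only be a path vertex, reached
    after the injury. Conversely an injured guess sees [vb 0] and misses a later path vertex, both
    of which are in [B]. *)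
Lemma buried_guess x s : ~ x = 0 -> (B (npair x s) <-> exists t, injured x s t).
Proof.
move=> x0; split=> [Bw|[t h]].
  have [z /buried_cases [[t ->]|[y [u [y0 ->]]]] nz] := not_dominating Bw.
    exists (t + 2); apply: NNPP => h; apply: nz; exact/adj_guess_path.
  by case: nz; exact: adj_guesses.
have [t' et] : exists t', t = t' + 2.
  have /(lt_ex hM) [k ->] := injured_late h; exists (s + k + 1); ring.
apply: (module (pt _ _) (buried_path 0) (adj_guess_0 _ x0) (buried_path t')).
by move=> /(adj_guess_path s t' x0); apply; rewrite -et.
Qed.

End Buried.
End Graph.
(** Never being injured is a $\Pi^0_1$ condition, too complex to stand under the existential
    quantifier of a $\Sigma^0_1$ induction. With [B] as a parameter it becomes membership in a
    set. *)
Lemma guess_holds (B : M -> Prop) : is_set B ->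
  (forall x s, ~ x = 0 -> (B (npair x s) <-> exists t, injured x s t)) ->
  forall x, exists s, ~ B (npair (x + 1) s).
Proof.
move=> BS BP; have succ0 x : ~ x + 1 = 0 by exact: succ_neq0.
apply: (sigma1_ind hM (A := fun s x => ~ B (npair (x + 1) s))); first by d0.
  exists 0; rewrite (add0m hM) => /(BP _ _ neq_10) [t]; exact: not_injured1.
move=> x [s hs].
have ninj t : ~ injured (x + 1) s t by move=> h; apply: hs; apply/BP => //; exists t.
have later s' : s <= s' -> (forall t, D x t -> t <= s' + 2) -> ~ B (npair (x + 1 + 1) s').
  move=> ss' hx /(BP _ _ (succ0 _)) [t /injuredP [t' [m [h1 h2 h3 h4]]]].
  move: h3 => /(lt_add2r hM) /(ltS_le hM) [mx|emx]; last first.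
    by case: (lt_not_le hM h2); apply: hx; rewrite -emx.
  apply: (ninj t'); apply/injuredP; exists t', m; split=> //; first by right.
    by apply: (le_lt_trans hM) h2; apply/(le_add2r hM).
  by apply/(lt_add2r hM).
(* Passing from [x + 1] to [x + 1 + 1] adds only the number [x] to the guess, so it suffices to wait
   for its enumeration, if there is one. *)
case: (classic (exists t, D x t)) => [[t ht]|n].
  exists (s + t); apply: later; first exact: le_addr.
  by move=> t' /(Duniq ht) <-; apply/(le_ex hM); exists (s + 2); ring.
by exists s; apply: later; [right | move=> t ht; case: n; exists t].
Qed.

(** With [B] the complement of the range is existential too: some correct guess [(m + 2, s)], which
    covers [m] itself, together with a check of the stages up to [s + 2], shows that [m] never
    appears. *)
Lemma enumerated_set : not_uniquely_orderable_buried M -> is_set (fun m => exists t, D m t).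
Proof.
move=> h4; have [E [ci im]] :=
  interval_graph_of_functions hM line_order point_set left_function right_function left_lt_right.
have [B bB] := h4 point E ci (graph_connected ci im) (graph_not_uniquely_orderable ci im).
have BS : is_set B by case: bB => -[].
have BP := buried_guess ci im bB.
have succ0 x : ~ x + 1 = 0 by exact: succ_neq0.
apply: (@delta1_set _ hM _ (fun t m => D m t)
  (fun s m => ~ B (npair (m + 1 + 1) s) /\ forall t, t < s + 2 + 1 -> ~ D m t)).
- by d0.
- by d0.
- by [].
- move=> m; split=> [n|[s [nB n]] [t ht]].
    have [s hs] := guess_holds BS BP (m + 1).
    by exists s; split=> // t _ ht; apply: n; exists t.
  case: (le_or_lt hM t (s + 2)) => [/(ltS_le hM) /n //|st].
  apply: nB; apply/BP => //; exists t; apply/injuredP; exists t, m.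
  by split=> //; [right | exact: lt_S].
Qed.

End InjuryGraph.

Lemma sigma1_of_buried (M : L2_structure) : RCA0 M ->
  not_uniquely_orderable_buried M -> sigma1_comprehension M.
Proof.
(* Keeping only the least witness gives each number at most one stage, as [Duniq] demands, without
   changing the projection. *)
move=> hM h4 A hA; pose D m t := A t m /\ forall t', t' < t -> ~ A t' m.
rewrite (_ : (fun n => _) = fun m => exists t, D m t).
  apply: enumerated_set => //; first by rewrite /D; d0.
  move=> m t t' [h1 h2] [h3 h4']; have [h|[//|h]] := lt_total hM t t'.
    by case: (h4' t).
  by case: (h2 t').
apply: predext => m; split=> [[t ht]|[t [ht _]]]; last by exists t.
have hS : is_set (fun t => A t m) by apply: (d0_set hM); d0.
have [t0 h0 hmin] := set_least hM hS ht; by exists t0.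
Qed.

(** * Arithmetical comprehension from projections *)

Section Arithmetical.
Variable M : L2_structure.
Hypothesis hM : RCA0 M.
Hypothesis sigma1_set : sigma1_comprehension M.
Implicit Types (P : (nat -> M) -> Prop) (e f g h : nat -> M) (n N i : nat).

Lemma eval_support (t : term) : exists N, forall e e' : nat -> M,
  (forall i, (i < N)%N -> e i = e' i) -> eval e t = eval e' t.
Proof.
elim: t => [i|||t [m IHt] u [n IHu]|t [m IHt] u [n IHu]]; try by exists 0%N.
- by exists i.+1 => e e'; apply.
- exists (maxn m n) => e e' h /=; rewrite (IHt e e') ?(IHu e e') // => i hi;
    by apply: h; rewrite leq_max hi ?orbT.
- exists (maxn m n) => e e' h /=; rewrite (IHt e e') ?(IHu e e') // => i hi;
    by apply: h; rewrite leq_max hi ?orbT.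
Qed.

Definition supported P N : Prop := forall e e',
  (forall i, (i < N)%N -> e i = e' i) -> P e <-> P e'.

Lemma supported_leq P m n : (m <= n)%N -> supported P m -> supported P n.
Proof. by move=> mn h e e' he; apply: h => i hi; apply: he; exact: leq_trans mn. Qed.

(** A formula depends on finitely many variables, in the standard sense, so an environment may be
    replaced by the code of a tuple. *)
Lemma sat_support s (p : formula) : exists N, supported (fun e => sat s e p) N.
Proof.
have two P Q m n : supported P m -> supported Q n ->
    supported P (maxn m n) /\ supported Q (maxn m n).
  by move=> hP hQ; split; [apply: supported_leq hP | apply: supported_leq hQ];
    rewrite leq_max leqnn ?orbT.
have terms t u : exists N, forall e e' : nat -> M, (forall i, (i < N)%N -> e i = e' i) ->
    eval e t = eval e' t /\ eval e u = eval e' u.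
  have [[m hm] [n hn]] := (eval_support t, eval_support u).
  by exists (maxn m n) => e e' h; split; [apply: hm | apply: hn] => i hi;
    apply: h; rewrite leq_max hi ?orbT.
have under N e e' x : (forall i, (i < N)%N -> e i = e' i) ->
    forall i, (i < N)%N -> scons x e i = scons x e' i.
  by move=> h [|i] // hi; apply: h; exact: ltnW.
elim: p => /=.
- by move=> t u; have [N h] := terms t u; exists N => e e' /h [-> ->].
- by move=> t u; have [N h] := terms t u; exists N => e e' /h [-> ->].
- by move=> t X; have [N h] := eval_support t; exists N => e e' /h ->.
- by move=> p [N h]; exists N => e e' /h ->.
- move=> p [m hp] q [n hq]; exists (maxn m n) => e e' he.
  by have [h1 h2] := two _ _ _ _ hp hq; rewrite (h1 e e' he) (h2 e e' he).
- move=> p [m hp] q [n hq]; exists (maxn m n) => e e' he.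
  by have [h1 h2] := two _ _ _ _ hp hq; rewrite (h1 e e' he) (h2 e e' he).
- move=> p [m hp] q [n hq]; exists (maxn m n) => e e' he.
  by have [h1 h2] := two _ _ _ _ hp hq; rewrite (h1 e e' he) (h2 e e' he).
- move=> p [N h]; exists N => e e' he.
  by split=> hx x; apply/(h _ _ (under _ _ _ x he)).
- move=> p [N h]; exists N => e e' he.
  by split=> -[x hx]; exists x; apply/(h _ _ (under _ _ _ x he)).
Qed.

Fixpoint tuple_code (n : nat) (e : nat -> M) : M :=
  match n with O => 0 | S m => npair (e m) (tuple_code m e) end.

Lemma tuple_code_term n : term_fun (tuple_code n).
Proof.
elim: n => [|n IH] /=; first exact: TF_const.
have sum : term_fun (fun e => e n + tuple_code n e) by apply: TF_add => //; exact: TF_var.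
by apply: TF_add; [exact: TF_mul | exact: TF_var].
Qed.

Lemma tuple_codeP n e e' :
  tuple_code n e = tuple_code n e' <-> forall i, (i < n)%N -> e i = e' i.
Proof.
elim: n => [|n IH] //=; split.
- move=> /(npair_inj hM) [en /IH h] i; rewrite ltnS leq_eqVlt => /orP [/eqP ->|] //.
  exact: h.
- by move=> h; rewrite h //; congr npair; apply/IH => i hi; apply: h; exact: ltnW.
Qed.

Definition glue n g h : nat -> M := fun i => if (i < n)%N then g i else h (i - n)%N.

(** The entry [f O] packs the first [n] variables and the others follow unpacked. Since [n] is a
    standard number, [D0_decoded] can unpack one entry at a time by bounded quantifiers. *)
Definition decoded n P f : Prop :=
  exists g, f O = tuple_code n g /\ P (glue n g (tail f)).

Lemma D0_decoded n P : D0 P -> D0 (decoded n P).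
Proof.
move=> hP; elim: n => [|n IH].
  apply: (@D0_ext _ (fun f => f O = 0 /\ P (fun i => f (S i)))).
    move=> f; rewrite /decoded.
    have e g : glue 0 g (tail f) = (fun i => f (S i)).
      by apply: functional_extensionality => i; rewrite /glue ltn0 subn0.
    by split=> [[h1 h2]|[g [h1]]]; [exists f; rewrite e | rewrite e].
  by apply: D0_and; [d0 | exact: D0_ren].
apply: (@D0_ext _ (fun f => exists c, exists a,
    f O = npair a c /\ decoded n P (scons c (scons a (tail f))))).
  have glueS g f : glue n.+1 g (tail f) = glue n g (scons (g n) (tail f)).
    apply: functional_extensionality => i; rewrite /glue ltnS leq_eqVlt.
    case: (ltngtP i n) => //= [ni|->]; last by rewrite subnn.
    by rewrite -(subnSK ni).
  move=> f; split=> [[c [a [e [g [/= ec hg]]]]]|[g [e hg]]].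
    pose g' i := if i == n then a else g i.
    have gg' : glue n g (tail (scons c (scons a (tail f)))) = glue n g' (scons a (tail f)).
      apply: functional_extensionality => i; rewrite /glue /g'.
      by case: (ltngtP i n).
    exists g'; split; last by rewrite glueS {2}/g' eqxx -gg'.
    rewrite /= {1}/g' eqxx e ec; congr npair; apply/tuple_codeP => i hi.
    by rewrite /g'; case: eqP hi => // ->; rewrite ltnn.
  by exists (tuple_code n g), (g n); split=> //; exists g; split=> //; rewrite /= -glueS.
have lt1 (x y : M) : x <= y -> x < y + 1 by move/(ltS_le hM).
apply: (@D0_exb _ (fun e => e O + 1)); first by tf.
  by move=> e c [a [-> _]]; exact/lt1/le_npair2.
apply: (@D0_exb _ (fun e => e 1%N + 1)); first by tf.
  by move=> e a; rewrite /tail => -[-> _]; exact/lt1/le_npair1.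
apply: D0_and; first by d0.
pose r (i : nat) := match i with O => 1%N | 1%N => O | S (S j) => j.+3 end.
apply: D0_ext (D0_ren r IH) => e.
rewrite (_ : (fun i => e (r i)) = scons (tail e O) (scons (e O) (tail (tail (tail e))))) //.
by apply: functional_extensionality => -[|[|i]].
Qed.

(** The codes of the tuples that have a witness form a projection, hence a set by [sigma1_set]. The
    quantified statement thus becomes atomic, namely membership of [tuple_code N e] in that set, and
    [D0] absorbs unbounded quantifiers. *)
Lemma D0_exists P N : supported P N -> D0 P -> D0 (fun e => exists x, P (scons x e)).
Proof.
(* The renaming places the witness at index [N], just after the [N] variables to be packed. *)
move=> hN hP; pose r (i : nat) := if i is S j then j else N.
pose P' h := P (fun i => h (r i)).
have hP' : D0 P' by exact: D0_ren.
pose A x c := decoded N P' (scons c (fun _ => x)).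
have hA : D0 (fun e => A (e O) (e 1%N)).
  pose r' (i : nat) := if i is O then 1%N else O.
  apply: D0_ext (D0_ren r' (D0_decoded N hP')) => e.
  rewrite (_ : (fun i => e (r' i)) = scons (e 1%N) (fun=> e O)) //.
  by apply: functional_extensionality => -[].
have hY := sigma1_set hA.
apply: D0_ext (D0_mem hY (tuple_code_term N)) => e.
have key g x : (forall i, (i < N)%N -> e i = g i) ->
    P' (glue N g (tail (scons (tuple_code N e) (fun=> x)))) <-> P (scons x e).
  move=> eg; apply: hN => -[|i] hi /=; first by rewrite /glue ltnn.
  by rewrite /glue (ltnW hi) eg // ltnW.
split=> [[x [g [/tuple_codeP eg h]]]|[x h]]; first by exists x; apply/(key g).
by exists x, e; split=> //; apply/key.
Qed.

Lemma D0_sat s (p : formula) : (forall i, is_set (s i)) -> D0 (fun e => sat s e p).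
Proof.
move=> hs; have tm (t : term) : term_fun (fun e : nat -> M => eval e t).
  elim: t => [i|||t ht u hu|t ht u hu]; [exact: TF_var|exact: TF_const|exact: TF_const|
    exact: TF_add|exact: TF_mul].
elim: p => /= [t u|t u|t X|p hp|p hp q hq|p hp q hq|p hp q hq|p hp|p hp].
- exact: D0_eq.
- exact: D0_lt.
- exact: D0_mem.
- exact: D0_not.
- exact: D0_and.
- exact: D0_or.
- exact: D0_imp.
- have [N hN] := sat_support s p.
  apply: (@D0_ext _ (fun e => ~ exists x, ~ sat s (scons x e) p)).
    move=> e; split=> [h x|h [x]]; last by apply.
    by apply: NNPP => n; apply: h; exists x.
  apply: D0_not; apply: (@D0_exists (fun e => ~ sat s e p) N); last exact: D0_not.
  by move=> e e' he; rewrite (hN e e' he).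
- by have [N hN] := sat_support s p; exact: D0_exists hN _.
Qed.

Lemma ACA0_of_sigma1 : ACA0 M.
Proof.
split; first by case: hM.
- by move=> X hX X0 XS; apply: (d0_ind hM) => //; d0.
- move=> s e p hs; exists (fun x : M => sat s (scons x e) p) => //.
  apply: (d0_set hM).
  pose f (i : nat) := if i is S j then (fun _ : nat -> M => e j) else (fun e' => e' O).
  apply: D0_ext (D0_sub (f := f) _ (D0_sat p hs)); last first.
    by case=> [|i]; [exact: TF_var | exact: TF_const].
  move=> e'; rewrite (_ : (fun i => f i e') = scons (e' O) e) //.
  by apply: functional_extensionality => -[].
Qed.

End Arithmetical.

Theorem theorem5p3 (M : L2_structure) (hM : RCA0 M) :
  [<-> ACA0 M;
       separated_pairs_buried M;
       many_components_buried M;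
       not_uniquely_orderable_buried M].
Proof.
split; first exact: ACA0_separated_pairs.
split; first exact: many_components_of_separated.
split; first exact: not_uniquely_orderable_of_many_components.
by move=> h4; apply: ACA0_of_sigma1 => //; exact: sigma1_of_buried.
Qed.
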